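(* Let $\Omega\subset\mathbb{C}$ be a domain, and let $f$ be a nonconstant holomorphic function on $\Omega$ such that $Z(f):=\{z\in\Omega: f(z)=0\}\neq\emptyset$ and $|f|<\frac{1}{10}$ on $\Omega$. Define $$v(z):=\begin{cases}\dfrac{1}{\log\bigl(-\log|f(z)|^2\bigr)}, & z\in\Omega\setminus Z(f),\\[6pt] 0, & z\in Z(f),\end{cases}\qquad g_v(z):=\begin{cases}\Delta v(z), & z\in\Omega\setminus Z(f),\\ 0, & z\in Z(f),\end{cases}$$ where $\Delta v$ is the classical Laplacian on $\Omega\setminus Z(f)$. Then: (1) $v$ is continuous on $\Omega$, $v\in L^\infty(\Omega)$ and $v\in W^{1,2}_{\mathrm{loc}}(\Omega)$; but for every $p>2$, every $a\in Z(f)$ and every open neighborhood $V\subset\Omega$ of $a$, $v\notin W^{1,p}_{\mathrm{loc}}(V)$; (2) $g_v\in L^1_{\mathrm{loc}}(\Omega)$; (3) $\Delta v=g_v$ on $\Omega$ in the sense of distributions; (4) $v\in W^{2,1}_{\mathrm{loc}}(\Omega)$, but for every $p>1$, every $a\in Z(f)$ and every open neighborhood $V\subset\Omega$ of $a$, $v\notin W^{2,p}_{\mathrm{loc}}(V)$.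
   Context: $W^{k,p}_{\mathrm{loc}}(V)$ is the space of functions on $V$ whose weak derivatives of order $\le k$ exist and belong to $L^p_{\mathrm{loc}}(V)$. The Laplacian is $\Delta v = 4\frac{\partial^2 v}{\partial z\,\partial\bar z}$. ''In the sense of distributions'' means $\int_\Omega v\,\Delta\varphi\,dA=\int_\Omega g_v\,\varphi\,dA$ for all $\varphi\in C_c^\infty(\Omega)$, with $dA$ Lebesgue measure. *)

(* Defs.v *)
(* MathComp-Analysis, over an arbitrary [R : realType]; the complex plane is
   the type [R[i]] of mathcomp-real-closed. *)
From HB Require Import structures.
From mathcomp Require Import all_boot all_order all_algebra.
From mathcomp Require Import complex.
From mathcomp Require Import all_classical all_reals all_analysis.

Set Implicit Arguments.
Unset Strict Implicit.
Unset Printing Implicit Defensive.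

Import Order.TTheory GRing.Theory Num.Theory.
Import numFieldNormedType.Exports.

Local Open Scope classical_set_scope.
Local Open Scope ring_scope.
Local Open Scope complex_scope.

(* [R[i]] normed over itself: the usual topology of the plane, and [derivable]
   along [1] is complex differentiability. *)
#[warnings="-redundant-canonical-projection"]
HB.instance Definition _ (R : rcfType) := NormedModule.copy R[i] R[i]^o.

Definition absc {R : realType} (z : R[i]) : R := ComplexField.Normc.normc z.

Definition domain {R : realType} (Omega : set R[i]) : Prop :=
  [/\ open Omega, connected Omega & Omega !=set0].

Definition holomorphic_on {R : realType} (Omega : set R[i])
    (f : R[i] -> R[i]) : Prop :=
  forall z, Omega z -> derivable f z 1.

Definition constant_on {R : realType} (Omega : set R[i])
    (f : R[i] -> R[i]) : Prop :=
  exists c, forall z, Omega z -> f z = c.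

(* [R[i]] carries no sigma-algebra in the library, so the area measure
   dA is Lebesgue measure on [R * R], transported along [of_plane]. *)
Definition of_plane {R : realType} (p : R * R) : R[i] := p.1 +i* p.2.

Definition area {R : realType} :=
  (@lebesgue_measure R \x @lebesgue_measure R)%E.

Definition area_integral {R : realType} (V : set R[i]) (u : R[i] -> R) : \bar R :=
  (\int[area]_(p in of_plane @^-1` V) (u (of_plane p))%:E)%E.

(* The exponent [p] may be [+oo]. [Lfun] asks for Borel measurability; every
   Lebesgue measurable function agrees a.e. with a Borel one. *)
Definition Lp_on {R : realType} (p : \bar R) (V : set R[i])
    (u : R[i] -> R) : Prop :=
  ((u \_ V) \o of_plane) \in Lfun (@area R) p.

Definition Lp_loc {R : realType} (p : \bar R) (V : set R[i])
    (u : R[i] -> R) : Prop :=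
  forall K, compact K -> K `<=` V -> Lp_on p K u.

Definition derivable_x {R : realType} (u : R[i] -> R) (z : R[i]) : Prop :=
  derivable (fun t : R => u (z + t%:C)) 0 1.

Definition derivable_y {R : realType} (u : R[i] -> R) (z : R[i]) : Prop :=
  derivable (fun t : R => u (z + t *i)) 0 1.

Definition dx {R : realType} (u : R[i] -> R) (z : R[i]) : R :=
  derive1 (fun t : R => u (z + t%:C)) 0.

Definition dy {R : realType} (u : R[i] -> R) (z : R[i]) : R :=
  derive1 (fun t : R => u (z + t *i)) 0.

Definition partial {R : realType} (i j : nat) (u : R[i] -> R) : R[i] -> R :=
  iter i dx (iter j dy u).

Definition dxC {R : realType} (u : R[i] -> R[i]) (z : R[i]) : R[i] :=
  dx (fun w => complex.Re (u w)) z +i* dx (fun w => complex.Im (u w)) z.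

Definition dyC {R : realType} (u : R[i] -> R[i]) (z : R[i]) : R[i] :=
  dy (fun w => complex.Re (u w)) z +i* dy (fun w => complex.Im (u w)) z.

Definition d_z {R : realType} (u : R[i] -> R[i]) (z : R[i]) : R[i] :=
  (dxC u z - 'i * dyC u z) / 2%:R.

Definition d_zbar {R : realType} (u : R[i] -> R[i]) (z : R[i]) : R[i] :=
  (dxC u z + 'i * dyC u z) / 2%:R.

(* For real-valued [u] of class C^2 the value 4 d_z d_zbar u is real; [Re] only
   brings it back to the type [R]. *)
Definition laplacian {R : realType} (u : R[i] -> R) (z : R[i]) : R :=
  complex.Re (4%:R * d_z (d_zbar (fun w => (u w)%:C)) z).

Fixpoint Ck {R : realType} (n : nat) (phi : R[i] -> R) : Prop :=
  continuous phi /\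
  if n is m.+1 then
    [/\ forall z, derivable_x phi z /\ derivable_y phi z,
        Ck m (dx phi) & Ck m (dy phi)]
  else True.

Definition test_function {R : realType} (V : set R[i])
    (phi : R[i] -> R) : Prop :=
  let supp := closure [set z | phi z != 0] in
  [/\ forall n, Ck n phi, compact supp & supp `<=` V].

Definition weak_partial {R : realType} (V : set R[i]) (i j : nat)
    (u w : R[i] -> R) : Prop :=
  [/\ Lp_loc 1%:E V u, Lp_loc 1%:E V w &
      forall phi, test_function V phi ->
        area_integral V (fun z => u z * partial i j phi z) =
        (((-1) ^+ (i + j))%:E * area_integral V (fun z => w z * phi z)%R)%E].

Definition Sobolev_loc {R : realType} (k : nat) (p : \bar R) (V : set R[i])
    (u : R[i] -> R) : Prop :=
  forall i j : nat, (i + j <= k)%N ->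
    exists w, weak_partial V i j u w /\ Lp_loc p V w.

Definition distributional_laplacian {R : realType} (V : set R[i])
    (u g : R[i] -> R) : Prop :=
  forall phi, test_function V phi ->
    area_integral V (fun z => u z * laplacian phi z) =
    area_integral V (fun z => g z * phi z).

Definition zeros {R : realType} (Omega : set R[i]) (f : R[i] -> R[i]) :
    set R[i] :=
  [set z | Omega z /\ f z = 0].

(* [f] is total, but is only used on an open set Omega; near a point of Omega
   these functions depend on the values of [f] on Omega alone. *)
Definition vfun {R : realType} (f : R[i] -> R[i]) (z : R[i]) : R :=
  if f z == 0 then 0 else (ln (- ln (absc (f z) ^+ 2)))^-1.

Definition gfun {R : realType} (f : R[i] -> R[i]) (z : R[i]) : R :=
  if f z == 0 then 0 else laplacian (vfun f) z.

(* Main.v *)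
Require Import Defs.
From HB Require Import structures.
From mathcomp Require Import all_boot all_order all_algebra.
From mathcomp Require Import complex.
From mathcomp Require Import all_classical all_reals all_analysis.
From mathcomp Require Import measurable_realfun ess_sup_inf ring lra.

(* Put S = - log |f|^2, L = log S, v = 1/L and q = f'/f.  Off the zeros of f all
   partial derivatives of v of order at most 2 are dominated by
   Q = (|q|^2 + |q'|) / (S L^2), up to a factor and an additive constant.  At a
   zero a of order m one has q = m/(z-a) + O(1), so Q is at most of the order of
   1 / (r^2 (-log r) log^2(-log r)) with r = |z-a|, and this is integrable in the
   plane: r times it is the derivative of 1/log(-log r).

   To pass from classical to weak derivatives, multiply the test function by the
   cutoff ((1 - eps L)_+)^2, which vanishes near the zeros and tends to 1 as
   eps -> 0; its gradient is again controlled by Q, so dominated convergence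
   removes it.

   Conversely, on a small box at distance about eps to the right of a one has
   v_x >= c eps^-1 |log eps|^-3 and v_yy >= c eps^-2 |log eps|^-3.  Testing a
   weak derivative in L^p against a bump on this box, of mass about eps^2, bounds
   eps^2 by a constant times (eps^s |log eps|^3)^p with s = 1 or 2, which fails
   for small eps as soon as p s > 2. *)

Set Implicit Arguments.
Unset Strict Implicit.
Unset Printing Implicit Defensive.
Import Order.TTheory GRing.Theory Num.Theory.
Import numFieldNormedType.Exports.
Local Open Scope classical_set_scope.
Local Open Scope ring_scope.
Local Open Scope complex_scope.

(** The weight L in the cutoff is suited to v = 1/L. The gradient of the cutoff has size eps L^2
    |grad v|, and eps L <= 1 on its support, so differentiating it costs one factor L. For u = v
    this factor is paid by v L = 1; for u a first derivative of v, of size D1 |q|, it is paid by D1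
    L = 1/(S L) <= 1. The square makes the cutoff C^1, so that the fundamental theorem of calculus
    applies on every line.

    The bound 1/10 gives S > 2 log 10 > 4 > e, hence L > 1; the estimates rest on these two
    inequalities.

    The box lies to the right of the zero because Re q' < 0 there: v_yy is then a sum of two
    nonnegative terms, whereas the terms of v_xx have opposite signs. The power 3 of the logarithm
    comes from log S <= S in 1/(S log^2 S); any power would be harmless against a power of eps.

    The factorisation f = (z - a)^m g with g zero-free near a, which gives the behaviour of q, is
    derived from Cauchy's formula on rectangles, written as a quotient of two boundary integrals. *)

Section Plane.
Context {R : realType}.
Implicit Types (z w : R[i]) (u : R[i] -> R).

Lemma normcE_absc z : `|z| = (absc z)%:C.
Proof. by case: z => a b; rewrite normc_def. Qed.

Lemma absc_ge0 z : 0 <= absc z.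
Proof. by case: z => a b; exact: sqrtr_ge0. Qed.

Lemma absc0 : absc (0 : R[i]) = 0.
Proof. exact: ComplexField.Normc.normc0. Qed.

Lemma absc1 : absc (1 : R[i]) = 1.
Proof. exact: ComplexField.Normc.normc1. Qed.

Lemma absc_eq0 z : (absc z == 0) = (z == 0).
Proof.
apply/eqP/eqP => [|->]; last exact: absc0.
exact: ComplexField.Normc.eq0_normc.
Qed.

Lemma absc_gt0 z : (0 < absc z) = (z != 0).
Proof. by rewrite lt_def absc_ge0 andbT absc_eq0. Qed.

Lemma abscM z w : absc (z * w) = absc z * absc w.
Proof. exact: ComplexField.Normc.normcM. Qed.

Lemma abscV z : absc z^-1 = (absc z)^-1.
Proof. exact: ComplexField.Normc.normcV. Qed.

Lemma abscX z n : absc (z ^+ n) = absc z ^+ n.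
Proof. by elim: n => [|n ih]; rewrite ?expr0 ?absc1// !exprS abscM ih. Qed.

Lemma abscN z : absc (- z) = absc z.
Proof. exact: normcN. Qed.

Lemma absc_distC z w : absc (z - w) = absc (w - z).
Proof. by rewrite -abscN opprB. Qed.

Lemma ler_abscD z w : absc (z + w) <= absc z + absc w.
Proof. exact: le_normcD. Qed.

Lemma ler_abscB z w : absc (z - w) <= absc z + absc w.
Proof. by rewrite -(abscN w) ler_abscD. Qed.

Lemma lerB_absc z w : absc z - absc w <= absc (z - w).
Proof. by rewrite lerBlDr -{1}(subrK w z) ler_abscD. Qed.

Lemma absc_sqr z : absc z ^+ 2 = complex.Re z ^+ 2 + complex.Im z ^+ 2.
Proof.
by case: z => a b; rewrite /absc /= sqr_sqrtr// addr_ge0// sqr_ge0.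
Qed.

Lemma absc_real (t : R) : absc t%:C = `|t|.
Proof. by rewrite /absc /= expr0n addr0 sqrtr_sqr. Qed.

Lemma absc_imag (t : R) : absc (t *i) = `|t|.
Proof. by rewrite /absc /= expr0n add0r sqrtr_sqr. Qed.

Lemma ler_Re_absc z : `|complex.Re z| <= absc z.
Proof.
rewrite -(@ler_pXn2r _ 2)// ?nnegrE ?absc_ge0// absc_sqr real_normK ?num_real//.
by rewrite lerDl sqr_ge0.
Qed.

Lemma ler_Im_absc z : `|complex.Im z| <= absc z.
Proof.
rewrite -(@ler_pXn2r _ 2)// ?nnegrE ?absc_ge0// absc_sqr real_normK ?num_real//.
by rewrite lerDr sqr_ge0.
Qed.

Lemma ler_absc_ReIm z : absc z <= `|complex.Re z| + `|complex.Im z|.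
Proof.
rewrite {1}(complexE z) (le_trans (ler_abscD _ _))// abscM !absc_real.
by rewrite absc_imag normr1 mul1r.
Qed.

(** Radii of balls are elements of [R[i]]; in its partial order [0 < d] forces d to be real, so
    balls are ordinary discs. *)
Lemma absc_ballE z (d : R[i]) w : 0 < d -> ball z d w = (absc (w - z) < complex.Re d) :> Prop.
Proof.
move=> d0; rewrite -ball_normE /ball_ /= normcE_absc -absc_distC.
move: d0; rewrite ltcE /= => /andP[/eqP di dr].
by rewrite ltcE /= di eqxx.
Qed.

Lemma nbhs_absc z (A : set R[i]) :
  nbhs z A <-> exists2 d : R, 0 < d & forall w, absc (w - z) < d -> A w.
Proof.
split.
  move=> /nbhs_ballP[d /= d0 dA]; exists (complex.Re d).
    by move: d0; rewrite ltcE /= => /andP[].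
  by move=> w wd; apply: dA; rewrite absc_ballE.
move=> [d d0 dA]; apply/nbhs_ballP; exists d%:C; first by rewrite /= ltcR.
by move=> w; rewrite absc_ballE ?ltcR//=; exact: dA.
Qed.

Lemma open_absc (A : set R[i]) z : open A -> A z ->
  exists2 d : R, 0 < d & forall w, absc (w - z) < d -> A w.
Proof. by move=> oA Az; apply/nbhs_absc; exact: open_nbhs_nbhs. Qed.

Lemma open_abscP (A : set R[i]) :
  (forall z, A z -> exists2 d : R, 0 < d & forall w, absc (w - z) < d -> A w) ->
  open A.
Proof. by move=> h; rewrite openE => z Az; apply/nbhs_absc; exact: h. Qed.

Lemma continuous_abscP (V : pseudoMetricNormedZmodType R) (u : R[i] -> V) z :
  {for z, continuous u} <-> forall e : R, 0 < e -> exists2 d : R, 0 < d &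
    forall w, absc (w - z) < d -> `|u w - u z| < e.
Proof.
split=> [/cvgrPdist_lt h e e0|h].
  by have /nbhs_absc[d d0 hd] := h e e0; exists d => // w /hd; rewrite distrC.
apply: (iffRL (@cvgrPdist_lt _ _ _ (nbhs z) _ u (u z))) => e e0; apply/nbhs_absc; have [d d0 hd] := h e e0.
by exists d => // w /hd; rewrite distrC.
Qed.

Lemma continuousC_abscP (u : R[i] -> R[i]) z :
  {for z, continuous u} <-> forall e : R, 0 < e -> exists2 d : R, 0 < d &
    forall w, absc (w - z) < d -> absc (u w - u z) < e.
Proof.
split=> [/cvgrPdist_lt h e e0|h].
  have e0' : 0 < e%:C by rewrite ltcR.
  have /nbhs_absc[d d0 hd] := h e%:C e0'.
  by exists d => // w /hd; rewrite normcE_absc ltcR absc_distC.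
apply: (iffRL (@cvgrPdist_lt _ _ _ (nbhs z) _ u (u z))) => e; rewrite ltcE /= => /andP[/eqP ei e0].
apply/nbhs_absc; have [d d0 hd] := h _ e0.
by exists d => // w /hd; rewrite normcE_absc ltcE/= ei eqxx absc_distC.
Qed.

(** The form without a quotient, with a weak inequality, includes h = 0 and composes with estimates
    of integrals; [has_cderivP] identifies it with the usual derivative. *)
Definition has_cderiv (f : R[i] -> R[i]) z (l : R[i]) :=
  forall e : R, 0 < e -> exists2 d : R, 0 < d &
    forall h, absc h < d -> absc (f (z + h) - f z - l * h) <= e * absc h.

Lemma has_cderivP (f : R[i] -> R[i]) z l : has_cderiv f z l <-> is_derive z 1 f l.
Proof.
split=> [h|[df <-] e e0].
  have cv : h^-1 *: ((f \o shift z) (h *: (1 : R[i])) - f z) @[h --> 0^'] --> l.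
    apply/cvgrPdist_le => e; rewrite ltcE /= => /andP[/eqP ei e0].
    have [d d0 hd] := h _ e0.
    apply/nbhs_absc; exists d => // w /=; rewrite subr0 => wd w0.
    rewrite normcE_absc lecE /= ei eqxx/= absc_distC -(ler_pM2r (_ : 0 < absc w)) ?absc_gt0//.
    rewrite -abscM (le_trans _ (hd _ wd))//.
    suff -> : (w^-1 *: (f (w *: 1 + z) - f z) - l) * w = f (z + w) - f z - l * w by [].
    have -> : w *: (1 : R[i]) = w by rewrite /GRing.scale/= mulr1.
    by rewrite /GRing.scale /= mulrBl mulrAC mulVf// mul1r (addrC w).
  apply: DeriveDef; first by apply/cvg_ex; exists l.
  exact: cvg_lim cv.
move: df => /cvgrPdist_le/(_ e%:C); rewrite ltcR => /(_ e0) /nbhs_absc[d d0 hd].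
exists d => // h hh; have [->|h0] := eqVneq h 0.
  by rewrite addr0 mulr0 !subr0 subrr absc0 mulr0.
move: (hd h); rewrite /= subr0 => /(_ hh h0).
rewrite normcE_absc lecR => hd'.
have -> : f (z + h) - f z - 'D_1 f z * h =
    - (('D_1 f z - h^-1 *: (f (h *: 1 + z) - f z)) * h).
  have -> : h *: (1 : R[i]) = h by rewrite /GRing.scale/= mulr1.
  by rewrite /GRing.scale /= mulrBl [_ * _ * h]mulrAC mulVf// mul1r (addrC h) opprB.
by rewrite abscN abscM ler_pM2r// absc_gt0.
Qed.

End Plane.

(** * Cauchy's theorem and formula on rectangles *)

Section SegmentIntegral.
Context {R : realType}.
Implicit Types (z w : R[i]) (g : R -> R[i]) (a b : R).
Local Notation mu := (@lebesgue_measure R).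

Definition cint a b g : R[i] :=
  (\int[mu]_(x in `[a, b]) complex.Re (g x)) +i*
  (\int[mu]_(x in `[a, b]) complex.Im (g x)).

(** Two-sided continuity, also at the end points: every integrand below is the restriction to a side
    of a function continuous at each point of that side as a point of the plane. *)
Definition ccont a b g := forall t, t \in `[a, b] -> {for t, continuous g}.

Lemma continuous_Re_comp g t : {for t, continuous g} ->
  {for t, continuous (fun x => complex.Re (g x))}.
Proof.
move=> /(@cvgrPdist_lt _ _ _ _ _ g (g t)) h.
apply/(@cvgrPdist_lt _ _ _ _ _ (fun x => complex.Re (g x))) => e e0.
have e0' : 0 < e%:C by rewrite ltcR.
apply: filterS (h _ e0') => x; rewrite normcE_absc ltcR; apply: le_lt_trans.
by rewrite (le_trans _ (ler_Re_absc _))//; case: (g t) => ? ?; case: (g x).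
Qed.

Lemma continuous_Im_comp g t : {for t, continuous g} ->
  {for t, continuous (fun x => complex.Im (g x))}.
Proof.
move=> /(@cvgrPdist_lt _ _ _ _ _ g (g t)) h.
apply/(@cvgrPdist_lt _ _ _ _ _ (fun x => complex.Im (g x))) => e e0.
have e0' : 0 < e%:C by rewrite ltcR.
apply: filterS (h _ e0') => x; rewrite normcE_absc ltcR; apply: le_lt_trans.
by rewrite (le_trans _ (ler_Im_absc _))//; case: (g t) => ? ?; case: (g x).
Qed.

Lemma integrable_continuous_at a b (u : R -> R) :
  (forall t, t \in `[a, b] -> {for t, continuous u}) ->
  mu.-integrable `[a, b] (EFin \o u).
Proof.
move=> h; apply: continuous_compact_integrable; first exact: segment_compact.
by apply: continuous_in_subspaceT => x; rewrite inE /=; exact: h.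
Qed.

Lemma ccont_Re a b g : ccont a b g ->
  mu.-integrable `[a, b] (EFin \o (fun x => complex.Re (g x))).
Proof.
by move=> h; apply: integrable_continuous_at => t /h; exact: continuous_Re_comp.
Qed.

Lemma ccont_Im a b g : ccont a b g ->
  mu.-integrable `[a, b] (EFin \o (fun x => complex.Im (g x))).
Proof.
by move=> h; apply: integrable_continuous_at => t /h; exact: continuous_Im_comp.
Qed.

Lemma eq_cint a b g1 g2 : (forall t, t \in `[a, b] -> g1 t = g2 t) ->
  cint a b g1 = cint a b g2.
Proof.
by move=> h; congr (_ +i* _); apply: eq_Rintegral => x; rewrite inE/= => /h ->.
Qed.

Lemma cintD a b g1 g2 : ccont a b g1 -> ccont a b g2 ->
  cint a b (fun x => g1 x + g2 x) = cint a b g1 + cint a b g2.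
Proof.
move=> h1 h2; rewrite /cint.
transitivity (Complex (\int[mu]_(x in `[a, b]) (complex.Re (g1 x) + complex.Re (g2 x)))
  (\int[mu]_(x in `[a, b]) (complex.Im (g1 x) + complex.Im (g2 x)))).
  by congr (_ +i* _); apply: eq_Rintegral => x _; case: (g1 x); case: (g2 x).
by rewrite !RintegralD//; [exact: ccont_Im..|exact: ccont_Re|exact: ccont_Re].
Qed.

Lemma cintZ a b (k : R[i]) g : ccont a b g ->
  cint a b (fun x => k * g x) = k * cint a b g.
Proof.
case: k => k l h; rewrite /cint /=.
have hr := ccont_Re h; have hi := ccont_Im h.
transitivity (Complex
  (\int[mu]_(x in `[a, b]) (k * complex.Re (g x) - l * complex.Im (g x)))
  (\int[mu]_(x in `[a, b]) (k * complex.Im (g x) + l * complex.Re (g x)))).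
  by congr (_ +i* _); apply: eq_Rintegral => x _; case: (g x).
have Z (m : R) (u : R -> R) : mu.-integrable `[a, b] (EFin \o u) ->
    mu.-integrable `[a, b] (EFin \o (fun x => m * u x)).
  by move=> hu; exact: (@integrableZl _ _ _ mu `[a, b]%classic _ m (EFin \o u)).
rewrite RintegralB// ?RintegralD//; try exact: Z.
by rewrite !RintegralZl.
Qed.

Lemma cint_cst a b (k : R[i]) : a <= b -> cint a b (fun=> k) = (b - a)%:C * k.
Proof.
move=> ab; rewrite /cint !Rintegral_cst//= lebesgue_measure_itv/= lte_fin.
have -> : fine (if (a < b)%R then b%:E - a%:E else 0)%E = b - a.
  case: ltgtP ab => // -> _; by rewrite subrr.
by case: k => k l /=; simpc; rewrite !(mulrC _ (b - a)).
Qed.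

Lemma cint_split a b c g : a <= c -> c <= b -> ccont a b g ->
  cint a b g = cint a c g + cint c b g.
Proof.
move=> ac cb h.
have S (u : R -> R) : mu.-integrable `[a, b] (EFin \o u) ->
    \int[mu]_(x in `[a, b]) u x = \int[mu]_(x in `[a, c]) u x + \int[mu]_(x in `[c, b]) u x.
  move=> hu; have -> : \int[mu]_(x in `[c, b]) u x = \int[mu]_(x in `]c, b]) u x.
    rewrite -(@Rintegral_itv_obnd_cbnd _ c (BRight b))//.
    apply: integrableS hu => //.
    by move=> x /=; rewrite !in_itv /= => /andP[/ltW/(le_trans ac) -> ->].
  by rewrite -(@Rintegral_itvB _ u (BLeft a) (BRight b) c hu) ?bnd_simp// addrC subrK.
rewrite /cint !S; [by []|exact: ccont_Im|exact: ccont_Re].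
Qed.

(** The factor 2 comes from estimating real and imaginary parts separately; such constants are
    immaterial in what follows. *)
Lemma cint_bound a b (M : R) g : a <= b -> ccont a b g ->
  (forall t, t \in `[a, b] -> absc (g t) <= M) ->
  absc (cint a b g) <= 2 * M * (b - a).
Proof.
move=> ab h hM.
have B (u : R -> R) : mu.-integrable `[a, b] (EFin \o u) ->
    (forall t, t \in `[a, b] -> `|u t| <= M) ->
    `|\int[mu]_(x in `[a, b]) u x| <= M * (b - a).
  move=> hu uM; apply: (le_trans (le_normr_Rintegral _ hu)) => //.
  have -> : M * (b - a) = \int[mu]_(x in `[a, b]) (cst M x).
    rewrite Rintegral_cst//= lebesgue_measure_itv/= lte_fin.
    case: ltgtP ab => // -> _; by rewrite subrr.
  apply: le_Rintegral => //; first exact: (integrable_norm hu).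
  by apply: integrable_continuous_at => t _; exact: cst_continuous.
apply: (le_trans (ler_absc_ReIm _)).
have -> : 2 * M * (b - a) = M * (b - a) + M * (b - a) by ring.
apply: lerD.
- apply: B; first exact: ccont_Re.
  by move=> t /hM; apply: le_trans; exact: ler_Re_absc.
- apply: B; first exact: ccont_Im.
  by move=> t /hM; apply: le_trans; exact: ler_Im_absc.
Qed.

End SegmentIntegral.

Section RectangleIntegral.
Context {R : realType}.
Implicit Types (z w : R[i]) (f g : R[i] -> R[i]) (a b c d : R).

Definition rect a b c d z :=
  a <= complex.Re z <= b /\ c <= complex.Im z <= d.

Definition bdry a b c d z := rect a b c d z /\
  [|| complex.Re z == a, complex.Re z == b, complex.Im z == c | complex.Im z == d].

Definition cont_on (A : set R[i]) f := forall z, A z -> {for z, continuous f}.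

(** The contour integral of f(z) dz over the boundary, counterclockwise; on the vertical sides dz =
    i dy. *)
Definition rint a b c d f : R[i] :=
  cint a b (fun x => f (x +i* c)) - cint a b (fun x => f (x +i* d)) +
  'i * (cint c d (fun y => f (b +i* y)) - cint c d (fun y => f (a +i* y))).

Lemma continuous_hseg f t c : {for (t +i* c), continuous f} ->
  {for t, continuous (fun x => f (x +i* c))}.
Proof.
move=> h; set g := fun x : R => x +i* c.
have k : g @ nbhs t --> nbhs (t +i* c).
  apply: (iffRL (@cvgrPdist_lt _ _ _ (nbhs t) _ g (t +i* c))) => e.
  rewrite ltcE /= => /andP[/eqP ei e0].
  apply/nbhs_ballP; exists (complex.Re e); first by [].
  move=> x xe; rewrite /g.
  have -> : (t +i* c) - (x +i* c) = (t - x)%:C.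
    by apply/eqP; rewrite eq_complex/= subrr !eqxx.
  by rewrite normcE_absc absc_real ltcE/= ei eqxx.
apply: (@cvg_comp _ _ _ g f (nbhs t) (nbhs (t +i* c)) (nbhs (f (t +i* c)))).
  exact: k.
exact: h.
Qed.

Lemma continuous_vseg f t c : {for (c +i* t), continuous f} ->
  {for t, continuous (fun x => f (c +i* x))}.
Proof.
move=> h; set g := fun x : R => c +i* x.
have k : g @ nbhs t --> nbhs (c +i* t).
  apply: (iffRL (@cvgrPdist_lt _ _ _ (nbhs t) _ g (c +i* t))) => e.
  rewrite ltcE /= => /andP[/eqP ei e0].
  apply/nbhs_ballP; exists (complex.Re e); first by [].
  move=> x xe; rewrite /g.
  have -> : (c +i* t) - (c +i* x) = (t - x) *i.
    by apply/eqP; rewrite eq_complex/= subrr !eqxx.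
  by rewrite normcE_absc absc_imag ltcE/= ei eqxx.
apply: (@cvg_comp _ _ _ g f (nbhs t) (nbhs (c +i* t)) (nbhs (f (c +i* t)))).
  exact: k.
exact: h.
Qed.

Lemma ccont_h a b c0 f (A : set R[i]) : cont_on A f ->
  (forall x, a <= x <= b -> A (x +i* c0)) -> ccont a b (fun x => f (x +i* c0)).
Proof. by move=> h hA t; rewrite in_itv/= => /hA/h; exact: continuous_hseg. Qed.

Lemma ccont_v a b c0 f (A : set R[i]) : cont_on A f ->
  (forall x, a <= x <= b -> A (c0 +i* x)) -> ccont a b (fun x => f (c0 +i* x)).
Proof. by move=> h hA t; rewrite in_itv/= => /hA/h; exact: continuous_vseg. Qed.

Lemma bdry_h a b c d x : c <= d -> a <= x <= b ->
  bdry a b c d (x +i* c) /\ bdry a b c d (x +i* d).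
Proof. by move=> cd xab; rewrite /bdry /rect/= !lexx cd !eqxx !orbT. Qed.

Lemma bdry_v a b c d y : a <= b -> c <= y <= d ->
  bdry a b c d (a +i* y) /\ bdry a b c d (b +i* y).
Proof. by move=> cd xab; rewrite /bdry /rect/= !lexx cd !eqxx !orbT. Qed.

Lemma bdry_ccont a b c d f : a <= b -> c <= d -> cont_on (bdry a b c d) f ->
  [/\ ccont a b (fun x => f (x +i* c)), ccont a b (fun x => f (x +i* d)),
      ccont c d (fun x => f (b +i* x)) & ccont c d (fun x => f (a +i* x))].
Proof.
move=> ab cd h; split.
- by apply: (ccont_h h) => x xab; exact: (bdry_h cd xab).1.
- by apply: (ccont_h h) => x xab; exact: (bdry_h cd xab).2.
- by apply: (ccont_v h) => x xab; exact: (bdry_v ab xab).2.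
- by apply: (ccont_v h) => x xab; exact: (bdry_v ab xab).1.
Qed.

Lemma eq_rint a b c d f g : a <= b -> c <= d ->
  (forall z, bdry a b c d z -> f z = g z) -> rint a b c d f = rint a b c d g.
Proof.
move=> ab cd h; rewrite /rint; congr (_ - _ + 'i * (_ - _)); apply: eq_cint => t.
- by rewrite in_itv/= => /(bdry_h cd)[+ _]; exact: h.
- by rewrite in_itv/= => /(bdry_h cd)[_]; exact: h.
- by rewrite in_itv/= => /(bdry_v ab)[_]; exact: h.
- by rewrite in_itv/= => /(bdry_v ab)[+ _]; exact: h.
Qed.

Lemma rintD a b c d f g : a <= b -> c <= d ->
  cont_on (bdry a b c d) f -> cont_on (bdry a b c d) g ->
  rint a b c d (fun z => f z + g z) = rint a b c d f + rint a b c d g.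
Proof.
move=> ab cd /(bdry_ccont ab cd)[f1 f2 f3 f4] /(bdry_ccont ab cd)[g1 g2 g3 g4].
by rewrite /rint !cintD//; ring.
Qed.

Lemma rintZ a b c d k f : a <= b -> c <= d -> cont_on (bdry a b c d) f ->
  rint a b c d (fun z => k * f z) = k * rint a b c d f.
Proof.
move=> ab cd /(bdry_ccont ab cd)[f1 f2 f3 f4].
by rewrite /rint !cintZ//; ring.
Qed.

Lemma rint_bound a b c d M f : a <= b -> c <= d -> cont_on (bdry a b c d) f ->
  (forall z, bdry a b c d z -> absc (f z) <= M) ->
  absc (rint a b c d f) <= 4 * M * ((b - a) + (d - c)).
Proof.
move=> ab cd /(bdry_ccont ab cd)[f1 f2 f3 f4] fM.
have h1 : absc (cint a b (fun x => f (x +i* c))) <= 2 * M * (b - a).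
  by apply: cint_bound => // t; rewrite in_itv/= => /(bdry_h cd)[+ _]; exact: fM.
have h2 : absc (cint a b (fun x => f (x +i* d))) <= 2 * M * (b - a).
  by apply: cint_bound => // t; rewrite in_itv/= => /(bdry_h cd)[_]; exact: fM.
have h3 : absc (cint c d (fun x => f (b +i* x))) <= 2 * M * (d - c).
  by apply: cint_bound => // t; rewrite in_itv/= => /(bdry_v ab)[_]; exact: fM.
have h4 : absc (cint c d (fun x => f (a +i* x))) <= 2 * M * (d - c).
  by apply: cint_bound => // t; rewrite in_itv/= => /(bdry_v ab)[+ _]; exact: fM.
apply: (le_trans (ler_abscD _ _)); rewrite abscM absc_imag normr1 mul1r.
have -> : 4 * M * (b - a + (d - c)) =
  (2 * M * (b - a) + 2 * M * (b - a)) + (2 * M * (d - c) + 2 * M * (d - c)) by ring.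
by apply: lerD; apply: (le_trans (ler_abscB _ _)); exact: lerD.
Qed.

Lemma cont_onS (A B : set R[i]) f : A `<=` B -> cont_on B f -> cont_on A f.
Proof. by move=> AB h z /AB; exact: h. Qed.

Lemma bdryS a b c d : bdry a b c d `<=` rect a b c d.
Proof. by move=> z []. Qed.

Lemma rectS a b c d a' b' c' d' : a <= a' -> b' <= b -> c <= c' -> d' <= d ->
  rect a' b' c' d' `<=` rect a b c d.
Proof.
move=> aa bb cc dd z [/andP[h1 h2] /andP[h3 h4]]; split; apply/andP; split.
- exact: le_trans h1.
- exact: le_trans bb.
- exact: le_trans h3.
- exact: le_trans dd.
Qed.

Lemma rint_vsplit a b c d m f : a <= m -> m <= b -> c <= d ->
  cont_on (rect a b c d) f ->
  rint a b c d f = rint a m c d f + rint m b c d f.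
Proof.
move=> am mb cd h.
have hb := cont_onS (@bdryS a b c d) h.
have [f1 f2 _ _] := bdry_ccont (le_trans am mb) cd hb.
by rewrite /rint (cint_split am mb f1) (cint_split am mb f2); ring.
Qed.

Lemma rint_hsplit a b c d m f : a <= b -> c <= m -> m <= d ->
  cont_on (rect a b c d) f ->
  rint a b c d f = rint a b c m f + rint a b m d f.
Proof.
move=> ab cm md h.
have hb := cont_onS (@bdryS a b c d) h.
have [_ _ f1 f2] := bdry_ccont ab (le_trans cm md) hb.
by rewrite /rint (cint_split cm md f1) (cint_split cm md f2); ring.
Qed.

Lemma cont_cst (A : set R[i]) (k : R[i]) : cont_on A (fun=> k).
Proof. by move=> z _; exact: cst_continuous. Qed.

Lemma cont_id (A : set R[i]) : cont_on A (fun z => z).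
Proof. by move=> z _; exact: cvg_id. Qed.

Lemma cont_onD (A : set R[i]) f g : cont_on A f -> cont_on A g ->
  cont_on A (fun z => f z + g z).
Proof. by move=> hf hg z Az; apply: continuousD; [exact: hf|exact: hg]. Qed.

Lemma cont_onM (A : set R[i]) f g : cont_on A f -> cont_on A g ->
  cont_on A (fun z => f z * g z).
Proof. by move=> hf hg z Az; apply: continuousM; [exact: hf|exact: hg]. Qed.

Lemma rint_cst a b c d k : a <= b -> c <= d -> rint a b c d (fun=> k) = 0.
Proof. by move=> ab cd; rewrite /rint !subrr mulr0 addr0. Qed.

(** On opposite sides the integrands differ by a constant, (c - d) i for the horizontal and b - a
    for the vertical pair, and the two contributions cancel. *)
Lemma rint_id a b c d : a <= b -> c <= d -> rint a b c d id = 0.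
Proof.
move=> ab cd; have [f1 f2 f3 f4] := bdry_ccont ab cd (@cont_id (bdry a b c d)).
have s p q (g h : R -> R[i]) k : p <= q -> ccont p q g -> ccont p q h ->
    (forall t, g t = k + h t) -> cint p q g - cint p q h = (q - p)%:C * k.
  move=> pq cg ch e; rewrite -(cint_cst k pq).
  have ck : ccont p q (fun=> k) by move=> t _; exact: cst_continuous.
  have -> : cint p q g = cint p q (fun t => k + h t) by apply: eq_cint => t _; exact: e.
  by rewrite (cintD ck ch) addrK.
rewrite /rint (s _ _ _ _ ((c - d) *i) ab f1 f2); last first.
  by move=> t; apply/eqP; rewrite eq_complex/= add0r subrK !eqxx.
rewrite (s _ _ _ _ (b - a)%:C cd f3 f4); last first.
  by move=> t; apply/eqP; rewrite eq_complex/= add0r subrK !eqxx.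
by apply/eqP; rewrite eq_complex /=; simpc; apply/andP; split; apply/eqP => //; ring.
Qed.

Lemma has_cderiv_continuous f z l : has_cderiv f z l -> {for z, continuous f}.
Proof.
move=> /has_cderivP[df _]; apply: differentiable_continuous.
by apply/derivable1_diffP.
Qed.

End RectangleIntegral.

(** * Goursat's theorem for rectangles *)

Section Goursat.
Context {R : realType}.
Implicit Types (z w : R[i]) (f g : R[i] -> R[i]) (a b c d : R).

(** The affine part of f at z has boundary integral 0. What remains is at most e/4 times the half
    perimeter on the boundary, and [rint_bound] contributes 4 times the half perimeter. *)
Lemma rint_goursat_small f z l e : has_cderiv f z l -> 0 < e ->
  exists2 r : R, 0 < r & forall a b c d, a <= b -> c <= d -> rect a b c d z ->
    (b - a) + (d - c) < r -> cont_on (rect a b c d) f ->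
    absc (rint a b c d f) <= e * ((b - a) + (d - c)) ^+ 2.
Proof.
move=> fl e0; have e40 : 0 < e / 4 by rewrite divr_gt0.
have [r r0 hr] := fl _ e40; exists r => // a b c d ab cd zR small cf.
have cb := cont_onS (@bdryS R a b c d) cf.
pose g w := f w + (- l) * w + (l * z - f z).
have cl : cont_on (bdry a b c d) (fun w => - l * w).
  by apply: cont_onM; [exact: cont_cst|exact: cont_id].
have cfl : cont_on (bdry a b c d) (fun w => f w + (- l) * w) by exact: cont_onD.
have ck : cont_on (bdry a b c d) (fun=> l * z - f z) by exact: cont_cst.
have cg : cont_on (bdry a b c d) g by exact: (cont_onD cfl ck).
have -> : rint a b c d f = rint a b c d g.
  have ci := @cont_id R (bdry a b c d).
  rewrite /g (rintD ab cd cfl ck) (rintD ab cd cb cl) (rintZ (- l) ab cd ci).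
  by rewrite (rint_cst _ ab cd) (rint_id ab cd) mulr0 !addr0.
set D := (b - a) + (d - c).
have gM w : bdry a b c d w -> absc (g w) <= e / 4 * D.
  move=> /bdryS wR.
  have wD : absc (w - z) <= D.
    apply: (le_trans (ler_absc_ReIm _)).
    case: w wR => w1 w2; case: z zR {fl g ck cl cfl cg hr} => z1 z2.
    rewrite /rect/= => -[/andP[h1 h2] /andP[h3 h4]] [/andP[h5 h6] /andP[h7 h8]].
    by apply: lerD; rewrite ler_norml; apply/andP; split; lra.
  have -> : g w = f (z + (w - z)) - f z - l * (w - z).
    by rewrite /g [z + _]addrC subrK; ring.
  apply: (le_trans (hr _ _)); first exact: le_lt_trans wD small.
  by rewrite ler_pM2l.
apply: (le_trans (rint_bound ab cd cg gM)).
by rewrite -/D le_eqVlt; apply/orP; left; apply/eqP; field.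
Qed.

Lemma quarter_bisect a b c d f : a <= b -> c <= d -> cont_on (rect a b c d) f ->
  let m := (a + b) / 2 in let n := (c + d) / 2 in
  rint a b c d f = rint a m c n f + rint a m n d f + rint m b c n f + rint m b n d f.
Proof.
move=> ab cd cf m n.
have am : a <= m by rewrite /m; lra.
have mb : m <= b by rewrite /m; lra.
have cn : c <= n by rewrite /n; lra.
have nd : n <= d by rewrite /n; lra.
rewrite (rint_vsplit am mb cd cf).
rewrite (rint_hsplit am cn nd); last exact: cont_onS (rectS _ _ _ _) cf.
rewrite (rint_hsplit mb cn nd); last exact: cont_onS (rectS _ _ _ _) cf.
by rewrite addrA.
Qed.

(** Rectangles are given by corner and side lengths, so that the four quarters have the same [w']
    and [h']; if each of them had integral below J, their sum would be below 4 J. *)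
Lemma bisect_step (x y w h w' h' J : R) f : 0 <= w' -> 0 <= h' ->
  w = w' + w' -> h = h' + h' -> cont_on (rect x (x + w) y (y + h)) f ->
  4 * J <= absc (rint x (x + w) y (y + h) f) ->
  exists x' y', [/\ x <= x', x' + w' <= x + w, y <= y', y' + h' <= y + h &
    J <= absc (rint x' (x' + w') y' (y' + h') f)].
Proof.
move=> w0 h0 -> -> hc.
have xw : x <= x + (w' + w') by rewrite lerDl addr_ge0.
have yh : y <= y + (h' + h') by rewrite lerDl addr_ge0.
rewrite (quarter_bisect xw yh hc) {hc}.
have -> : (x + (x + (w' + w'))) / 2 = x + w' by field.
have -> : (y + (y + (h' + h'))) / 2 = y + h' by field.
rewrite (addrA x) (addrA y).
have xw' : x <= x + w' by rewrite lerDl.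
have yh' : y <= y + h' by rewrite lerDl.
have xw2 : x + w' <= x + w' + w' by rewrite lerDl.
have yh2 : y + h' <= y + h' + h' by rewrite lerDl.
set r2 := rint x _ y _ _; set r3 := rint x _ _ _ _.
set r4 := rint _ _ y _ _; set r5 := rint _ _ _ _ _ => Iin.
have {Iin} : 4 * J <= absc r2 + absc r3 + absc r4 + absc r5.
  apply: (le_trans Iin); apply: (le_trans (ler_abscD _ _)); rewrite lerD2r.
  by apply: (le_trans (ler_abscD _ _)); rewrite lerD2r; exact: ler_abscD.
have [k2 _|k2] := leP J (absc r2); first by exists x, y.
have [k3 _|k3] := leP J (absc r3); first by exists x, (y + h').
have [k4 _|k4] := leP J (absc r4); first by exists (x + w'), y.
have [k5 _|k5] := leP J (absc r5); first by exists (x + w'), (y + h').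
move: (absc r2) (absc r3) (absc r4) (absc r5) k2 k3 k4 k5 => t2 t3 t4 t5 *.
by exfalso; lra.
Qed.

Lemma nested_intervals (x y : nat -> R) :
  (forall n, x n <= x n.+1) -> (forall n, y n.+1 <= y n) ->
  (forall n, x n <= y n) -> exists l, forall n, x n <= l <= y n.
Proof.
move=> hx hy xy.
have mx : {homo x : m n / (m <= n)%N >-> m <= n}.
  by apply: homo_leq => //; exact: le_trans.
have my : {homo y : m n / (m <= n)%N >-> n <= m}.
  apply: (homo_leq (r := fun a b => b <= a)) => //.
  by move=> u v w vu wv; exact: le_trans vu.
have xy' m n : x m <= y n.
  have h1 := mx _ _ (leq_maxl m n); have h2 := my _ _ (leq_maxr m n).
  by apply: (le_trans h1); apply: le_trans h2.
have su : has_sup (range x).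
  by split; [exists (x 0), 0|exists (y 0) => _ [n _ <-]].
exists (sup (range x)) => n; apply/andP; split.
  by apply: (ub_le_sup su.2); exists n.
by apply: ge_sup; [exists (x 0), 0|move=> _ [m _ <-]].
Qed.

(** Goursat's bisection: if the integral had modulus I > 0, nested quarters of order n would keep at
    least I / 4^n, while differentiability at their common point bounds them by e D^2 / 4^n, D being
    the half perimeter. *)
Lemma goursat a b c d f : a <= b -> c <= d ->
  (forall z, rect a b c d z -> exists l, has_cderiv f z l) ->
  rint a b c d f = 0.
Proof.
move=> ab cd hf; apply/eqP; rewrite -absc_eq0 eq_le absc_ge0 andbT leNgt.
apply/negP; set I := absc _ => I0.
have cf : cont_on (rect a b c d) f.
  by move=> z /hf[l]; exact: has_cderiv_continuous.
pose W n := (b - a) / 2 ^+ n; pose H n := (d - c) / 2 ^+ n.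
have W0 n : 0 <= W n by rewrite divr_ge0 ?subr_ge0// exprn_ge0.
have H0 n : 0 <= H n by rewrite divr_ge0 ?subr_ge0// exprn_ge0.
have WS n : W n = W n.+1 + W n.+1.
  by rewrite /W exprS; field; rewrite expf_neq0.
have HS n : H n = H n.+1 + H n.+1.
  by rewrite /H exprS; field; rewrite expf_neq0.
pose P n (p : R * R) := [/\ a <= p.1, p.1 + W n <= b, c <= p.2, p.2 + H n <= d &
  I / 4 ^+ n <= absc (rint p.1 (p.1 + W n) p.2 (p.2 + H n) f)].
(* The invariant is put inside the existential so that a choice function exists on all pairs; where
   the invariant fails the witness is arbitrary. *)
have step (np : nat * (R * R)) : exists q : R * R, P np.1 np.2 ->
    [/\ P np.1.+1 q, np.2.1 <= q.1, q.1 + W np.1.+1 <= np.2.1 + W np.1,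
      np.2.2 <= q.2 & q.2 + H np.1.+1 <= np.2.2 + H np.1].
  case: np => n [x y]; rewrite /=.
  have [pP|nP] := pselect (P n (x, y)); last by exists (x, y).
  have [/= ax xb cy yd Iin] := pP.
  have hc : cont_on (rect x (x + W n) y (y + H n)) f.
    by apply: cont_onS cf; exact: rectS.
  have I4 : I / 4 ^+ n = 4 * (I / 4 ^+ n.+1).
    by rewrite exprS; field; rewrite expf_neq0.
  move: Iin; rewrite I4 => Iin.
  have [x' [y' [h1 h2 h3 h4 h5]]] := bisect_step (W0 n.+1) (H0 n.+1) (WS n) (HS n) hc Iin.
  exists (x', y') => _; split=> //; split=> //=.
  - exact: le_trans h1.
  - exact: le_trans xb.
  - exact: le_trans h3.
  - exact: le_trans yd.
have [nx hnx] := choice step.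
pose s := fix s n := if n is m.+1 then nx (m, s m) else (a, c).
have sP n : P n (s n).
  elim: n => [|n ih]; last by have [] := hnx (n, s n) ih.
  rewrite /P /s /= /W /H !expr0 !divr1 [a + _]addrC [c + _]addrC !subrK.
  by split.
have sN n := hnx (n, s n) (sP n).
have [X hX] : exists l, forall n, (s n).1 <= l <= (s n).1 + W n.
  apply: nested_intervals => n; try by have [] := sN n.
  by rewrite lerDl.
have [Y hY] : exists l, forall n, (s n).2 <= l <= (s n).2 + H n.
  apply: nested_intervals => n; try by have [] := sN n.
  by rewrite lerDl.
have zR n : rect (s n).1 ((s n).1 + W n) (s n).2 ((s n).2 + H n) (X +i* Y).
  by split; [exact: hX|exact: hY].
have Rn n : rect (s n).1 ((s n).1 + W n) (s n).2 ((s n).2 + H n) `<=` rect a b c d.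
  by have [? ? ? ? _] := sP n; apply: rectS.
have [l fl] := hf _ (Rn 0 _ (zR 0)).
pose D := (b - a) + (d - c).
have D0 : 0 <= D by rewrite addr_ge0// subr_ge0.
(* This tolerance satisfies e D^2 < I; [D + 1] keeps the denominator positive for a degenerate
   rectangle. *)
have e0 : 0 < I / (2 * (D + 1) ^+ 2).
  by rewrite divr_gt0// mulr_gt0// exprn_gt0// ltr_wpDl.
have [r r0 hr] := rint_goursat_small fl e0.
have [n hn] : exists n, D / 2 ^+ n < r.
  have Dr : 0 <= D / r by rewrite divr_ge0// ltW.
  exists (Num.bound (D / r)).
  rewrite ltr_pdivrMr ?exprn_gt0// mulrC -ltr_pdivrMr//.
  by rewrite (lt_trans (archi_boundP Dr))// -natrX ltr_nat ltn_expl.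
have [_ _ _ _ In] := sP n.
have cn : cont_on (rect (s n).1 ((s n).1 + W n) (s n).2 ((s n).2 + H n)) f.
  exact: cont_onS (Rn n) cf.
have := hr (s n).1 ((s n).1 + W n) (s n).2 ((s n).2 + H n).
rewrite !lerDl => /(_ (W0 n) (H0 n) (zR n)).
have -> : (s n).1 + W n - (s n).1 + ((s n).2 + H n - (s n).2) = D / 2 ^+ n.
  by rewrite /W /H /D; field; rewrite expf_neq0.
move=> /(_ hn cn) /(le_trans In).
have -> : (D / 2 ^+ n) ^+ 2 = D ^+ 2 / 4 ^+ n.
  by rewrite expr_div_n -exprM mulnC exprM; congr (_ / _ ^+ _); ring.
rewrite mulrA ler_pM2r ?invr_gt0 ?exprn_gt0//.
rewrite -mulrA -{1}(mulr1 I) ler_pM2l//.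
rewrite mulrC ler_pdivlMr ?mul1r; last by rewrite mulr_gt0// exprn_gt0// ltr_wpDl.
have : D ^+ 2 < (D + 1) ^+ 2 by rewrite ltrXn2r// ?ltrDl// ltr_wpDl.
by have := sqr_ge0 (D+1); lra.
Qed.

End Goursat.

(** * Rules for the complex derivative *)

Section ComplexDerivative.
Context {R : realType}.
Implicit Types (z w h : R[i]) (f g : R[i] -> R[i]).

Lemma has_cderivM f g z df dg : has_cderiv f z df -> has_cderiv g z dg ->
  has_cderiv (fun w => f w * g w) z (f z * dg + g z * df).
Proof.
move=> /has_cderivP hf /has_cderivP hg.
exact: (iffRL (has_cderivP _ _ _) (is_deriveM hf hg)).
Qed.

Lemma has_cderivD f g z df dg : has_cderiv f z df -> has_cderiv g z dg ->
  has_cderiv (fun w => f w + g w) z (df + dg).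
Proof.
move=> /has_cderivP hf /has_cderivP hg.
exact: (iffRL (has_cderivP _ _ _) (is_deriveD hf hg)).
Qed.

Lemma has_cderiv_cst z (k : R[i]) : has_cderiv (fun=> k) z 0.
Proof.
by move=> e e0; exists 1 => // h _; rewrite subrr mul0r subr0 absc0 mulr_ge0 ?absc_ge0 ?ltW.
Qed.

Lemma has_cderiv_id z : has_cderiv (fun w => w) z 1.
Proof.
move=> e e0; exists 1 => // h _.
by rewrite mul1r [z + h]addrC addrK subrr absc0 mulr_ge0 ?absc_ge0 ?ltW.
Qed.

Lemma has_cderivB f g z df dg : has_cderiv f z df -> has_cderiv g z dg ->
  has_cderiv (fun w => f w - g w) z (df - dg).
Proof.
move=> hf hg; have hN := has_cderivM (has_cderiv_cst z (-1)) hg.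
have := has_cderivD hf hN; rewrite mulN1r mulr0 addr0.
by under eq_fun do rewrite mulN1r.
Qed.

Lemma has_cderiv_near f g z l : (exists2 d : R, 0 < d & forall w, absc (w - z) < d -> f w = g w) ->
  has_cderiv f z l -> has_cderiv g z l.
Proof.
move=> [d d0 fg] hf e e0; have [r r0 hr] := hf _ e0.
exists (Num.min d r); first by rewrite lt_min d0.
move=> h; rewrite lt_min => /andP[hd hr'].
by rewrite -!fg ?hr// ?subrr ?absc0// addrC addKr.
Qed.

Lemma has_cderivV f z l : f z != 0 -> has_cderiv f z l ->
  has_cderiv (fun w => (f w)^-1) z (- l / f z ^+ 2).
Proof.
move=> fz0 hf e e0.
set A := absc (f z); have A0 : 0 < A by rewrite absc_gt0.
have cf := has_cderiv_continuous hf.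
(* In the error of the inverse, a fraction with denominator f(z)^2 B, each of the two terms of the
   numerator is to be at most e |h| A^3 / 4, while the denominator is at least A^3 / 2. [absc l + 1]
   covers l = 0. *)
have e1 : 0 < e * A ^+ 2 / 4 by rewrite divr_gt0// mulr_gt0// exprn_gt0.
have L0 : 0 < absc l + 1 by rewrite ltr_wpDl// absc_ge0.
have e2 : 0 < e * A ^+ 3 / 4 / (absc l + 1) by rewrite !divr_gt0// mulr_gt0// exprn_gt0.
have A2 : 0 < A / 2 by rewrite divr_gt0.
have [d1 d10 h1] := hf _ e1.
have [d2 d20 h2] := (continuousC_abscP _ _).1 cf _ e2.
have [d3 d30 h3] := (continuousC_abscP _ _).1 cf _ A2.
exists (Num.min d1 (Num.min d2 d3)); first by rewrite !lt_min d10 d20.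
move=> h; rewrite !lt_min => /and3P[/h1 {}h1 hd2 hd3].
have zh : z + h - z = h by rewrite addrC addKr.
have {}h2 : absc (f (z + h) - f z) < e * A ^+ 3 / 4 / (absc l + 1) by apply: h2; rewrite zh.
have {}h3 : absc (f (z + h) - f z) < A / 2 by apply: h3; rewrite zh.
set B := f (z + h) in h1 h2 h3 *.
have B2 : A / 2 <= absc B.
  have := lerB_absc (f z) (f z - B); rewrite subKr -/A.
  by rewrite absc_distC in h3; lra.
have B0 : B != 0 by rewrite -absc_gt0 (lt_le_trans A2).
have -> : B^-1 - (f z)^-1 - - l / f z ^+ 2 * h =
    (l * h * (B - f z) - (B - f z - l * h) * f z) / (f z ^+ 2 * B).
  by field; rewrite fz0 B0.
rewrite abscM abscV abscM abscX -/A ler_pdivrMr; last first.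
  by rewrite mulr_gt0 ?exprn_gt0 ?absc_gt0.
apply: (le_trans (ler_abscB _ _)); rewrite !abscM -/A.
have lh : absc l * absc h * absc (B - f z) <= absc h * (e * A ^+ 3 / 4).
  rewrite mulrAC mulrC ler_wpM2l ?absc_ge0//.
  move: h2; rewrite ltr_pdivlMr// => /ltW; apply: le_trans.
  rewrite mulrDr mulr1 mulrC lerDl; exact: absc_ge0.
have rA : absc (B - f z - l * h) * A <= e * A ^+ 2 / 4 * absc h * A.
  by apply: ler_wpM2r; [exact: ltW|exact: h1].
apply: (le_trans (lerD lh rA)).
have -> : absc h * (e * A ^+ 3 / 4) + e * A ^+ 2 / 4 * absc h * A =
  e * absc h * (A ^+ 2 * (A / 2)) by field.
apply: ler_wpM2l; first by rewrite mulr_ge0 ?absc_ge0// ltW.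
by apply: ler_wpM2l => //; exact: sqr_ge0.
Qed.

Lemma has_cderiv_unique f z l l' : has_cderiv f z l -> has_cderiv f z l' -> l = l'.
Proof. by move=> /has_cderivP[_ <-] /has_cderivP[_ <-]. Qed.

Lemma has_cderivX f z l n : has_cderiv f z l ->
  has_cderiv (fun w => f w ^+ n) z (n%:R * f z ^+ n.-1 * l).
Proof.
move=> hf; elim: n => [|n ih].
  rewrite mul0r mul0r; under eq_fun do rewrite expr0.
  exact: has_cderiv_cst.
have := has_cderivM hf ih; under eq_fun do rewrite -exprS.
suff -> : f z * (n%:R * f z ^+ n.-1 * l) + f z ^+ n * l = n.+1%:R * f z ^+ n.+1.-1 * l by [].
rewrite -natr1 /=; case: n {ih} => [|n] /=; first by rewrite expr0; ring.
by rewrite exprS; ring.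
Qed.

End ComplexDerivative.

(** * Cauchy transforms on the boundary of a rectangle *)

Section Cauchy.
Context {R : realType}.
Variables (a b c d : R) (ab : a < b) (cd : c < d).
Implicit Types (z w h : R[i]) (f g : R[i] -> R[i]).

Definition interior_rect z := a < complex.Re z < b /\ c < complex.Im z < d.

Lemma interior_bdry_dist z : interior_rect z ->
  exists2 r : R, 0 < r & forall w, bdry a b c d w -> r <= absc (w - z).
Proof.
case: z => x y; rewrite /interior_rect /= => -[/andP[ax xb] /andP[cy yd]].
exists (Num.min (Num.min (x - a) (b - x)) (Num.min (y - c) (d - y))).
  by rewrite !lt_min !subr_gt0 ax xb cy yd.
move=> w [_ /or4P[]] /eqP e; rewrite !ge_min.
- have := ler_Re_absc (w - (x +i* y)); case: w e => /= w1 w2 -> h.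
  have -> : x - a <= absc ((a +i* w2) - (x +i* y)); last by rewrite ?orbT.
  by apply: le_trans h; rewrite distrC ler_norm.
- have := ler_Re_absc (w - (x +i* y)); case: w e => /= w1 w2 -> h.
  have -> : b - x <= absc ((b +i* w2) - (x +i* y)); last by rewrite ?orbT.
  by apply: le_trans h; rewrite ler_norm.
- have := ler_Im_absc (w - (x +i* y)); case: w e => /= w1 w2 -> h.
  have -> : y - c <= absc ((w1 +i* c) - (x +i* y)); last by rewrite ?orbT.
  by apply: le_trans h; rewrite distrC ler_norm.
- have := ler_Im_absc (w - (x +i* y)); case: w e => /= w1 w2 -> h.
  have -> : d - y <= absc ((w1 +i* d) - (x +i* y)); last by rewrite ?orbT.
  by apply: le_trans h; rewrite ler_norm.
Qed.

Lemma cont_kernel z (A : set R[i]) : ~ A z -> cont_on A (fun w => (w - z)^-1).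
Proof.
move=> nAz w Aw; have wz : w - z != 0 by rewrite subr_eq0; apply/eqP => e; rewrite e in Aw.
have k := has_cderivB (has_cderiv_id w) (has_cderiv_cst w z).
exact: has_cderiv_continuous (@has_cderivV R (fun w => w - z) w _ wz k).
Qed.

(** Differentiation under the integral sign: a remainder quadratic in h, uniformly on the boundary,
    passes through [rint_bound] and stays quadratic. *)
Lemma rint_param_deriv (k : R[i] -> R[i] -> R[i]) (k' : R[i] -> R[i]) z (C r : R) :
  0 < r -> (forall h, absc h < r -> cont_on (bdry a b c d) (k (z + h))) ->
  cont_on (bdry a b c d) k' ->
  (forall h w, absc h < r -> bdry a b c d w ->
     absc (k (z + h) w - k z w - k' w * h) <= C * absc h ^+ 2) ->
  has_cderiv (fun z => rint a b c d (k z)) z (rint a b c d k').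
Proof.
move=> r0 ck ck' hk e e0.
have ab' := ltW ab; have cd' := ltW cd.
set P := (b - a) + (d - c).
have P0 : 0 < P by rewrite addr_gt0// subr_gt0.
pose D := 4 * `|C| * P + 1.
have D0 : 0 < D by rewrite /D ltr_wpDl// mulr_ge0 ?mulr_ge0// ltW.
exists (Num.min r (e / D)); first by rewrite lt_min r0 divr_gt0.
move=> h; rewrite lt_min => /andP[hr he].
have c0 : cont_on (bdry a b c d) (k z) by rewrite -[z]addr0; apply: ck; rewrite absc0.
have c1 := ck _ hr.
have c2 := cont_onM (@cont_cst _ (bdry a b c d) (-1)) c0.
have c3 := cont_onM (@cont_cst _ (bdry a b c d) (- h)) ck'.
have c12 := cont_onD c1 c2; have c123 := cont_onD c12 c3.
have -> : rint a b c d (k (z + h)) - rint a b c d (k z) - rint a b c d k' * h =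
    rint a b c d (fun w => k (z + h) w + - 1 * k z w + (- h) * k' w).
  by rewrite (rintD ab' cd' c12 c3) (rintD ab' cd' c1 c2) (rintZ _ ab' cd' c0) (rintZ _ ab' cd' ck'); ring.
apply: (@le_trans _ _ (4 * (`|C| * absc h ^+ 2) * P)).
  apply: (rint_bound ab' cd' c123) => w /(hk _ _ hr).
  have -> : k (z + h) w - k z w - k' w * h = k (z + h) w + -1 * k z w + - h * k' w by ring.
  by move=> /le_trans; apply; rewrite ler_wpM2r ?sqr_ge0// ler_norm.
have -> : 4 * (`|C| * absc h ^+ 2) * P = (4 * `|C| * P * absc h) * absc h by ring.
rewrite ler_wpM2r ?absc_ge0//.
move: he; rewrite ltr_pdivlMr// => /ltW; apply: le_trans.
by rewrite mulrC ler_wpM2l ?absc_ge0// lerDl.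
Qed.

End Cauchy.

Section CauchyKernel.
Context {R : realType}.
Variables (a b c d : R) (ab : a < b) (cd : c < d).
Implicit Types (z w h : R[i]) (f g G : R[i] -> R[i]).
Local Notation bd := (bdry a b c d).
Local Notation int := (interior_rect a b c d).
Let ab' := ltW ab.
Let cd' := ltW cd.

(** The Cauchy transform of boundary data that need only be continuous, not normalised by 2 pi i;
    [cauchyT2] is its derivative in z. *)
Definition cauchyT G z := rint a b c d (fun w => G w * (w - z)^-1).
Definition cauchyT2 G z := rint a b c d (fun w => G w * (w - z)^-1 * (w - z)^-1).

Lemma compact_bound_bdry G : cont_on bd G ->
  exists2 M : R, 0 < M & forall w, bd w -> absc (G w) <= M.
Proof.
move=> cG; have [g1 g2 g3 g4] := bdry_ccont ab' cd' cG.
have B p q (g : R -> R[i]) : p <= q -> ccont p q g ->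
    exists M, forall t, t \in `[p, q] -> absc (g t) <= M.
  move=> pq cg.
  have ca : {within `[p, q], continuous (fun t => absc (g t))}.
    apply: continuous_in_subspaceT => t; rewrite inE/= => tpq.
    apply/(@cvgrPdist_lt _ _ _ _ _ (fun t => absc (g t))) => e e0.
    have e0' : 0 < e%:C by rewrite ltcR.
    have /(@cvgrPdist_lt _ _ _ _ _ g (g t)) := cg t tpq.
    move=> /(_ _ e0'); apply: filterS => x.
    rewrite normcE_absc ltcR; apply: le_lt_trans; rewrite ler_norml.
    have := lerB_absc (g t) (g x); have := lerB_absc (g x) (g t).
    by rewrite (absc_distC (g x)) => ? ?; apply/andP; split; lra.
  by have [x _ hx] := EVT_max pq ca; exists (absc (g x)).
have [M1 h1] := B _ _ _ ab' g1; have [M2 h2] := B _ _ _ ab' g2.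
have [M3 h3] := B _ _ _ cd' g3; have [M4 h4] := B _ _ _ cd' g4.
exists (`|M1| + `|M2| + `|M3| + `|M4| + 1); first by rewrite ltr_wpDl// !addr_ge0.
have := normr_ge0 M1; have := normr_ge0 M2; have := normr_ge0 M3; have := normr_ge0 M4.
have := ler_norm M1; have := ler_norm M2; have := ler_norm M3; have := ler_norm M4.
move=> m1 m2 m3 m4 n1 n2 n3 n4 [x y] [[/= hx hy] /or4P[]] /eqP e.
- by have := h4 y; rewrite in_itv/= => /(_ hy); rewrite e; lra.
- by have := h3 y; rewrite in_itv/= => /(_ hy); rewrite e; lra.
- by have := h1 x; rewrite in_itv/= => /(_ hx); rewrite e; lra.
- by have := h2 x; rewrite in_itv/= => /(_ hx); rewrite e; lra.
Qed.

Lemma cont_kernelT G z : cont_on bd G -> ~ bd z -> cont_on bd (fun w => G w * (w - z)^-1).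
Proof. by move=> cG nz; exact: (cont_onM cG (cont_kernel nz)). Qed.

Lemma far_bdry z r : 0 < r -> (forall w, bd w -> r <= absc (w - z)) ->
  forall h, absc h < r / 2 -> (~ bd (z + h)) /\ forall w, bd w -> r / 2 <= absc (w - z - h).
Proof.
move=> r0 hr h hh.
have k w : bd w -> r / 2 <= absc (w - z - h).
  by move=> /hr rw; have := lerB_absc (w - z) h; lra.
split=> // /k; rewrite [z + h]addrC addrK subrr absc0.
by rewrite leNgt divr_gt0.
Qed.

Lemma cauchyT_deriv G z : cont_on bd G -> int z ->
  has_cderiv (cauchyT G) z (cauchyT2 G z).
Proof.
move=> cG iz; have [r r0 hr] := interior_bdry_dist iz.
have far := far_bdry r0 hr.
have [M M0 hM] := compact_bound_bdry cG.
have nz : ~ bd z by have [] := far 0; rewrite ?absc0 ?divr_gt0// addr0.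
have c1 := cont_kernelT cG nz.
(* With u = w - z the remainder is h^2 / (u^2 (u - h)), where |u| >= r and |u - h| >= r/2. *)
apply: (rint_param_deriv ab cd (C := M * (2 / r ^+ 3)) (r := r / 2)).
- by rewrite divr_gt0.
- by move=> h hh; exact: (cont_kernelT cG (far h hh).1).
- exact: (cont_kernelT c1 nz).
move=> h w hh wb.
have := (far h hh).2 w wb; have := hr w wb; set u := w - z => ur uhr.
have u0 : u != 0 by rewrite -absc_gt0 (lt_le_trans r0).
have uh0 : u - h != 0 by rewrite -absc_gt0 (lt_le_trans _ uhr)// divr_gt0.
have -> : w - (z + h) = u - h by rewrite /u opprD addrA.
have -> : G w * (u - h)^-1 - G w * u^-1 - G w * u^-1 * u^-1 * h =
    G w * (u^-1 * u^-1 * (u - h)^-1) * h ^+ 2.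
  by field; rewrite u0 uh0.
rewrite abscM abscX ler_wpM2r ?sqr_ge0// abscM.
have r2 : 0 < r / 2 by rewrite divr_gt0.
apply: ler_pM; rewrite ?mulr_ge0 ?absc_ge0 ?hM//.
have -> : 2 / r ^+ 3 = r^-1 * r^-1 * (r / 2)^-1 by field; rewrite gt_eqF.
by rewrite !abscM !abscV; apply: ler_pM; rewrite ?mulr_ge0 ?invr_ge0 ?absc_ge0//;
  [apply: ler_pM; rewrite ?invr_ge0 ?absc_ge0// lef_pV2 ?posrE// (lt_le_trans r0)
  |rewrite lef_pV2 ?posrE// (lt_le_trans r2)].
Qed.

(** This second differentiation is what makes the derivative of a holomorphic function holomorphic
    in [hol_cderiv]. *)
Lemma cauchyT2_deriv G z : cont_on bd G -> int z ->
  exists l, has_cderiv (cauchyT2 G) z l.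
Proof.
move=> cG iz; have [r r0 hr] := interior_bdry_dist iz.
have far := far_bdry r0 hr.
have [M M0 hM] := compact_bound_bdry cG.
have nz : ~ bd z by have [] := far 0; rewrite ?absc0 ?divr_gt0// addr0.
have c1 := cont_kernelT cG nz; have c2 := cont_kernelT c1 nz; have c3 := cont_kernelT c2 nz.
have c4 := cont_onM (@cont_cst _ bd 2) c3.
eexists.
apply: (rint_param_deriv ab cd (C := M * (8 / r ^+ 4)) (r := r / 2) _ _ c4).
(* The constant 8 is 4 + 4: the remainder is h^2 times 1/(u^2 (u - h)^2) + 2/(u^3 (u - h)), and each
   summand is at most 4 / r^4. *)
- by rewrite divr_gt0.
- move=> h hh; have k := (far h hh).1.
  exact: (cont_kernelT (cont_kernelT cG k) k).
move=> h w hh wb.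
have := (far h hh).2 w wb; have := hr w wb; set u := w - z => ur uhr.
have u0 : u != 0 by rewrite -absc_gt0 (lt_le_trans r0).
have uh0 : u - h != 0 by rewrite -absc_gt0 (lt_le_trans _ uhr)// divr_gt0.
have -> : w - (z + h) = u - h by rewrite /u opprD addrA.
have -> : G w * (u - h)^-1 * (u - h)^-1 - G w * u^-1 * u^-1 -
    2 * (G w * u^-1 * u^-1 * u^-1) * h =
    G w * (u^-1 * u^-1 * (u - h)^-1 * (u - h)^-1 + 2 * (u^-1 * u^-1 * u^-1 * (u - h)^-1)) * h ^+ 2.
  by field; rewrite u0 uh0.
rewrite abscM abscX ler_wpM2r ?sqr_ge0// abscM.
have r2 : 0 < r / 2 by rewrite divr_gt0.
apply: ler_pM; rewrite ?absc_ge0 ?hM//.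
apply: (le_trans (ler_abscD _ _)).
have U0 : 0 <= (absc u)^-1 by rewrite invr_ge0 absc_ge0.
have V0 : 0 <= (absc (u - h))^-1 by rewrite invr_ge0 absc_ge0.
have Ur : (absc u)^-1 <= r^-1 by rewrite lef_pV2 ?posrE// (lt_le_trans r0).
have Vr : (absc (u - h))^-1 <= (r / 2)^-1 by rewrite lef_pV2 ?posrE// (lt_le_trans r2).
have -> : 8 / r ^+ 4 = r^-1 * r^-1 * (r / 2)^-1 * (r / 2)^-1 +
   2 * (r^-1 * r^-1 * r^-1 * (r / 2)^-1) by field; rewrite gt_eqF.
rewrite !abscM !abscV.
have -> : absc (2 : R[i]) = 2.
  have -> : (2 : R[i]) = (2 : R)%:C by rewrite rmorphMn /=.
  by rewrite absc_real ger0_norm.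
by apply: lerD; do 3 ?[apply: ler_pM; rewrite ?mulr_ge0//]; apply: ler_pM; rewrite ?mulr_ge0//; apply: ler_pM; rewrite ?mulr_ge0//;  apply: ler_pM; rewrite ?mulr_ge0.
Qed.

End CauchyKernel.

(** * Cauchy's integral formula *)

Section CauchyFormula.
Context {R : realType}.
Variables (a b c d : R) (ab : a < b) (cd : c < d).
Implicit Types (z w h : R[i]) (f g G : R[i] -> R[i]).
Local Notation bd := (bdry a b c d).
Local Notation int := (interior_rect a b c d).
Let ab' := ltW ab.
Let cd' := ltW cd.

Lemma interior_not_bdry z : int z -> ~ bd z.
Proof.
move=> iz bz; have [r r0 /(_ z bz)] := interior_bdry_dist iz.
by rewrite subrr absc0 leNgt r0.
Qed.

Lemma has_cderiv_quot f z w : w != z -> (exists l, has_cderiv f w l) ->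
  exists l, has_cderiv (fun w => (f w - f z) * (w - z)^-1) w l.
Proof.
move=> wz [l fl]; have wz' : w - z != 0 by rewrite subr_eq0.
have h1 := has_cderivB fl (has_cderiv_cst w (f z)).
have h2 := has_cderivB (has_cderiv_id w) (has_cderiv_cst w z).
have h3 := @has_cderivV R (fun w => w - z) w _ wz' h2.
eexists; exact: (has_cderivM h1 h3).
Qed.

(** The difference quotient, extended by f'(z), is continuous, bounded near z and differentiable
    away from z. By Goursat only a square of side 2 t about z contributes, and its contribution is
    O(t). *)
Lemma rint_quot0 f z : int z -> (forall w, rect a b c d w -> exists l, has_cderiv f w l) ->
  rint a b c d (fun w => (f w - f z) * (w - z)^-1) = 0.
Proof.
case: z => x y iz hf; have [/andP[/= ax xb] /andP[/= cy yd]] := iz.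
set z := x +i* y in iz *.
have zR : rect a b c d z by split=> /=; apply/andP; split; exact: ltW.
have [l fl] := hf z zR.
pose K w := if w == z then l else (f w - f z) * (w - z)^-1.
have -> : rint a b c d (fun w => (f w - f z) * (w - z)^-1) = rint a b c d K.
  apply: eq_rint => // w wb; rewrite /K; case: eqP => // wz.
  by case: (interior_not_bdry iz); rewrite -wz.
have Kd w : rect a b c d w -> w != z -> exists l, has_cderiv K w l.
  move=> wR wz; have [m hm] := has_cderiv_quot wz (hf w wR); exists m.
  apply: has_cderiv_near hm; exists (absc (w - z)).
    by rewrite absc_gt0 subr_eq0.
  move=> u uw; rewrite /K; case: eqP => // uz.
  by move: uw; rewrite uz absc_distC ltxx.
have Kb e : 0 < e -> exists2 r : R, 0 < r & forall w, absc (w - z) < r -> absc (K w - l) <= e.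
  move=> e0; have [r r0 hr] := fl _ e0; exists r => // w /hr.
  rewrite /K; case: eqP => [_ _|/eqP wz]; first by rewrite subrr absc0 ltW.
  have -> : z + (w - z) = w by rewrite addrC subrK.
  have wz' : w - z != 0 by rewrite subr_eq0.
  have -> : f w - f z - l * (w - z) = ((f w - f z) * (w - z)^-1 - l) * (w - z).
    by field.
  by rewrite abscM ler_pM2r// absc_gt0.
have Kc : cont_on (rect a b c d) K.
  move=> w wR; have [->|wz] := eqVneq w z; last first.
    by have [m hm] := Kd w wR wz; exact: has_cderiv_continuous hm.
  apply/continuousC_abscP => e e0.
  have e20 : 0 < e / 2 by rewrite divr_gt0.
  have [r r0 hr] := Kb _ e20; exists r => // u /hr.
  have -> : K z = l by rewrite /K eqxx.
  by move=> /le_lt_trans; apply; lra.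
have [r r0 hr] := Kb 1 ltr01.
have M0 : 0 < absc l + 1 by rewrite ltr_wpDl// absc_ge0.
have Kr w : absc (w - z) < r -> absc (K w) <= absc l + 1.
  by move=> /hr h; have := ler_abscD (K w - l) l; rewrite subrK; lra.
have small t : 0 < t -> t < r / 2 -> t < x - a -> t < b - x -> t < y - c -> t < d - y ->
    absc (rint a b c d K) <= 4 * (absc l + 1) * (4 * t).
  move=> t0 t1 t2 t3 t4 t5.
  have o1 : a <= x - t by lra.
  have o2 : x - t <= x + t by lra.
  have o3 : x + t <= b by lra.
  have o4 : c <= y - t by lra.
  have o5 : y - t <= y + t by lra.
  have o6 : y + t <= d by lra.
  have xtb : x - t <= b by lra.
  have ytd : y - t <= d by lra.
  have z0 p q p' q' : p <= q -> p' <= q' -> a <= p -> q <= b -> c <= p' -> q' <= d ->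
      (q < x) || (x < p) || (q' < y) || (y < p') -> rint p q p' q' K = 0.
    move=> pq pq' ap qb cp qd out; apply: goursat => // w wR.
    apply: Kd; first by apply: rectS wR.
    apply: contraTneq out => wz; move: wR; rewrite wz /z => -[/= /andP[h1 h2] /andP[h3 h4]].
    by rewrite !negb_or -!leNgt h1 h2 h3 h4.
  have c1 : cont_on (rect (x - t) b c d) K by apply: cont_onS Kc; exact: rectS.
  have c2 : cont_on (rect (x - t) (x + t) c d) K by apply: cont_onS Kc; exact: rectS.
  have c3 : cont_on (rect (x - t) (x + t) (y - t) d) K by apply: cont_onS Kc; exact: rectS.
  have c4 : cont_on (rect (x - t) (x + t) (y - t) (y + t)) K by apply: cont_onS Kc; exact: rectS.
  have axt : a <= x + t by lra.
  have cyt : c <= y + t by lra.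
  have xlt : x - t < x by lra.
  have xgt : x < x + t by lra.
  have ylt : y - t < y by lra.
  have ygt : y < y + t by lra.
  have e1 : rint a (x - t) c d K = 0.
    by apply: z0; rewrite ?lexx ?xlt.
  have e2 : rint (x + t) b c d K = 0.
    by apply: z0; rewrite ?lexx ?xgt ?orbT.
  have e3 : rint (x - t) (x + t) c (y - t) K = 0.
    by apply: z0; rewrite ?lexx ?ylt ?orbT.
  have e4 : rint (x - t) (x + t) (y + t) d K = 0.
    by apply: z0; rewrite ?lexx ?ygt ?orbT.
  have -> : rint a b c d K = rint (x - t) (x + t) (y - t) (y + t) K.
    have E1 := rint_vsplit o1 xtb cd' Kc.
    have E2 := rint_vsplit o2 o3 cd' c1.
    have E3 := rint_hsplit o2 o4 ytd c2.
    have E4 := rint_hsplit o2 o5 o6 c3.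
    move: E1 E2 E3 E4; rewrite e1 e2 e3 e4.
    by move=> -> -> -> ->; rewrite add0r addr0 add0r addr0.
  have -> : 4 * t = (x + t - (x - t)) + (y + t - (y - t)) by ring.
  apply: (rint_bound o2 o5 (cont_onS (@bdryS _ _ _ _ _) c4)) => w /bdryS.
  case: w => w1 w2 [/= /andP[h1 h2] /andP[h3 h4]]; apply: Kr.
  apply: (le_lt_trans (ler_absc_ReIm _)); rewrite /=.
  have -> : r = r / 2 + r / 2 by field.
  by apply: ltrD; apply: le_lt_trans t1; rewrite ler_norml; apply/andP; split; lra.
apply/eqP; rewrite -absc_eq0 eq_le absc_ge0 andbT leNgt; apply/negP.
set I := absc _ in small * => I0.
(* With t = m/2 the square stays in the rectangle and in the disc where K is bounded; the second
   entry makes the bound 4 (|l| + 1) (4 t) smaller than I. *)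
pose m := Num.min (Num.min (r / 2) (I / (4 * (absc l + 1) * 4)))
   (Num.min (Num.min (x - a) (b - x)) (Num.min (y - c) (d - y))).
have m0 : 0 < m.
  rewrite /m !lt_min !subr_gt0 ax xb cy yd !divr_gt0//.
  by rewrite !mulr_gt0.
have mm : m / 2 < m by lra.
have := mm; rewrite {2}/m !lt_min => /andP[/andP[q1 q2] /andP[/andP[q3 q4] /andP[q5 q6]]].
have := small (m / 2) (ltac:(by rewrite divr_gt0)) q1 q3 q4 q5 q6.
apply/negP; rewrite -ltNge.
have -> : 4 * (absc l + 1) * (4 * (m / 2)) = m / 2 * (4 * (absc l + 1) * 4) by ring.
by rewrite -ltr_pdivlMr// !mulr_gt0.
Qed.

Lemma Re_Rintegral p q (g : R -> R[i]) : complex.Re (cint p q g) =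
  \int[lebesgue_measure]_(x in `[p, q]) complex.Re (g x).
Proof. by []. Qed.

Lemma cint_Re_gt0 (p q : R) (g : R -> R[i]) : p < q -> ccont p q g ->
  (forall t, t \in `[p, q] -> 0 < complex.Re (g t)) -> 0 < complex.Re (cint p q g).
Proof.
move=> pq cg g0; rewrite Re_Rintegral.
have cc : {within `[p, q], continuous (fun t => complex.Re (g t))}.
  apply: continuous_in_subspaceT => t; rewrite inE/= => tpq.
  by apply: continuous_Re_comp; exact: cg.
have [t tpq tmin] := EVT_min (ltW pq) cc.
have gt0 := g0 t tpq.
apply: (@lt_le_trans _ _ (\int[lebesgue_measure]_(x in `[p, q]) (cst (complex.Re (g t)) x))).
  rewrite Rintegral_cst//= lebesgue_measure_itv/= lte_fin pq -EFinB /=.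
  by rewrite mulr_gt0// subr_gt0.
apply: le_Rintegral => //.
- by apply: integrable_continuous_at => s _; exact: cst_continuous.
- exact: ccont_Re.
Qed.

Lemma cint_Im_gt0 (p q : R) (g : R -> R[i]) : p < q -> ccont p q g ->
  (forall t, t \in `[p, q] -> 0 < complex.Im (g t)) -> 0 < complex.Im (cint p q g).
Proof.
move=> pq cg g0.
have cg' : ccont p q (fun t => - 'i * g t).
  move=> t tpq; apply: (@continuousM _ _ (fun=> - 'i) g); [exact: cst_continuous|exact: cg].
have E z : complex.Re (- 'i * z) = complex.Im z by case: z => u v /=; ring.
have := cint_Re_gt0 pq cg'; rewrite (cintZ _ cg) E; apply => t /g0.
by rewrite E.
Qed.

(* Only the nonvanishing of this integral is needed, not its value 2 pi i: the
   imaginary part of each of the four sides is positive. *)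
Lemma cauchy_kernel_neq0 z : int z -> cauchyT a b c d (fun=> 1) z != 0.
Proof.
move=> iz; have nz := interior_not_bdry iz.
have ck := cont_kernelT (@cont_cst _ bd 1) nz.
have [g1 g2 g3 g4] := bdry_ccont ab' cd' ck.
case: z iz nz ck g1 g2 g3 g4 => x y [/= /andP[ax xb] /andP[cy yd]] nz ck g1 g2 g3 g4.
have den (u v : R) : u != 0 \/ v != 0 -> 0 < u ^+ 2 + v ^+ 2.
  move=> uv; rewrite lt_def paddr_eq0 ?sqr_ge0// !sqrf_eq0 addr_ge0 ?sqr_ge0// andbT.
  by case: uv => /negbTE ->; rewrite ?andbF.
have ReE (p q : R) : complex.Re (1 * ((p +i* q) - (x +i* y))^-1) =
   (p - x) / ((p - x) ^+ 2 + (q - y) ^+ 2) by rewrite mul1r.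
have ImE (p q : R) : complex.Im (1 * ((p +i* q) - (x +i* y))^-1) =
   - ((q - y) / ((p - x) ^+ 2 + (q - y) ^+ 2)) by rewrite mul1r.
have h1 := cint_Im_gt0 ab g1.
have h2 := cint_Im_gt0 ab (g := fun t => -1 * (1 * ((t +i* d) - (x +i* y))^-1)).
have h3 := cint_Re_gt0 cd g3.
have h4 := cint_Re_gt0 cd (g := fun t => -1 * (1 * ((a +i* t) - (x +i* y))^-1)).
have : 0 < complex.Im (cauchyT a b c d (fun=> 1) (x +i* y)).
  rewrite /cauchyT /rint.
  have E (u1 u2 u3 u4 : R[i]) : complex.Im (u1 - u2 + 'i * (u3 - u4)) =
     complex.Im u1 + complex.Im (-1 * u2) + complex.Re u3 + complex.Re (-1 * u4).
    by case: u1 u2 u3 u4 => [? ?] [? ?] [? ?] [? ?] /=; ring.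
  rewrite E.
  rewrite -(cintZ (-1) g2) -(cintZ (-1) g4).
  rewrite !addr_gt0//.
  - by apply: h1 => t _; rewrite ImE -mulNr divr_gt0// ?oppr_gt0 ?subr_lt0 ?den//; right; rewrite subr_eq0 lt_eqF.
  - apply: h2.
      by move=> t tt; apply: (@continuousM _ _ (fun=> -1)); [exact: cst_continuous|exact: g2].
    move=> t _; rewrite mulN1r.
    have -> w : complex.Im (- w) = - complex.Im w by case: w.
    by rewrite ImE opprK divr_gt0// ?subr_gt0// den//; right; rewrite subr_eq0 gt_eqF.
  - by apply: h3 => t _; rewrite ReE divr_gt0// ?subr_gt0// den//; left; rewrite subr_eq0 gt_eqF.
  - apply: h4.
      by move=> t tt; apply: (@continuousM _ _ (fun=> -1)); [exact: cst_continuous|exact: g4].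
    move=> t _; rewrite mulN1r.
    have -> w : complex.Re (- w) = - complex.Re w by case: w.
    by rewrite ReE -mulNr divr_gt0// ?oppr_gt0 ?subr_lt0// den//; left; rewrite subr_eq0 lt_eqF.
by apply: contraTneq => ->; rewrite ltxx.
Qed.

(** By [rint_quot0] the transform of f is f(z) times that of 1, and the latter does not vanish; the
    quotient takes the place of the factor 1/(2 pi i). *)
Lemma cauchy_formula f z : int z -> (forall w, rect a b c d w -> exists l, has_cderiv f w l) ->
  f z = cauchyT a b c d f z / cauchyT a b c d (fun=> 1) z.
Proof.
move=> iz hf; have nz := interior_not_bdry iz.
have cf : cont_on bd f.
  by move=> w /bdryS/hf[l]; exact: has_cderiv_continuous.
have c1 := cont_kernelT cf nz.
have c2 := cont_kernelT (@cont_cst _ bd 1) nz.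
have c3 := cont_onM (@cont_cst _ bd (- f z)) c2.
have E := rint_quot0 iz hf.
have k0 := cauchy_kernel_neq0 iz.
suff -> : cauchyT a b c d f z = f z * cauchyT a b c d (fun=> 1) z by rewrite mulfK.
apply/eqP; rewrite -subr_eq0 -mulNr /cauchyT -(rintZ _ ab' cd' c2) -(rintD ab' cd' c1 c3).
apply/eqP; rewrite -[RHS]E; apply: (eq_rint ab' cd') => w _.
by rewrite mul1r mulNr -mulrBl.
Qed.

End CauchyFormula.

(** * Zeros of holomorphic functions *)

Section Holomorphic.
Context {R : realType}.
Implicit Types (z w h : R[i]) (f g G : R[i] -> R[i]) (U : set R[i]).

Definition hol U f := forall z, U z -> exists l, has_cderiv f z l.

Definition cder f z : R[i] := 'D_1 f z.

Lemma hol_cder U f z : hol U f -> U z -> has_cderiv f z (cder f z).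
Proof. by move=> hf /hf[l]; move=> fl; have /has_cderivP[_ e] := fl; rewrite /cder e. Qed.

Lemma cder_eq f z l : has_cderiv f z l -> cder f z = l.
Proof. by move=> /has_cderivP[_ <-]. Qed.

Lemma holomorphic_hol U f : holomorphic_on U f -> hol U f.
Proof.
move=> hf z /hf d; exists ('D_1 f z); apply/has_cderivP.
exact: DeriveDef.
Qed.

Lemma square_sub U z : open U -> U z -> exists2 r : R, 0 < r &
  rect (complex.Re z - r) (complex.Re z + r) (complex.Im z - r) (complex.Im z + r) `<=` U.
Proof.
move=> oU Uz; have [d d0 hd] := open_absc oU Uz; exists (d / 4).
  by rewrite divr_gt0.
case: z {Uz} hd => x y hd [u v] [/= /andP[h1 h2] /andP[h3 h4]]; apply: hd.
apply: (le_lt_trans (ler_absc_ReIm _)); rewrite /=.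
have /le_lt_trans -> // : `|u - x| + `|v - y| <= d / 4 + d / 4.
  by apply: lerD; rewrite ler_norml; apply/andP; split; lra.
by lra.
Qed.

Lemma interior_near a b c d z : interior_rect a b c d z ->
  exists2 r : R, 0 < r & forall w, absc (w - z) < r -> interior_rect a b c d w.
Proof.
case: z => x y [/= /andP[h1 h2] /andP[h3 h4]].
exists (Num.min (Num.min (x - a) (b - x)) (Num.min (y - c) (d - y))).
  by rewrite !lt_min !subr_gt0 h1 h2 h3 h4.
move=> [u v]; rewrite !lt_min => /andP[/andP[k1 k2] /andP[k3 k4]].
have := ler_Re_absc ((u +i* v) - (x +i* y)); have := ler_Im_absc ((u +i* v) - (x +i* y)).
move: k1 k2 k3 k4; move: (absc _) => A k1 k2 k3 k4.
rewrite /= !ler_norml => /andP[p1 p2] /andP[p3 p4].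
by split=> /=; apply/andP; split; lra.
Qed.

Lemma interior_center z (r : R) : 0 < r ->
  interior_rect (complex.Re z - r) (complex.Re z + r) (complex.Im z - r) (complex.Im z + r) z.
Proof. by move=> r0; split; rewrite ltrBlDr ltrDl r0. Qed.

(** Near z, f is a quotient N/K of Cauchy transforms. K is treated as an arbitrary nonvanishing
    differentiable function, so [F] is the full quotient rule in N, K and their derivatives [N2],
    [K2], and each of these four functions is differentiable. *)
Lemma hol_cderiv U f : open U -> hol U f -> hol U (cder f).
Proof.
move=> oU hf z Uz; have [r r0 sq] := square_sub oU Uz.
set a := complex.Re z - r in sq; set b := complex.Re z + r in sq.
set c := complex.Im z - r in sq; set d := complex.Im z + r in sq.
have ab : a < b by rewrite /a /b; lra.
have cd : c < d by rewrite /c /d; lra.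
have iz : interior_rect a b c d z by exact: interior_center.
have hR w : rect a b c d w -> exists l, has_cderiv f w l by move=> /sq; exact: hf.
have cf : cont_on (bdry a b c d) f.
  by move=> w /bdryS/hR[l]; exact: has_cderiv_continuous.
have c1 := @cont_cst R (bdry a b c d) 1.
pose N := cauchyT a b c d f; pose K := cauchyT a b c d (fun=> 1).
pose N2 := cauchyT2 a b c d f; pose K2 := cauchyT2 a b c d (fun=> 1).
pose F w := N w * (- K2 w / K w ^+ 2) + (K w)^-1 * N2 w.
have near1 : exists2 r : R, 0 < r & forall w, absc (w - z) < r -> F w = cder f w.
  have [s s0 hs] := interior_near iz; exists s => // w /hs iw.
  apply/esym/cder_eq.
  have Kw := cauchy_kernel_neq0 ab cd iw.
  have dN := cauchyT_deriv ab cd cf iw; have dK := cauchyT_deriv ab cd c1 iw.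
  apply: (has_cderiv_near _ (has_cderivM dN (has_cderivV Kw dK))).
  have [t t0 ht] := interior_near iw; exists t => // u /ht iu.
  exact/esym/(cauchy_formula ab cd iu hR).
have Kz := cauchy_kernel_neq0 ab cd iz.
have dN := cauchyT_deriv ab cd cf iz; have dK := cauchyT_deriv ab cd c1 iz.
have [n2 dN2] := cauchyT2_deriv ab cd cf iz; have [k2 dK2] := cauchyT2_deriv ab cd c1 iz.
have i1 := has_cderivV Kz dK.
have Kz2 : K z ^+ 2 != 0 by rewrite expf_neq0.
have i2 := has_cderivV (f := fun w => K w ^+ 2) Kz2 (has_cderivX 2 dK).
have i3 := has_cderivM (has_cderivM (has_cderiv_cst z (-1)) dK2) i2.
have i4 := has_cderivD (has_cderivM dN i3) (has_cderivM i1 dN2).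
eexists; apply: has_cderiv_near i4.
have [s s0 hs] := near1; exists s => // w /hs <-.
by rewrite /F mulN1r.
Qed.

Lemma hol_continuous U f : hol U f -> cont_on U f.
Proof. by move=> hf z /hf[l]; exact: has_cderiv_continuous. Qed.

Lemma holM U f g : hol U f -> hol U g -> hol U (fun z => f z * g z).
Proof.
move=> hf hg z Uz; have [l fl] := hf z Uz; have [m gm] := hg z Uz.
by eexists; exact: has_cderivM fl gm.
Qed.

Lemma holV U f : hol U f -> (forall z, U z -> f z != 0) -> hol U (fun z => (f z)^-1).
Proof.
move=> hf f0 z Uz; have [l fl] := hf z Uz.
by eexists; exact: has_cderivV (f0 z Uz) fl.
Qed.

(* Iterating this identity yields Taylor expansion with remainder. *)
Lemma cauchyT_step a b c d G z w0 : a < b -> c < d -> cont_on (bdry a b c d) G ->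
  interior_rect a b c d z -> interior_rect a b c d w0 ->
  cauchyT a b c d G z = cauchyT a b c d G w0 +
    (z - w0) * cauchyT a b c d (fun w => G w * (w - w0)^-1) z.
Proof.
move=> ab cd cG iz iw.
have nz := interior_not_bdry iz; have nw := interior_not_bdry iw.
have c1 := cont_kernelT cG nw; have c2 := cont_kernelT c1 nz.
have c3 := cont_onM (@cont_cst _ (bdry a b c d) (z - w0)) c2.
rewrite /cauchyT -(rintZ _ (ltW ab) (ltW cd) c2) -(rintD (ltW ab) (ltW cd) c1 c3).
apply: (eq_rint (ltW ab) (ltW cd)) => w wb.
have uz : w - z != 0 by rewrite subr_eq0; apply/eqP => e; rewrite e in wb.
have uw : w - w0 != 0 by rewrite subr_eq0; apply/eqP => e; rewrite e in wb.
by field; rewrite uz uw.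
Qed.

Lemma cont_kernelX (A : set R[i]) G z n : cont_on A G -> ~ A z ->
  cont_on A (fun w => G w * (w - z)^-1 ^+ n).
Proof.
move=> cG nz; elim: n => [|n ih].
  by under eq_fun do rewrite expr0 mulr1.
have := cont_onM ih (cont_kernel nz).
by under eq_fun do rewrite -mulrA -exprSr.
Qed.

(** The dichotomy of Taylor coefficients at a: if all vanish, the remainder of every order tends to
    0 geometrically and f is 0 nearby; otherwise the first nonzero one gives the order m, and g is
    the remainder of order m. *)
Lemma hol_zero U f a : open U -> hol U f -> U a -> f a = 0 ->
  (exists2 d : R, 0 < d & forall z, absc (z - a) < d -> f z = 0) \/
  (exists m g, exists2 d : R, 0 < d & (0 < m)%N /\
    forall z, absc (z - a) < d -> [/\ U z, exists l, has_cderiv g z l, g z != 0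
      & f z = (z - a) ^+ m * g z]).
Proof.
move=> oU hf Ua fa0; have [r r0 sq] := square_sub oU Ua.
set a1 := complex.Re a - r in sq; set b := complex.Re a + r in sq.
set c := complex.Im a - r in sq; set d := complex.Im a + r in sq.
have ab : a1 < b by rewrite /a1 /b; lra.
have cd : c < d by rewrite /c /d; lra.
have ia : interior_rect a1 b c d a by exact: interior_center.
have hR w : rect a1 b c d w -> exists l, has_cderiv f w l by move=> /sq; exact: hf.
have cf : cont_on (bdry a1 b c d) f.
  by move=> w /bdryS/hR[l]; exact: has_cderiv_continuous.
have c1 := @cont_cst R (bdry a1 b c d) 1.
have na := interior_not_bdry ia.
(* [T n a] is, up to a nonzero factor, the n-th Taylor coefficient of f at a; [TE] below is the
   expansion whose first n coefficients vanish. *)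
pose G n w := f w * (w - a)^-1 ^+ n.
pose T n := cauchyT a1 b c d (G n).
have cG n : cont_on (bdry a1 b c d) (G n) by exact: cont_kernelX.
have T0 : T 0%N = cauchyT a1 b c d f.
  by rewrite /T /G; congr cauchyT; apply/funext => w; rewrite expr0 mulr1.
have TS n z : interior_rect a1 b c d z -> T n z = T n a + (z - a) * T n.+1 z.
  move=> iz; have E : (fun w => G n w * (w - a)^-1) = G n.+1.
    by apply/funext => w; rewrite /G exprSr mulrA.
  by rewrite /T (cauchyT_step ab cd (cG n) iz ia) E.
have TE n z : interior_rect a1 b c d z -> (forall k, (k < n)%N -> T k a = 0) ->
    T 0%N z = (z - a) ^+ n * T n z.
  move=> iz; elim: n => [_|n ih hk]; first by rewrite expr0 mul1r.
  rewrite ih; last by move=> k kn; apply: hk; rewrite ltnW.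
  by rewrite (TS n z iz) hk// add0r mulrA -exprSr.
have K0 := cauchy_kernel_neq0 ab cd.
have fE := cauchy_formula ab cd _ hR.
have [s s0 hs] := interior_near ia.
have [[k Tk]|allz] := pselect (exists k, T k a != 0); last first.
  left; have {}allz k : T k a = 0.
    by apply/eqP; apply: contrapT => /negP h; apply: allz; exists k.
  have [rho rho0 hrho] := interior_bdry_dist ia.
  have [M M0 hM] := compact_bound_bdry ab cd cf.
  (* For |z - a| < rho/4 and w on the boundary, |z - a| / |w - a| <= 1/4 and |w - z| >= rho/2,
     whence the decay like 4^-n. *)
  exists (Num.min s (rho / 4)); first by rewrite lt_min s0 divr_gt0.
  move=> z; rewrite lt_min => /andP[/hs iz zr].
  suff Tz : T 0%N z = 0 by rewrite (fE _ iz) -T0 Tz mul0r.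
  pose C := 4 * (M * (2 / rho)) * ((b - a1) + (d - c)).
  have Cn n : absc (T 0%N z) <= C / 4 ^+ n.
    rewrite (TE n z iz)// abscM abscX.
    have Tn : absc (T n z) <= 4 * (M * (rho^-1 ^+ n) * (2 / rho)) * ((b - a1) + (d - c)).
      apply: (rint_bound (ltW ab) (ltW cd) (cont_kernelT (cG n) (interior_not_bdry iz))).
      move=> w wb; rewrite /G !abscM; have wr := hrho w wb.
      have wr2 : rho / 2 <= absc (w - z).
        by have := lerB_absc (w - a) (z - a); rewrite opprB addrA subrK; lra.
      have w0 : 0 < absc (w - a) by exact: lt_le_trans wr.
      have w1 : 0 < absc (w - z) by apply: lt_le_trans wr2; rewrite divr_gt0.
      rewrite abscX !abscV; apply: ler_pM; rewrite ?mulr_ge0 ?exprn_ge0 ?invr_ge0 ?absc_ge0//.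
        apply: ler_pM; rewrite ?exprn_ge0 ?invr_ge0 ?absc_ge0 ?hM//.
        by apply: lerXn2r; rewrite ?nnegrE ?invr_ge0 ?absc_ge0 ?(ltW rho0)// lef_pV2.
      by rewrite -[2 / rho]invf_div lef_pV2 ?posrE// divr_gt0.
    have -> : C / 4 ^+ n = (rho / 4) ^+ n * (4 * (M * rho^-1 ^+ n * (2 / rho)) * (b - a1 + (d - c))).
      rewrite /C expr_div_n exprVn; field.
      by rewrite !expf_neq0// gt_eqF.
    apply: ler_pM; rewrite ?exprn_ge0 ?absc_ge0//.
    by apply: lerXn2r; rewrite ?nnegrE ?absc_ge0 ?divr_ge0 ?(ltW rho0)// ltW.
  apply/eqP; rewrite -absc_eq0 eq_le absc_ge0 andbT leNgt; apply/negP => I0.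
  have C0 : 0 < C.
    have D0 : 0 < b - a1 + (d - c) by rewrite addr_gt0// subr_gt0.
    have r20 : 0 < 2 / rho by rewrite divr_gt0.
    by rewrite /C; apply: mulr_gt0 => //; apply: mulr_gt0 => //; apply: mulr_gt0.
  have I1 : 0 <= C / absc (T 0%N z) by rewrite divr_ge0 ?ltW.
  have := Cn (Num.bound (C / absc (T 0%N z))).
  rewrite ler_pdivlMr ?exprn_gt0// mulrC -ler_pdivlMr// leNgt => /negP; apply.
  by rewrite (lt_trans (archi_boundP I1))// -natrX ltr_nat ltn_expl.
right.
have ek : exists k, T k a != 0 by exists k.
case: (ex_minnP ek) => m Tm mmin.
have lowz j : (j < m)%N -> T j a = 0.
  move=> jm; apply/eqP; apply: contraTT jm => /mmin; by rewrite leqNgt.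
pose g z := T m z * (cauchyT a1 b c d (fun=> 1) z)^-1.
have dg z : interior_rect a1 b c d z -> exists l, has_cderiv g z l.
  move=> iz; eexists.
  exact: has_cderivM (cauchyT_deriv ab cd (cG m) iz) (has_cderivV (K0 z iz) (cauchyT_deriv ab cd c1 iz)).
have fg z : interior_rect a1 b c d z -> f z = (z - a) ^+ m * g z.
  by move=> iz; rewrite (fE z iz) -T0 (TE m z iz lowz) mulrA.
have ga : g a != 0 by rewrite mulf_neq0// invr_neq0// K0.
(* For m = 0 the factorisation at a would read f(a) = g(a), and g(a) is nonzero. *)
have m0 : (0 < m)%N.
  rewrite lt0n; apply: contraNneq ga => m0.
  by have := fg a ia; rewrite m0 expr0 mul1r fa0 => <-.
have [l gl] := dg a ia.
have ga0 : 0 < absc (g a) by rewrite absc_gt0.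
have [t t0 ht] := (continuousC_abscP _ _).1 (has_cderiv_continuous gl) _ ga0.
exists m, g, (Num.min s t); first by rewrite lt_min s0.
split=> // z; rewrite lt_min => /andP[/hs iz /ht gz]; split.
- apply: sq; case: iz => /andP[? ?] /andP[? ?]; by split; apply/andP; split; exact: ltW.
- exact: dg.
- by apply: contraTneq gz => ->; rewrite sub0r abscN ltxx.
- exact: fg.
Qed.

(** The identity theorem: the set of points near which f vanishes identically is open and relatively
    closed in the connected set U, so if nonempty it is U, and f is constant. *)
Lemma domain_zero U f a : domain U -> hol U f -> ~ constant_on U f -> U a -> f a = 0 ->
  exists m g, exists2 d : R, 0 < d & (0 < m)%N /\
    forall z, absc (z - a) < d -> [/\ U z, exists l, has_cderiv g z l, g z != 0
      & f z = (z - a) ^+ m * g z].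
Proof.
move=> [oU cU _] hf nc Ua fa0.
have [[d d0 hd]|//] := hol_zero oU hf Ua fa0; exfalso.
pose B := [set z | U z /\ exists2 d : R, 0 < d & forall w, absc (w - z) < d -> f w = 0].
suff BU : B = U.
  apply: nc; exists 0 => z; rewrite -BU => -[_ [r r0]]; apply.
  by rewrite subrr absc0.
apply: cU; first by exists a; split => //; exists d.
- exists B; last by apply/seteqP; split=> z; [case=> Uz h; split=> //|case].
  apply: open_abscP => z [Uz [r r0 hr]].
  have [s s0 hs] := open_absc oU Uz.
  have r20 : 0 < r / 2 by rewrite divr_gt0.
  exists (Num.min s (r / 2)); first by rewrite lt_min s0.
  move=> w; rewrite lt_min => /andP[/hs Uw wr]; split=> //.
  exists (r / 2) => // u uw; apply: hr.
  have -> : u - z = (u - w) + (w - z) by rewrite addrA subrK.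
  by apply: (le_lt_trans (ler_abscD _ _)); lra.
- exists (closure B); first exact: closed_closure.
  apply/seteqP; split=> z.
    by move=> Bz; have [Uz _] := Bz; split=> //; exact: subset_closure.
  move=> [Uz cz].
  have close e : 0 < e -> exists2 w, B w & absc (w - z) < e.
    move=> e0; have /cz[w [Bw hw]] : nbhs z [set w | absc (w - z) < e].
      by apply/nbhs_absc; exists e.
    by exists w.
  have fz0 : f z = 0.
    apply/eqP; apply: contrapT => /negP fz; have fz' : 0 < absc (f z) by rewrite absc_gt0.
    have [t t0 ht] := (continuousC_abscP _ _).1 (hol_continuous hf Uz) _ fz'.
    have [w [_ [s s0 hs]] /ht] := close t t0.
    by rewrite hs ?subrr ?absc0// sub0r abscN ltxx.
  (* If the factored form held at the limit point z, a nearby point w of B would satisfy (w - z)^m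
     g(w) = 0 with g(w) nonzero; hence w = z, and z itself lies in B. *)
  split=> //; have [//|[m [g [t t0 [_ ht]]]]] := hol_zero oU hf Uz fz0.
  have [w [Uw [s s0 hs]] /ht [_ _ gw]] := close t t0.
  rewrite hs ?subrr ?absc0// => /esym/eqP; rewrite mulf_eq0 (negbTE gw) orbF.
  rewrite expf_eq0 => /andP[_]; rewrite subr_eq0 => /eqP wz.
  by exists s => // u us; apply: hs; rewrite wz.
Qed.

End Holomorphic.

(** * Integration over the plane *)

Section PlaneMeasure.
Context {R : realType}.
Implicit Types (z w : R[i]) (u : R[i] -> R) (K U : set R[i]).
Local Notation mR := (measurableTypeR R).
Local Notation area := (@area R).

Lemma of_plane_continuous : continuous (@of_plane R).
Proof.
move=> [x y]; apply: (iffRL (@cvgrPdist_lt _ _ _ (nbhs (x, y)) _ (@of_plane R) (x +i* y))) => e.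
rewrite ltcE /= => /andP[/eqP ei e0].
have e20 : 0 < complex.Re e / 2 by rewrite divr_gt0.
exists (ball x (complex.Re e / 2), ball y (complex.Re e / 2)).
  by split=> /=; exact: nbhsx_ballx.
move=> [x' y'] [/= hx hy].
have k : absc ((x +i* y) - (x' +i* y')) < complex.Re e.
  apply: (le_lt_trans (ler_absc_ReIm _)); rewrite /=.
  have -> : complex.Re e = complex.Re e / 2 + complex.Re e / 2 by field.
  exact: ltrD.
by rewrite normcE_absc ltcE ei eqxx.
Qed.

Definition pbox (a b c d : R) : set (mR * mR) := `[a, b]%classic `*` `[c, d]%classic.

(** Measurability refers to the product of two Borel sigma-algebras, so an open set is written as a
    countable union of boxes with rational centre and half side. *)
Lemma measurable_open U : open U -> measurable (of_plane @^-1` U : set (mR * mR)).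
Proof.
move=> oU.
pose B (q : rat * rat * rat) : set (mR * mR) :=
  `]ratr q.1.1 - ratr q.2, ratr q.1.1 + ratr q.2[%classic `*`
  `]ratr q.1.2 - ratr q.2, ratr q.1.2 + ratr q.2[%classic.
have -> : of_plane @^-1` U = \bigcup_(q in [set q | B q `<=` of_plane @^-1` U]) B q.
  apply/seteqP; split=> [[x y] Uxy|p [q hq]]; last exact: hq.
  have [d d0 hd] := open_absc oU Uxy.
  have d40 : 0 < d / 4 by rewrite divr_gt0.
  have [r] := rat_in_itvoo d40; rewrite in_itv/= => /andP[r0 rd].
  have [s] := rat_in_itvoo (ltac:(lra) : x - ratr r < x + ratr r).
  rewrite in_itv/= => /andP[s1 s2].
  have [t] := rat_in_itvoo (ltac:(lra) : y - ratr r < y + ratr r).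
  rewrite in_itv/= => /andP[t1 t2].
  exists (s, t, r); last by split; rewrite /= in_itv/=; apply/andP; split; lra.
  move=> [x' y'] []; rewrite /= !in_itv/= => /andP[h1 h2] /andP[h3 h4].
  apply: hd; apply: (le_lt_trans (ler_absc_ReIm _)); rewrite /=.
  have -> : d = (d / 4 + d / 4) + (d / 4 + d / 4) by field.
  by apply: ltrD; rewrite ltr_norml; apply/andP; split; lra.
rewrite bigcup_mkcond; apply: countable_bigcupT_measurable => [|q]; first exact: countableP.
case: ifP => // _.
by apply: measurableX; exact: measurable_itv.
Qed.

Lemma measurable_closed U : closed U -> measurable (of_plane @^-1` U : set (mR * mR)).
Proof.
move=> cU; have -> : of_plane @^-1` U = ~` (of_plane @^-1` (~` U)).
  by rewrite preimage_setC setCK.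
by apply: measurableC; apply: measurable_open; exact: closed_openC.
Qed.

Lemma hausdorff_plane : hausdorff_space R[i].
Proof. exact: norm_hausdorff. Qed.

Lemma compact_closed_plane K : compact K -> closed K.
Proof. by move=> cK; apply: compact_closed => //; exact: hausdorff_plane. Qed.

Lemma absc_continuous : continuous (@absc R).
Proof.
move=> z; apply/continuous_abscP => e e0; exists e => // w; apply: le_lt_trans.
rewrite ler_norml; have := lerB_absc w z; have := lerB_absc z w.
by rewrite (absc_distC z) => ? ?; apply/andP; split; lra.
Qed.

Lemma compact_bound_plane K : compact K ->
  exists2 B : R, 0 < B & forall z, K z -> absc z < B.
Proof.
move=> cK; have cI : compact (@absc R @` K).
  by apply: continuous_compact => //; apply: continuous_subspaceT; exact: absc_continuous.
have [M [Mr hM]] := compact_bounded cI.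
exists (`|M| + 2); first by rewrite ltr_wpDl.
move=> z Kz; have : M < `|M| + 1 by have := ler_norm M; lra.
move=> /hM /(_ (absc z)) h; have : `|absc z| <= `|M| + 1 by apply: h; exists z.
by rewrite ger0_norm ?absc_ge0//; lra.
Qed.

Lemma measurable_restrict_open U u : open U -> (forall z, U z -> {for z, continuous u}) ->
  measurable_fun setT ((u \_ U) \o of_plane : mR * mR -> R).
Proof.
move=> oU cu.
have -> : (u \_ U) \o of_plane = (u \o of_plane) \_ (of_plane @^-1` U).
  by apply/funext => p; rewrite /= /patch; congr (if _ then _ else _); rewrite !inE.
apply/(measurable_restrictT _ _).1; first exact: measurable_open.
move=> mD; apply: (measurability _ (measurable_realfun.RGenOInfty.measurableE R)) => //.
move=> /= _ [_ [r ->] <-].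
have -> : of_plane @^-1` U `&` (u \o of_plane) @^-1` `]r, +oo[%classic =
    of_plane @^-1` [set z | U z /\ r < u z] :> set (mR * mR).
  by apply/seteqP; split=> p /=; rewrite in_itv/= andbT.
apply: measurable_open; apply: open_abscP => z [Uz rz].
have [d1 d10 h1] := open_absc oU Uz.
have [d2 d20 h2] := (continuous_abscP _ _).1 (cu z Uz) (u z - r) (ltac:(by rewrite subr_gt0)).
exists (Num.min d1 d2); first by rewrite lt_min d10.
move=> w; rewrite lt_min => /andP[/h1 Uw /h2]; rewrite ltr_norml => /andP[k _].
by split=> //; lra.
Qed.

Lemma area_box a b c d : a <= b -> c <= d ->
  area (pbox a b c d) = ((b - a) * (d - c))%:E.
Proof.
move=> ab cd; rewrite /area/= product_measure1E//=; [|exact: measurable_itv..].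
rewrite !lebesgue_measure_itv/= !lte_fin EFinM.
have E p q : p <= q -> (if (p < q)%R then q%:E - p%:E else 0)%E = (q - p)%:E :> \bar R.
  by case: ltgtP => // -> _; rewrite subrr.
by rewrite !E.
Qed.

Definition in_box (B : R) z := `|complex.Re z| < B /\ `|complex.Im z| < B.

Lemma integrable_bounded (g : mR * mR -> R) (M B : R) : measurable_fun setT g ->
  (forall p, `|g p| <= M) -> (forall p, g p != 0 -> in_box B (of_plane p)) ->
  area.-integrable setT (EFin \o g).
Proof.
move=> mg gM gB.
have -> : (EFin \o g) = (EFin \o g) \_ (pbox (- `|B|) `|B| (- `|B|) `|B|).
  apply/funext => p; rewrite /patch; case: ifPn => //= /negP; rewrite inE => nB.
  have [->//|/gB] := eqVneq (g p) 0.
  move=> [h1 h2]; exfalso; apply: nB; case: p h1 h2 => x y /= h1 h2.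
  have := ler_norm B; move: h1 h2; rewrite !ltr_norml => /andP[? ?] /andP[? ?] ?.
  by split; rewrite /= in_itv/=; apply/andP; split; lra.
have mb : measurable (pbox (- `|B|) `|B| (- `|B|) `|B|).
  by apply: measurableX; exact: measurable_itv.
apply/(integrable_mkcond _ mb).1.
apply: measurable_bounded_integrable => //.
- have b0 : - `|B| <= `|B| by have := normr_ge0 B; lra.
  by apply: (eq_ind_r (fun x => (x < +oo)%E) _ (area_box b0 b0)); exact: ltry.
- exact: measurable_funS mg.
- by exists M; split; [exact: num_real|move=> x Mx p _; exact: le_trans (gM p) (ltW Mx)].
Qed.

End PlaneMeasure.

(** * Partial derivatives and the vanishing of their integrals *)

Section PartialDerivatives.
Context {R : realType}.
Implicit Types (z w : R[i]) (u : R[i] -> R) (K U : set R[i]).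
Local Notation mR := (measurableTypeR R).
Local Notation area := (@area R).
Local Notation mu := (@lebesgue_measure R).

Definition is_dx u z (l : R) := is_derive (0 : R) (1 : R) (fun t : R => u (z + t%:C)) l.
Definition is_dy u z (l : R) := is_derive (0 : R) (1 : R) (fun t : R => u (z + t *i)) l.

Lemma is_derive_shift0 (g : R -> R) (x l : R) :
  is_derive (0 : R) (1 : R) (fun t => g (x + t)) l <-> is_derive x 1 g l.
Proof.
split=> h.
  have -> : g = (fun t => g (x + t)) \o (fun t => t - x).
    by apply/funext => t /=; rewrite addrC subrK.
  have i : is_derive x (1 : R) (fun t => t - x) 1.
    by apply: is_derive_eq; rewrite subr0.
  have h' : is_derive (x - x) (1 : R) (fun t => g (x + t)) l by rewrite subrr.
  by have := @is_derive1_comp R (fun t => g (x + t)) (fun t => t - x) x l 1 h' i; rewrite mulr1.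
have i : is_derive (0 : R) (1 : R) (fun t => x + t) 1.
  have := @is_deriveD _ _ _ (cst x) id 0 1 0 1 (is_derive_cst _ _ _) (is_derive_id _ _).
  by rewrite add0r.
have h' : is_derive (x + 0) (1 : R) g l by rewrite addr0.
by have := @is_derive1_comp R g (fun t => x + t) 0 l 1 h' i; rewrite mulr1.
Qed.

Lemma is_dxE u x y l : is_dx u (x +i* y) l <-> is_derive x 1 (fun t => u (t +i* y)) l.
Proof.
rewrite -is_derive_shift0 /is_dx.
suff -> : (fun t : R => u ((x +i* y) + t%:C)) = (fun t => u ((x + t) +i* y)) by [].
by apply/funext => t; congr u; apply/eqP; rewrite eq_complex/= addr0 !eqxx.
Qed.

Lemma is_dyE u x y l : is_dy u (x +i* y) l <-> is_derive y 1 (fun t => u (x +i* t)) l.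
Proof.
rewrite -is_derive_shift0 /is_dy.
suff -> : (fun t : R => u ((x +i* y) + t *i)) = (fun t => u (x +i* (y + t))) by [].
by apply/funext => t; congr u; apply/eqP; rewrite eq_complex/= addr0 !eqxx.
Qed.

Lemma continuous_slice_x u x y : {for (x +i* y), continuous u} ->
  {for x, continuous (fun t => u (t +i* y))}.
Proof.
move=> /continuous_abscP h.
apply: (iffRL (@cvgrPdist_lt _ _ _ (nbhs x) _ (fun t => u (t +i* y)) (u (x +i* y)))) => e e0.
have [d d0 hd] := h e e0; apply/nbhs_ballP; exists d => // t xt.
rewrite distrC; apply: hd.
have -> : (t +i* y) - (x +i* y) = (t - x)%:C by apply/eqP; rewrite eq_complex/= subrr !eqxx.
by rewrite absc_real distrC.
Qed.

Lemma continuous_slice_y u x y : {for (x +i* y), continuous u} ->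
  {for y, continuous (fun t => u (x +i* t))}.
Proof.
move=> /continuous_abscP h.
apply: (iffRL (@cvgrPdist_lt _ _ _ (nbhs y) _ (fun t => u (x +i* t)) (u (x +i* y)))) => e e0.
have [d d0 hd] := h e e0; apply/nbhs_ballP; exists d => // t xt.
rewrite distrC; apply: hd.
have -> : (x +i* t) - (x +i* y) = (t - y) *i by apply/eqP; rewrite eq_complex/= subrr !eqxx.
by rewrite absc_imag distrC.
Qed.

Lemma compact_pbox (B : R) : compact (of_plane @` (pbox (- B) B (- B) B)).
Proof.
apply: continuous_compact.
  by apply: continuous_subspaceT; exact: of_plane_continuous.
by apply: compact_setX; exact: segment_compact.
Qed.

Lemma continuous_bounded_compact K u : compact K -> (forall z, K z -> {for z, continuous u}) ->
  exists2 M : R, 0 <= M & forall z, K z -> `|u z| <= M.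
Proof.
move=> cK cu; have cI : compact (u @` K).
  apply: continuous_compact => //; apply: continuous_in_subspaceT => z.
  by rewrite inE; exact: cu.
have [M [Mr hM]] := compact_bounded cI.
exists (`|M| + 1); first by rewrite addr_ge0.
move=> z Kz; apply: (hM (`|M| + 1)); last by exists z.
by have := ler_norm M; lra.
Qed.

Lemma in_box_pbox (B : R) z : in_box B z -> (of_plane @` (pbox (- B) B (- B) B)) z.
Proof.
case: z => x y [/=]; rewrite !ltr_norml => /andP[? ?] /andP[? ?].
by exists (x, y) => //; split; rewrite /= in_itv/=; apply/andP; split; exact: ltW.
Qed.

Lemma continuous_measurable u : continuous u -> measurable_fun setT (u \o of_plane : mR * mR -> R).
Proof.
move=> cu; have := @measurable_restrict_open R setT u openT (fun z _ => cu z).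
by rewrite patch_setT.
Qed.

Lemma integrable_continuous_box u (B : R) : continuous u -> (forall z, u z != 0 -> in_box B z) ->
  area.-integrable setT (EFin \o (u \o of_plane)).
Proof.
move=> cu uB.
have [M M0 hM] := @continuous_bounded_compact _ u (@compact_pbox B) (fun z _ => cu z).
apply: (@integrable_bounded R _ M B).
- exact: continuous_measurable.
- move=> p; rewrite /=; have [->|up] := eqVneq (u (of_plane p)) 0.
    by rewrite normr0.
  by apply: hM; apply: in_box_pbox; exact: uB.
- by move=> p; exact: uB.
Qed.

Lemma integral1_dx0 (P P' : R -> R) (B : R) : 0 < B ->
  (forall x : R, is_derive x (1 : R) P (P' x)) -> continuous P' ->
  (forall x, ~ (`|x| < B) -> P x = 0 /\ P' x = 0) ->
  (\int[mu]_x (P' x)%:E = 0)%E.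
Proof.
move=> B0 dP cP hB.
have -> : (\int[mu]_x (P' x)%:E = \int[mu]_(x in `[(- B)%R, B]) (P' x)%:E)%E.
  rewrite [RHS]integral_mkcond; apply: eq_integral => x _.
  rewrite /patch; case: ifPn => // /negP; rewrite inE/= in_itv/= => nx.
  have [] := hB x; last by move=> _ ->.
  by rewrite ltr_norml => /andP[h1 h2]; apply: nx; rewrite !ltW.
have BB : - B < B by lra.
have Pc : continuous P.
  move=> x; have [d _] := dP x.
  by apply: differentiable_continuous; apply/derivable1_diffP.
rewrite (continuous_FTC2 BB (F := P)).
- have [-> _] : P B = 0 /\ P' B = 0 by apply: hB; rewrite ger0_norm ?ltxx// ltW.
  have [-> _] : P (- B) = 0 /\ P' (- B) = 0 by apply: hB; rewrite normrN ger0_norm ?ltxx// ltW.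
  by rewrite subee.
- exact: continuous_subspaceT.
- split.
  + by move=> x _; have [d _] := dP x.
  + by apply: cvg_at_right_filter; exact: Pc.
  + by apply: cvg_at_left_filter; exact: Pc.
- by move=> x _; rewrite derive1E; have [_ ->] := dP x.
Qed.

(** Fubini in the order that integrates first along the direction of differentiation; each inner
    integral is 0 by the fundamental theorem of calculus. *)
Lemma integral_dx0 (P P' : R[i] -> R) (B : R) : 0 < B ->
  (forall z, is_dx P z (P' z)) -> continuous P' ->
  (forall z, ~ in_box B z -> P z = 0 /\ P' z = 0) ->
  (\int[area]_p (P' (of_plane p))%:E = 0)%E.
Proof.
move=> B0 dP cP hB.
have iP : area.-integrable setT (EFin \o (P' \o of_plane)).
  apply: (integrable_continuous_box cP (B := B)) => z; apply: contraPP => /hB[_ ->].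
  by rewrite eqxx.
rewrite -(@integral21_prod_meas1 _ _ _ _ _ mu mu _ iP).
apply: integral0_eq => y _; rewrite /fubini_G /=.
apply: (integral1_dx0 (P := fun x => P (x +i* y)) B0).
- by move=> x; exact: (is_dxE P x y _).1 (dP (x +i* y)).
- move=> x; apply: (@continuous_slice_x P' x y); exact: cP.
- by move=> x nx; apply: hB => -[].
Qed.

Lemma integral_dy0 (P P' : R[i] -> R) (B : R) : 0 < B ->
  (forall z, is_dy P z (P' z)) -> continuous P' ->
  (forall z, ~ in_box B z -> P z = 0 /\ P' z = 0) ->
  (\int[area]_p (P' (of_plane p))%:E = 0)%E.
Proof.
move=> B0 dP cP hB.
have iP : area.-integrable setT (EFin \o (P' \o of_plane)).
  apply: (integrable_continuous_box cP (B := B)) => z; apply: contraPP => /hB[_ ->].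
  by rewrite eqxx.
rewrite -(@integral12_prod_meas1 _ _ _ _ _ mu mu _ iP).
apply: integral0_eq => x _; rewrite /fubini_F /=.
apply: (integral1_dx0 (P := fun y => P (x +i* y)) B0).
- by move=> y; exact: (is_dyE P x y _).1 (dP (x +i* y)).
- move=> y; apply: (@continuous_slice_y P' x y); exact: cP.
- by move=> y ny; apply: hB => -[].
Qed.

End PartialDerivatives.

(** * Classical partial derivatives of v *)

Section RealCalculus.
Context {R : realType}.
Implicit Types (z w : R[i]) (u : R[i] -> R) (f : R[i] -> R[i]).

Lemma is_derive0_eps (g : R -> R) (l : R) :
  (forall e : R, 0 < e -> exists2 d : R, 0 < d & forall t, `|t| < d ->
    `|g t - g 0 - l * t| <= e * `|t|) -> is_derive (0 : R) (1 : R) g l.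
Proof.
move=> h.
have cv : t^-1 *: ((g \o shift (0:R)) (t *: (1 : R)) - g 0) @[t --> 0^'] --> l.
  apply/cvgrPdist_le => e e0; have [d d0 hd] := h _ e0.
  apply/nbhs_ballP; exists d => // t /=; rewrite /ball /= sub0r normrN => td t0.
  rewrite addr0 /GRing.scale /= mulr1 distrC -(ler_pM2r (_ : 0 < `|t|)) ?normr_gt0//.
  rewrite -normrM (le_trans _ (hd _ td))//.
  by rewrite mulrBl mulrAC mulVf// mul1r.
apply: DeriveDef; first by apply/cvg_ex; exists l.
exact: cvg_lim cv.
Qed.

Lemma has_cderiv_dx f z l : has_cderiv f z l ->
  is_dx (fun w => complex.Re (f w)) z (complex.Re l) /\
  is_dx (fun w => complex.Im (f w)) z (complex.Im l).
Proof.
move=> hf; split; apply: is_derive0_eps => e e0; have [d d0 hd] := hf e e0; exists d => // t td; have td' : absc (t%:C) < d by rewrite absc_real.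
all: have := hd _ td'; rewrite absc_real; apply: le_trans.
- apply: (le_trans _ (ler_Re_absc _)); rewrite addr0.
  by case: (f z) => a b; case: (f _) => a' b'; case: (l) => p q /=; rewrite mulr0 subr0.
- apply: (le_trans _ (ler_Im_absc _)); rewrite addr0.
  by case: (f z) => a b; case: (f _) => a' b'; case: (l) => p q /=; rewrite mulr0 add0r.
Qed.

(** Increments h = i t multiply by i l = - Im l + i Re l; together with [has_cderiv_dx] these are
    the Cauchy-Riemann equations. *)
Lemma has_cderiv_dy f z l : has_cderiv f z l ->
  is_dy (fun w => complex.Re (f w)) z (- complex.Im l) /\
  is_dy (fun w => complex.Im (f w)) z (complex.Re l).
Proof.
move=> hf; split; apply: is_derive0_eps => e e0; have [d d0 hd] := hf e e0; exists d => // t td; have td' : absc (t *i) < d by rewrite absc_imag.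
all: have := hd _ td'; rewrite absc_imag; apply: le_trans.
- apply: (le_trans _ (ler_Re_absc _)); rewrite addr0.
  case: (f z) => a b; case: (f _) => a' b'; case: (l) => p q /=.
  by rewrite mulr0 add0r mulNr.
- apply: (le_trans _ (ler_Im_absc _)); rewrite addr0.
  by case: (f z) => a b; case: (f _) => a' b'; case: (l) => p q /=; rewrite mulr0 addr0.
Qed.

Lemma is_deriveM1 (g h : R -> R) (x a b : R) : is_derive x (1 : R) g a ->
  is_derive x (1 : R) h b -> is_derive x (1 : R) (fun t => g t * h t) (a * h x + g x * b).
Proof.
move=> dg dh; have := is_deriveM dg dh.
by rewrite /GRing.scale /= addrC [h x * a]mulrC.
Qed.

Lemma is_deriveV1 (g : R -> R) (x a : R) : g x != 0 -> is_derive x (1 : R) g a ->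
  is_derive x (1 : R) (fun t => (g t)^-1) (- a / g x ^+ 2).
Proof.
move=> gx dg; have := is_deriveV gx dg.
by rewrite /GRing.scale /= mulNr mulrC mulNr.
Qed.

Lemma is_deriveD1 (g h : R -> R) (x a b : R) : is_derive x (1 : R) g a ->
  is_derive x (1 : R) h b -> is_derive x (1 : R) (fun t => g t + h t) (a + b).
Proof. by move=> dg dh; exact: (is_deriveD dg dh). Qed.

Lemma is_deriveN1 (g : R -> R) (x a : R) : is_derive x (1 : R) g a ->
  is_derive x (1 : R) (fun t => - g t) (- a).
Proof. by move=> dg; exact: (is_deriveN dg). Qed.

Lemma is_derive_ext (g h : R -> R) (x a b : R) : (forall t, g t = h t) -> a = b ->
  is_derive x (1 : R) g a -> is_derive x (1 : R) h b.
Proof. by move=> /funext -> ->. Qed.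

Lemma is_derive_ln1 (g : R -> R) (x a : R) : 0 < g x -> is_derive x (1 : R) g a ->
  is_derive x (1 : R) (fun t => ln (g t)) (a / g x).
Proof.
by move=> gx dg; have := is_derive1_comp (is_derive1_ln gx) dg; rewrite mulrC.
Qed.

Lemma is_derive_invln (S : R -> R) (x s : R) : 0 < S x -> 0 < ln (S x) ->
  is_derive x (1 : R) S s ->
  is_derive x (1 : R) (fun t => (ln (S t))^-1) (- s / (S x * ln (S x) ^+ 2)).
Proof.
move=> S0 L0 dS.
have := is_deriveV1 (g := fun t => ln (S t)) (lt0r_neq0 L0) (is_derive_ln1 S0 dS).
suff -> : - (s / S x) / ln (S x) ^+ 2 = - s / (S x * ln (S x) ^+ 2) by [].
by field; rewrite !gt_eqF.
Qed.

Lemma is_derive_invSln (S : R -> R) (x s : R) : 0 < S x -> 0 < ln (S x) ->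
  is_derive x (1 : R) S s ->
  is_derive x (1 : R) (fun t => (S t * ln (S t) ^+ 2)^-1)
    (- s * ((ln (S x) + 2) / (S x ^+ 2 * ln (S x) ^+ 3))).
Proof.
move=> S0 L0 dS.
have dL := is_derive_ln1 S0 dS.
have d1 := is_deriveM1 dS (is_deriveM1 dL dL).
have ne : S x * (ln (S x) * ln (S x)) != 0 by rewrite !mulf_neq0// gt_eqF.
have := is_deriveV1 (g := fun t => S t * (ln (S t) * ln (S t))) ne d1.
rewrite (_ : (fun t => (S t * (ln (S t) * ln (S t)))^-1) = (fun t => (S t * ln (S t) ^+ 2)^-1))//.
set A := _ / _; set B := - s * _; suff -> : A = B by [].
by rewrite /A /B; field; rewrite !gt_eqF.
Qed.

End RealCalculus.

Section Vcalculus.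
Context {R : realType}.
Variables (Om : set R[i]) (f : R[i] -> R[i]).
Hypothesis oOm : open Om.
Hypothesis hf : hol Om f.
Hypothesis fsmall : forall z, Om z -> absc (f z) < 1 / 10.
Implicit Types (z w : R[i]).

(* D1 = - F'(S) and D2 = F''(S) for F = 1 / log.  On the zeros of f, where
   ln 0 = 0 and x / 0 = 0 in Rocq, all these functions take the value 0. *)
Definition Sf z : R := - ln (absc (f z) ^+ 2).
Definition D1 z : R := (Sf z * ln (Sf z) ^+ 2)^-1.
Definition D2 z : R := (ln (Sf z) + 2) / (Sf z ^+ 2 * ln (Sf z) ^+ 3).
Definition qf z : R[i] := cder f z / f z.
Definition qf1 z : R[i] := cder (cder f) z / f z - qf z ^+ 2.
(** Chain rule for F(S): since S = - 2 Re log f, the gradient of S is (- 2 Re q, 2 Im q); moreover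
    q_x = q' and q_y = i q'. *)
Definition vx z : R := D1 z * (2 * complex.Re (qf z)).
Definition vy z : R := - (D1 z * (2 * complex.Im (qf z))).
Definition vxx z : R := D2 z * (2 * complex.Re (qf z)) ^+ 2 + D1 z * (2 * complex.Re (qf1 z)).
Definition vyy z : R := D2 z * (2 * complex.Im (qf z)) ^+ 2 - D1 z * (2 * complex.Re (qf1 z)).
Definition vxy z : R := - (D2 z * (4 * (complex.Re (qf z) * complex.Im (qf z)))
   + D1 z * (2 * complex.Im (qf1 z))).
Definition Uf : set R[i] := [set z | Om z /\ f z != 0].

Lemma Uf_open : open Uf.
Proof.
apply: open_abscP => z [Oz fz]; have [d1 d10 h1] := open_absc oOm Oz.
have fz0 : 0 < absc (f z) by rewrite absc_gt0.
have [d2 d20 h2] := (continuousC_abscP _ _).1 (hol_continuous hf Oz) _ fz0.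
exists (Num.min d1 d2); first by rewrite lt_min d10.
move=> w; rewrite lt_min => /andP[/h1 Ow /h2 fw]; split=> //.
by apply: contraTneq fw => ->; rewrite sub0r abscN ltxx.
Qed.

(** At a zero [ln 0 = 0] and [0^-1 = 0], so the formula takes the prescribed value 0 there without a
    case distinction. *)
Lemma vfunE z : vfun f z = (ln (Sf z))^-1.
Proof.
rewrite /vfun /Sf; case: eqP => // ->.
have l0 : ln (0 : R) = 0 by rewrite ln0.
by rewrite absc0 expr0n /= l0 oppr0 l0 invr0.
Qed.

(** From exp(-1/6) >= 5/6. The exponent 6 is the least n with (1 - 1/n)^n > 1/3. *)
Lemma expR1_lt3 : expR 1 < 3 :> R.
Proof.
have h : 5 / 6 <= expR (- 6^-1) :> R.
  by apply: (le_trans _ (expR_ge1Dx _)); rewrite le_eqVlt; apply/orP; left; apply/eqP; field.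
have e : expR (- 1) = expR (- 6^-1) ^+ 6 :> R.
  by rewrite -expRM_natl; congr expR; field.
have h6 : (5 / 6) ^+ 6 <= expR (- 1) :> R by rewrite e lerXn2r// nnegrE ?divr_ge0// expR_ge0.
have k : 3^-1 < (5 / 6) ^+ 6 :> R by lra.
by have := lt_le_trans k h6; rewrite expRN ltf_pV2 ?posrE ?expR_gt0.
Qed.

(** e^2 < 9 < 10. *)
Lemma ln10_gt2 : 2 < ln (10 : R).
Proof.
have e3 := expR1_lt3.
rewrite -[2]expRK ltr_ln ?posrE ?expR_gt0//.
have -> : (2 : R) = 1 + 1 by ring.
rewrite expRD; have e0 := expR_gt0 (1 : R).
have : expR 1 * expR 1 < 3 * 3 :> R by apply: ltr_pM => //; exact: ltW.
lra.
Qed.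

(** Here the bound 1/10 enters: S = - 2 log |f| > 2 log 10 > 4. As 4 > e, log S > 1 follows. *)
Lemma Sf_gt4 z : Uf z -> 4 < Sf z.
Proof.
move=> [Oz fz]; rewrite /Sf lnXn ?absc_gt0//.
have : ln (absc (f z)) < - ln 10.
  rewrite -lnV ?posrE// ltr_ln ?posrE ?absc_gt0//.
  by have := fsmall Oz; rewrite mul1r.
have := ln10_gt2; rewrite mulr2n; lra.
Qed.

Lemma lnSf_gt1 z : Uf z -> 1 < ln (Sf z).
Proof.
move=> Uz; have S4 := Sf_gt4 Uz.
have e3 := expR1_lt3.
by rewrite -[1]expRK ltr_ln ?posrE ?expR_gt0//; lra.
Qed.

(** No branch of log f is chosen: |f|^2 is differentiated as a sum of two squares, and division by
    |f|^2 turns the result into Re (f'/f). *)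
Lemma Sf_dx z : Uf z -> is_dx Sf z (- (2 * complex.Re (qf z))).
Proof.
move=> [Oz fz]; have [d1 d2] := has_cderiv_dx (hol_cder hf Oz).
have e t : absc (f (z + t%:C)) ^+ 2 = complex.Re (f (z + t%:C)) * complex.Re (f (z + t%:C)) +
   complex.Im (f (z + t%:C)) * complex.Im (f (z + t%:C)) by rewrite absc_sqr.
have d3 := is_derive_ext (fun t => esym (e t)) erefl (is_deriveD1 (is_deriveM1 d1 d1) (is_deriveM1 d2 d2)).
have pos : 0 < absc (f (z + (0:R)%:C)) ^+ 2 by rewrite addr0 exprn_gt0// absc_gt0.
apply: is_derive_ext (is_deriveN1 (is_derive_ln1 (g := fun t => absc (f (z + t%:C)) ^+ 2) pos d3)) => //.
rewrite !addr0; set A := - (_ / _); set B := - (2 * _).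
have a0 : absc (f z) ^+ 2 != 0 by rewrite expf_neq0// absc_eq0.
rewrite /A /B absc_sqr /qf in a0 *; move: a0; case: (f z) (cder f z) => a b [p q] /= a0.
by field.
Qed.

Lemma Sf_dy z : Uf z -> is_dy Sf z (2 * complex.Im (qf z)).
Proof.
move=> [Oz fz]; have [d1 d2] := has_cderiv_dy (hol_cder hf Oz).
have e t : absc (f (z + t *i)) ^+ 2 = complex.Re (f (z + t *i)) * complex.Re (f (z + t *i)) +
   complex.Im (f (z + t *i)) * complex.Im (f (z + t *i)) by rewrite absc_sqr.
have d3 := is_derive_ext (fun t => esym (e t)) erefl (is_deriveD1 (is_deriveM1 d1 d1) (is_deriveM1 d2 d2)).
have pos : 0 < absc (f (z + (0:R) *i)) ^+ 2 by rewrite addr0 exprn_gt0// absc_gt0.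
apply: is_derive_ext (is_deriveN1 (is_derive_ln1 (g := fun t => absc (f (z + t *i)) ^+ 2) pos d3)) => //.
rewrite !addr0; set A := - (_ / _); set B := (2 * _).
have a0 : absc (f z) ^+ 2 != 0 by rewrite expf_neq0// absc_eq0.
rewrite /A /B absc_sqr /qf in a0 *; move: a0; case: (f z) (cder f z) => a b [p q] /= a0.
by field.
Qed.

Lemma qf_deriv z : Uf z -> has_cderiv qf z (qf1 z).
Proof.
move=> [Oz fz].
have h := has_cderivM (hol_cder (hol_cderiv oOm hf) Oz) (has_cderivV fz (hol_cder hf Oz)).
suff -> : qf1 z = cder f z * (- cder f z / f z ^+ 2) + (f z)^-1 * cder (cder f) z by [].
rewrite /qf1 /qf {h}; move: (cder (cder f) z) (cder f z) (f z) fz => A B C C0.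
by field.
Qed.

Lemma is_dxM (u w : R[i] -> R) z a b : is_dx u z a -> is_dx w z b ->
  is_dx (fun x => u x * w x) z (a * w z + u z * b).
Proof. by move=> h1 h2; have := is_deriveM1 h1 h2; rewrite !addr0. Qed.

Lemma is_dyM (u w : R[i] -> R) z a b : is_dy u z a -> is_dy w z b ->
  is_dy (fun x => u x * w x) z (a * w z + u z * b).
Proof. by move=> h1 h2; have := is_deriveM1 h1 h2; rewrite !addr0. Qed.

Lemma is_dxZ (c : R) (u : R[i] -> R) z a : is_dx u z a -> is_dx (fun x => c * u x) z (c * a).
Proof.
move=> h; have := is_deriveM1 (is_derive_cst c (0:R) (1:R)) h.
by rewrite mul0r add0r.
Qed.

Lemma is_dyZ (c : R) (u : R[i] -> R) z a : is_dy u z a -> is_dy (fun x => c * u x) z (c * a).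
Proof.
move=> h; have := is_deriveM1 (is_derive_cst c (0:R) (1:R)) h.
by rewrite mul0r add0r.
Qed.

Lemma is_dx_eq (u w : R[i] -> R) z a b : (forall x, u x = w x) -> a = b -> is_dx u z a -> is_dx w z b.
Proof. by move=> /funext -> ->. Qed.

Lemma is_dy_eq (u w : R[i] -> R) z a b : (forall x, u x = w x) -> a = b -> is_dy u z a -> is_dy w z b.
Proof. by move=> /funext -> ->. Qed.

Lemma v_dx z : Uf z -> is_dx (vfun f) z (vx z).
Proof.
move=> Uz; have S4 := Sf_gt4 Uz; have L1 := lnSf_gt1 Uz.
have S0 : 0 < Sf (z + (0:R)%:C) by rewrite addr0; lra.
have L0 : 0 < ln (Sf (z + (0:R)%:C)) by rewrite addr0; lra.
apply: is_derive_ext (is_derive_invln (S := fun t => Sf (z + t%:C)) S0 L0 (Sf_dx Uz)).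
  by move=> t; rewrite vfunE.
by rewrite addr0 opprK /vx /D1 mulrC.
Qed.

Lemma v_dy z : Uf z -> is_dy (vfun f) z (vy z).
Proof.
move=> Uz; have S4 := Sf_gt4 Uz; have L1 := lnSf_gt1 Uz.
have S0 : 0 < Sf (z + (0:R) *i) by rewrite addr0; lra.
have L0 : 0 < ln (Sf (z + (0:R) *i)) by rewrite addr0; lra.
apply: is_derive_ext (is_derive_invln (S := fun t => Sf (z + t *i)) S0 L0 (Sf_dy Uz)).
  by move=> t; rewrite vfunE.
by rewrite addr0 mulNr /vy /D1 mulrC.
Qed.

Lemma D1_dx z : Uf z -> is_dx D1 z (D2 z * (2 * complex.Re (qf z))).
Proof.
move=> Uz; have S4 := Sf_gt4 Uz; have L1 := lnSf_gt1 Uz.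
have S0 : 0 < Sf (z + (0:R)%:C) by rewrite addr0; lra.
have L0 : 0 < ln (Sf (z + (0:R)%:C)) by rewrite addr0; lra.
apply: is_derive_ext (is_derive_invSln (S := fun t => Sf (z + t%:C)) S0 L0 (Sf_dx Uz)).
  by [].
by rewrite addr0 opprK /D2 mulrC.
Qed.

Lemma D1_dy z : Uf z -> is_dy D1 z (- (D2 z * (2 * complex.Im (qf z)))).
Proof.
move=> Uz; have S4 := Sf_gt4 Uz; have L1 := lnSf_gt1 Uz.
have S0 : 0 < Sf (z + (0:R) *i) by rewrite addr0; lra.
have L0 : 0 < ln (Sf (z + (0:R) *i)) by rewrite addr0; lra.
apply: is_derive_ext (is_derive_invSln (S := fun t => Sf (z + t *i)) S0 L0 (Sf_dy Uz)).
  by [].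
by rewrite addr0 mulNr /D2 mulrC.
Qed.

Lemma vx_dx z : Uf z -> is_dx vx z (vxx z).
Proof.
move=> Uz; have [h1 h2] := has_cderiv_dx (qf_deriv Uz).
have h := is_dxM (D1_dx Uz) (is_dxZ 2 h1).
by apply: is_dx_eq h => //; rewrite /vxx; ring.
Qed.

Lemma vx_dy z : Uf z -> is_dy vx z (vxy z).
Proof.
move=> Uz; have [h1 h2] := has_cderiv_dy (qf_deriv Uz).
have h := is_dyM (D1_dy Uz) (is_dyZ 2 h1).
by apply: is_dy_eq h => //; rewrite /vxy; ring.
Qed.

Lemma vy_dy z : Uf z -> is_dy vy z (vyy z).
Proof.
move=> Uz; have [h1 h2] := has_cderiv_dy (qf_deriv Uz).
have h := is_dyZ (-1) (is_dyM (D1_dy Uz) (is_dyZ 2 h2)).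
by apply: is_dy_eq h; [move=> x; rewrite mulN1r|rewrite /vyy; ring].
Qed.

Definition rcont (A : set R[i]) (u : R[i] -> R) := forall z, A z -> {for z, continuous u}.

Lemma rcontM A (u w : R[i] -> R) : rcont A u -> rcont A w -> rcont A (fun z => u z * w z).
Proof. by move=> hu hw z Az; exact: (continuousM (hu z Az) (hw z Az)). Qed.

Lemma rcontD A (u w : R[i] -> R) : rcont A u -> rcont A w -> rcont A (fun z => u z + w z).
Proof. by move=> hu hw z Az; exact: (continuousD (hu z Az) (hw z Az)). Qed.

Lemma rcontN A u : rcont A u -> rcont A (fun z => - u z).
Proof. by move=> hu z Az; exact: (continuousN (hu z Az)). Qed.

Lemma rcontV A u : rcont A u -> (forall z, A z -> u z != 0) -> rcont A (fun z => (u z)^-1).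
Proof. by move=> hu h0 z Az; exact: (continuousV (h0 z Az) (hu z Az)). Qed.

Lemma rcont_cst A (c : R) : rcont A (fun=> c).
Proof. by move=> z _; exact: cst_continuous. Qed.

Lemma rcont_ln A u : rcont A u -> (forall z, A z -> 0 < u z) -> rcont A (fun z => ln (u z)).
Proof.
move=> hu h0 z Az; apply: (@cvg_comp _ _ _ u (@ln R) (nbhs z) (nbhs (u z)) (nbhs (ln (u z)))).
  exact: hu.
by apply: continuous_ln; exact: h0.
Qed.

Lemma rcont_Re A (g : R[i] -> R[i]) : cont_on A g -> rcont A (fun z => complex.Re (g z)).
Proof.
move=> hg z Az; apply/continuous_abscP => e e0.
have [d d0 hd] := (continuousC_abscP _ _).1 (hg z Az) _ e0.
exists d => // w /hd; apply: le_lt_trans; apply: (le_trans _ (ler_Re_absc _)).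
by case: (g w) => ? ?; case: (g z).
Qed.

Lemma rcont_Im A (g : R[i] -> R[i]) : cont_on A g -> rcont A (fun z => complex.Im (g z)).
Proof.
move=> hg z Az; apply/continuous_abscP => e e0.
have [d d0 hd] := (continuousC_abscP _ _).1 (hg z Az) _ e0.
exists d => // w /hd; apply: le_lt_trans; apply: (le_trans _ (ler_Im_absc _)).
by case: (g w) => ? ?; case: (g z).
Qed.

Lemma rcont_absc A (g : R[i] -> R[i]) : cont_on A g -> rcont A (fun z => absc (g z)).
Proof.
move=> hg z Az; apply/continuous_abscP => e e0.
have [d d0 hd] := (continuousC_abscP _ _).1 (hg z Az) _ e0.
exists d => // w /hd; apply: le_lt_trans.
rewrite ler_norml; have := lerB_absc (g w) (g z); have := lerB_absc (g z) (g w).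
by rewrite (absc_distC (g z)) => ? ?; apply/andP; split; lra.
Qed.

Lemma Sf_cont : rcont Uf Sf.
Proof.
apply: rcontN; apply: rcont_ln => [|z [_ fz]]; last by rewrite exprn_gt0// absc_gt0.
have c : rcont Uf (fun z => absc (f z)).
  by apply: rcont_absc => z [Oz _]; exact: (hol_continuous hf Oz).
by have := rcontM c c; under eq_fun do rewrite -expr2.
Qed.

Lemma lnSf_cont : rcont Uf (fun z => ln (Sf z)).
Proof.
by apply: rcont_ln; [exact: Sf_cont|move=> z /Sf_gt4; lra].
Qed.

Lemma rcontX A u n : rcont A u -> rcont A (fun z => u z ^+ n).
Proof.
move=> hu; elim: n => [|n ih].
  by under eq_fun do rewrite expr0; exact: rcont_cst.
by have := rcontM hu ih; under eq_fun do rewrite -exprS.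
Qed.

Lemma D1_cont : rcont Uf D1.
Proof.
apply: rcontV; first by apply: rcontM; [exact: Sf_cont|apply: rcontX; exact: lnSf_cont].
by move=> z Uz; have := Sf_gt4 Uz; have := lnSf_gt1 Uz => ? ?; rewrite mulf_neq0 ?expf_neq0// gt_eqF//; lra.
Qed.

Lemma D2_cont : rcont Uf D2.
Proof.
apply: rcontM; first by apply: rcontD; [exact: lnSf_cont|exact: rcont_cst].
apply: rcontV; first by apply: rcontM; apply: rcontX; [exact: Sf_cont|exact: lnSf_cont].
by move=> z Uz; have := Sf_gt4 Uz; have := lnSf_gt1 Uz => ? ?; rewrite mulf_neq0 ?expf_neq0// gt_eqF//; lra.
Qed.

Lemma qf_cont : cont_on Uf qf.
Proof. by move=> z Uz; exact: has_cderiv_continuous (qf_deriv Uz). Qed.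

Lemma qf1_hol : hol Uf qf1.
Proof.
have h : hol Uf qf by move=> z Uz; eexists; exact: qf_deriv.
have h' := hol_cderiv Uf_open h.
move=> z Uz; have [l hl] := h' z Uz; exists l; apply: has_cderiv_near hl.
have [d d0 hd] := open_absc Uf_open Uz; exists d => // w /hd Uw.
by apply: cder_eq; exact: qf_deriv.
Qed.

Lemma qf1_cont : cont_on Uf qf1.
Proof. exact: hol_continuous qf1_hol. Qed.

Lemma v_cont : rcont Uf (vfun f).
Proof.
have -> : vfun f = fun z => (ln (Sf z))^-1 by apply/funext => z; exact: vfunE.
apply: rcontV; first exact: lnSf_cont.
by move=> z /lnSf_gt1 ?; rewrite gt_eqF//; lra.
Qed.

Lemma vx_cont : rcont Uf vx.
Proof.
apply: rcontM; first exact: D1_cont.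
by apply: rcontM; [exact: rcont_cst|apply: rcont_Re; exact: qf_cont].
Qed.

Lemma vy_cont : rcont Uf vy.
Proof.
apply: rcontN; apply: rcontM; first exact: D1_cont.
by apply: rcontM; [exact: rcont_cst|apply: rcont_Im; exact: qf_cont].
Qed.

Lemma vxx_cont : rcont Uf vxx.
Proof.
apply: rcontD; apply: rcontM.
- exact: D2_cont.
- by apply: rcontX; apply: rcontM; [exact: rcont_cst|apply: rcont_Re; exact: qf_cont].
- exact: D1_cont.
- by apply: rcontM; [exact: rcont_cst|apply: rcont_Re; exact: qf1_cont].
Qed.

Lemma vyy_cont : rcont Uf vyy.
Proof.
apply: rcontD; last apply: rcontN; apply: rcontM.
- exact: D2_cont.
- by apply: rcontX; apply: rcontM; [exact: rcont_cst|apply: rcont_Im; exact: qf_cont].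
- exact: D1_cont.
- by apply: rcontM; [exact: rcont_cst|apply: rcont_Re; exact: qf1_cont].
Qed.

Lemma vxy_cont : rcont Uf vxy.
Proof.
apply: rcontN; apply: rcontD; apply: rcontM.
- exact: D2_cont.
- apply: rcontM; first exact: rcont_cst.
  by apply: rcontM; [apply: rcont_Re; exact: qf_cont|apply: rcont_Im; exact: qf_cont].
- exact: D1_cont.
- by apply: rcontM; [exact: rcont_cst|apply: rcont_Im; exact: qf1_cont].
Qed.

Lemma zero_qf z : f z = 0 -> qf z = 0 /\ qf1 z = 0.
Proof.
move=> fz; rewrite /qf1 /qf fz; move: (cder (cder f) z) (cder f z) => A B.
by rewrite invr0 !mulr0 expr0n subr0.
Qed.

Lemma zero_v z : f z = 0 -> [/\ vfun f z = 0, vx z = 0, vy z = 0 & [/\ vxx z = 0, vxy z = 0 & vyy z = 0]].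
Proof.
move=> fz; have [q0 q10] := zero_qf fz.
rewrite /vx /vy /vxx /vxy /vyy q0 q10 /= /vfun fz eqxx.
by split; [..|split]; ring.
Qed.

End Vcalculus.

(** * Integrability near the zeros *)

Section SquareIntegrability.
Context {R : realType}.
Local Notation mR := (measurableTypeR R).
Local Notation area := (@area R).
Local Notation mu := (@lebesgue_measure R).

Lemma measurable_itvoo_continuous (a b : R) (h : R -> R) :
  (forall x, a < x < b -> {for x, continuous h}) ->
  measurable_fun `]a, b[%classic (h : mR -> R).
Proof.
move=> ch; apply: measurable_realfun.subspace_continuous_measurable_fun; first exact: measurable_itv.
by apply: continuous_in_subspaceT => x; rewrite inE/= in_itv/=; exact: ch.
Qed.

(** Psi and h may misbehave at the end points, so the interval is exhausted by closed ones; each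
    integral is a difference of two values of Psi, and monotone convergence passes to the limit. *)
Lemma integral_itvoo_derivative (a b B : R) (Psi h : R -> R) : a < b ->
  (forall x, a < x < b -> is_derive x (1 : R) Psi (h x)) ->
  (forall x, a < x < b -> {for x, continuous h}) ->
  (forall x, a < x < b -> 0 <= h x) ->
  (forall x, a < x < b -> `|Psi x| <= B) ->
  (\int[mu]_(x in `]a, b[) (h x)%:E <= (2 * B)%:E)%E.
Proof.
move=> ab dP ch h0 PB.
(* The denominator n + 3 makes 2 d(n) < b - a already for n = 0, so that every closed interval is
   nondegenerate. *)
pose d n : R := (b - a) / n.+3%:R.
have d0 n : 0 < d n by rewrite divr_gt0// subr_gt0.
have d2 n : d n + d n < b - a.
  rewrite /d -mulrDl ltr_pdivrMr ?ltr0n//.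
  have -> : b - a + (b - a) = (b - a) * 2%:R by ring.
  by rewrite ltr_pM2l ?subr_gt0// ltr_nat.
have dS m n : (m <= n)%N -> d n <= d m.
  by move=> mn; rewrite /d ler_pM2l ?subr_gt0// lef_pV2 ?posrE ?ltr0n// ler_nat !ltnS.
pose F n : set R := `[a + d n, b - d n]%classic.
have FE : `]a, b[%classic = \bigcup_n F n.
  apply/seteqP; split=> x /=; rewrite in_itv/=.
    move=> /andP[ax xb].
    pose e := Num.min (x - a) (b - x).
    have e0 : 0 < e by rewrite lt_min !subr_gt0 ax xb.
    have be0 : 0 <= (b - a) / e by rewrite divr_ge0 ?ltW// subr_gt0.
    exists (Num.bound ((b - a) / e)) => //.
    have de : d (Num.bound ((b - a) / e)) < e.
      rewrite /d ltr_pdivrMr ?ltr0n// mulrC -ltr_pdivrMr//.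
      by rewrite (lt_trans (archi_boundP be0))// ltr_nat -[X in (X < _)%N]addn0 -addn3 ltn_add2l.
    move: de; rewrite lt_min => /andP[k1 k2].
    by rewrite /F /= in_itv/=; apply/andP; split; lra.
  move=> [n _]; rewrite /F /= in_itv/= => /andP[h1 h2].
  by have := d0 n => ?; apply/andP; split; lra.
have inF n x : F n x -> a < x < b.
  rewrite /F /= in_itv/= => /andP[h1 h2].
  by have := d0 n => ?; apply/andP; split; lra.
have FB n : (\int[mu]_(x in F n) (h x)%:E <= (2 * B)%:E)%E.
  have lt : a + d n < b - d n by have := d2 n; lra.
  have inn x : a + d n <= x <= b - d n -> a < x < b.
    by have := d0 n => ? /andP[? ?]; apply/andP; split; lra.
  have Pc x : a < x < b -> {for x, continuous Psi}.
    move=> /dP[df _].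
    by apply: differentiable_continuous; apply/derivable1_diffP.
  have e1 : a < a + d n < b by apply: inn; rewrite lexx ltW.
  have e2 : a < b - d n < b by apply: inn; rewrite lexx ltW.
  rewrite /F (continuous_FTC2 lt (F := Psi)).
  - rewrite -EFinB lee_fin.
    have := PB _ e1; have := PB _ e2; rewrite !ler_norml => /andP[? ?] /andP[? ?]; lra.
  - apply: continuous_in_subspaceT => x; rewrite inE/= in_itv/= => xi.
    by apply: ch; exact: inn.
  - split.
    + move=> x; rewrite in_itv/= => /andP[x1 x2].
      by have [] := dP x; [apply: inn; rewrite !ltW|].
    + by apply: cvg_at_right_filter; exact: Pc.
    + by apply: cvg_at_left_filter; exact: Pc.
  - move=> x; rewrite in_itv/= => /andP[x1 x2]; rewrite derive1E.
    by have [] := dP x; [apply: inn; rewrite !ltW|].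
rewrite FE.
have cv : (\int[mu]_(x in F i) (h x)%:E)%E @[i --> \oo] --> (\int[mu]_(x in \bigcup_i F i) (h x)%:E)%E.
  apply: ge0_nondecreasing_set_cvg_integral.
  - move=> m n mn; rewrite /F; apply/subsetPset => x /=; rewrite !in_itv/= => /andP[? ?].
    by have := dS _ _ mn => ?; apply/andP; split; lra.
  - by move=> n; exact: measurable_itv.
  - move=> n; apply/measurable_EFinP.
    have := measurable_itvoo_continuous ch; apply: measurable_funS.
      exact: measurable_itv.
    by move=> x /inF; rewrite /= in_itv.
  - by move=> n x /inF; rewrite lee_fin; exact: h0.
rewrite -(cvg_lim _ cv)//; apply: lime_le; first by apply/cvg_ex; eexists; exact: cv.
exact: nearW.
Qed.

Variables (d B : R) (Psi h : R -> R).
Hypothesis d0 : 0 < d.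
Hypothesis dPsi : forall x, 0 < x < d -> is_derive x (1 : R) Psi (h x).
Hypothesis ch : forall x, 0 < x < d -> {for x, continuous h}.
Hypothesis h0 : forall x, 0 < x < d -> 0 <= h x.
Hypothesis PsiB : forall x, 0 < x < d -> `|Psi x| <= B.

(* The max-norm replaces polar coordinates: with rho = max(|x-a|, |y-b|), the
   function h(rho)/rho is at most ksq a b (x, y) + ksq b a (y, x), and the inner
   integral of ksq over the cone |y-b| <= |x-a| cancels the 1/|x-a|. *)
Let D (a : R) : set mR := [set x | 0 < `|x - a| < d].

Let D_E (a : R) : D a = `]a - d, a[%classic `|` `]a, a + d[%classic.
Proof.
apply/seteqP; split=> x; rewrite /D /=.
  rewrite ltr_norml normr_gt0 subr_eq0 => /andP[xa /andP[h1 h2]].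
  have [xlt|xgt|xe] := ltgtP x a.
  - by left; rewrite /= in_itv/= xlt andbT; lra.
  - by right; rewrite /= in_itv/= xgt; lra.
  - by rewrite xe eqxx in xa.
move=> [] /=; rewrite in_itv/= => /andP[h1 h2]; rewrite normr_gt0 subr_eq0 ltr_norml.
- by rewrite lt_eqF//; apply/andP; split; lra.
- by rewrite gt_eqF//; apply/andP; split; lra.
Qed.

Let mD a : measurable (D a).
Proof. by rewrite D_E; apply: measurableU; exact: measurable_itv. Qed.

Lemma continuous_absB (a : R) : continuous (fun x : R => `|x - a|).
Proof. by move=> x; apply: cvg_norm; apply: cvgB; [exact: cvg_id|exact: cvg_cst]. Qed.

Lemma measurable_hshift a : measurable_fun (D a) (fun x : mR => h `|x - a|).
Proof.
rewrite D_E; apply/measurable_funU; [exact: measurable_itv..|split].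
- apply: measurable_itvoo_continuous => x /andP[h1 h2].
  apply: (@continuous_comp _ _ _ (fun x => `|x - a|) h).
    exact: continuous_absB.
  by apply: ch; rewrite normr_gt0 subr_eq0 lt_eqF//= ltr_norml; apply/andP; split; lra.
- apply: measurable_itvoo_continuous => x /andP[h1 h2].
  apply: (@continuous_comp _ _ _ (fun x => `|x - a|) h).
    exact: continuous_absB.
  by apply: ch; rewrite normr_gt0 subr_eq0 gt_eqF//= ltr_norml; apply/andP; split; lra.
Qed.

Lemma integral_hshift a : (\int[mu]_(x in D a) (h `|x - a|)%:E <= (4 * B)%:E)%E.
Proof.
have nn x : D a x -> (0 <= (h `|x - a|)%:E)%E.
  by rewrite /D /= lee_fin => ?; exact: h0.
have mh : measurable_fun (D a) (fun x : mR => (h `|x - a|)%:E).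
  by apply/measurable_EFinP; exact: measurable_hshift.
rewrite D_E in nn mh *.
rewrite ge0_integral_setU//=; [|exact: measurable_itv..|]; last first.
  apply/disj_setPS => x [] /=; rewrite !in_itv/= => /andP[? ?] /andP[? ?]; lra.
have -> : 4 * B = 2 * B + 2 * B by ring.
rewrite EFinD; apply: leeD.
- have -> : (\int[mu]_(x in `](a - d)%R, a[) (h `|x - a|)%:E = \int[mu]_(x in `](a - d)%R, a[) (h (a - x))%:E)%E.
    apply: eq_integral => x; rewrite inE/= in_itv/= => /andP[_ xa].
    by rewrite distrC ger0_norm// subr_ge0 ltW.
  have sub x : a - d < x < a -> 0 < a - x < d by move=> /andP[? ?]; apply/andP; split; lra.
  apply: (integral_itvoo_derivative (Psi := fun x => - Psi (a - x))).
  + by rewrite ltrBlDr ltrDl.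
  + move=> x /sub /dPsi dd.
    have i : is_derive x (1 : R) (fun t => a - t) (-1).
      have := @is_deriveB _ _ _ (cst a) id x 1 0 1 (is_derive_cst _ _ _) (is_derive_id _ _).
      by rewrite sub0r.
    have := is_deriveN (@is_derive1_comp R Psi (fun t => a - t) x _ _ dd i).
    by rewrite mulrN1 opprK.
  + move=> x /sub /ch cc.
    apply: (@continuous_comp _ _ _ (fun x => a - x) h) => //.
    by apply: continuousB => //; exact: cst_continuous.
  + by move=> x /sub /h0.
  + by move=> x /sub /PsiB; rewrite normrN.
- have -> : (\int[mu]_(x in `]a, (a + d)%R[) (h `|x - a|)%:E = \int[mu]_(x in `]a, (a + d)%R[) (h (x - a))%:E)%E.
    apply: eq_integral => x; rewrite inE/= in_itv/= => /andP[xa _].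
    by rewrite ger0_norm// subr_ge0 ltW.
  have sub x : a < x < a + d -> 0 < x - a < d by move=> /andP[? ?]; apply/andP; split; lra.
  apply: (integral_itvoo_derivative (Psi := fun x => Psi (x - a))).
  + by rewrite ltrDl.
  + move=> x /sub /dPsi dd.
    have i : is_derive x (1 : R) (fun t => t - a) 1.
      have := @is_deriveB _ _ _ id (cst a) x 1 1 0 (is_derive_id _ _) (is_derive_cst _ _ _).
      by rewrite subr0.
    by have := @is_derive1_comp R Psi (fun t => t - a) x _ _ dd i; rewrite mulr1.
  + move=> x /sub /ch cc.
    apply: (@continuous_comp _ _ _ (fun x => x - a) h) => //.
    by apply: continuousB => //; exact: cst_continuous.
  + by move=> x /sub /h0.
  + by move=> x /sub /PsiB.
Qed.

Definition gsq (a : R) : mR -> R := (fun x => h `|x - a| / `|x - a|) \_ (D a).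

Lemma gsq_ge0 a x : 0 <= gsq a x.
Proof.
rewrite /gsq /patch; case: ifPn => //; rewrite inE => Dx.
by rewrite divr_ge0// h0.
Qed.

Lemma measurable_absB (a : R) : measurable_fun setT (fun x : mR => `|x - a|).
Proof. by apply: continuous_measurable_fun; exact: continuous_absB. Qed.

Lemma measurable_gsq a : measurable_fun setT (gsq a).
Proof.
apply/(measurable_restrictT _ _).1; first exact: mD.
apply: measurable_funM; first exact: measurable_hshift.
apply: (@measurable_comp _ _ _ _ _ _ [set x : mR | x != 0] (fun x : mR => x^-1)).
- by rewrite (_ : [set x : mR | x != 0] = ~` [set 0]); [exact: measurableC|apply/seteqP; split=> x /= /eqP].
- by move=> _ [x Dx <-]; rewrite /= gt_eqF//; case/andP: Dx.
- apply: measurable_realfun.subspace_continuous_measurable_fun.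
    by rewrite (_ : [set x : mR | x != 0] = ~` [set 0]); [exact: measurableC|apply/seteqP; split=> x /= /eqP].
  apply: continuous_in_subspaceT => x; rewrite inE /= => x0; exact: inv_continuous.
- by apply: measurable_funTS; exact: measurable_absB.
Qed.

Definition ksq (a b : R) (p : mR * mR) : R :=
  gsq a p.1 * (\1_[set p : mR * mR | `|p.2 - b| <= `|p.1 - a|] p).

Lemma measurable_cone (a b : R) :
  measurable [set p : mR * mR | `|p.2 - b| <= `|p.1 - a|].
Proof.
have m1 : measurable_fun setT (fun p : mR * mR => `|p.1 - a|).
  by apply: (measurableT_comp (measurable_absB a)); exact: measurable_fst.
have m2 : measurable_fun setT (fun p : mR * mR => `|p.2 - b|).
  by apply: (measurableT_comp (measurable_absB b)); exact: measurable_snd.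
have := measurable_fun_ler m2 m1 measurableT (Y := [set true]) I.
by rewrite setTI; congr measurable; apply/seteqP; split=> p.
Qed.

Lemma measurable_ksq a b : measurable_fun setT (ksq a b).
Proof.
apply: measurable_funM.
  by apply: (measurableT_comp (measurable_gsq a)); exact: measurable_fst.
by apply: measurable_indic; exact: measurable_cone.
Qed.

Lemma ksq_ge0 a b p : 0 <= ksq a b p.
Proof. by rewrite mulr_ge0 ?gsq_ge0. Qed.

Lemma measure_absB (b r : R) : 0 <= r ->
  mu [set y : mR | `|y - b| <= r] = (2 * r)%:E.
Proof.
move=> r0; have -> : [set y : mR | `|y - b| <= r] = `[b - r, b + r]%classic.
  apply/seteqP; split=> y /=; rewrite in_itv/= ler_norml.
    by move=> /andP[? ?]; apply/andP; split; lra.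
  by move=> /andP[? ?]; apply/andP; split; lra.
rewrite lebesgue_measure_itv/= lte_fin.
have [lt|] := ltP (b - r) (b + r); first by rewrite -EFinB; congr (_%:E); ring.
by move=> le; congr (_%:E); lra.
Qed.

Lemma integral_ksq_inner a b (x : mR) :
  (\int[mu]_y (ksq a b (x, y))%:E = (2 * h `|x - a|)%:E * (\1_(D a) x)%:E)%E.
Proof.
rewrite /ksq /=.
under eq_integral do rewrite EFinM.
have mS : measurable [set y : mR | `|y - b| <= `|x - a|].
  have -> : [set y : mR | `|y - b| <= `|x - a|] = `[b - `|x - a|, b + `|x - a|]%classic.
    apply/seteqP; split=> y /=; rewrite in_itv/= ler_norml.
      by move=> /andP[? ?]; apply/andP; split; lra.
    by move=> /andP[? ?]; apply/andP; split; lra.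
  exact: measurable_itv.
have E : (fun y : mR => (gsq a x)%:E * (\1_[set p : mR * mR | (`|p.2 - b| <= `|p.1 - a|)%R] (x, y))%:E)%E =
   (fun y : mR => (gsq a x)%:E * (\1_[set y : mR | (`|y - b| <= `|x - a|)%R] y)%:E)%E.
  by apply/funext => y; rewrite !indicE.
have mI : measurable_fun setT (fun y : mR => (\1_[set y : mR | `|y - b| <= `|x - a|] y)%:E : \bar R).
  by apply/measurable_EFinP; exact: measurable_indic.
have I0 (y : mR) : setT y -> (0 <= (\1_[set y : mR | (`|y - b| <= `|x - a|)%R] y)%:E :> \bar R)%E.
  by rewrite lee_fin.
have g0 : (0 <= (gsq a x)%:E)%E by rewrite lee_fin gsq_ge0.
rewrite E ge0_integralZl//.
rewrite integral_indic// setIT.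
transitivity ((gsq a x)%:E * (2 * `|x - a|)%:E)%E.
  by congr (_ * _)%E; exact: measure_absB.
rewrite /gsq /patch indicE.
case: ifPn => [|_]; last by rewrite mul0e mule0.
rewrite inE => /andP[xa _].
by rewrite mule1 -EFinM; congr (_%:E); field; rewrite gt_eqF.
Qed.

Lemma integral_ksq a b : (\int[area]_p (ksq a b p)%:E <= (8 * B)%:E)%E.
Proof.
rewrite /area fubini_tonelli1; last 2 first.
- by apply/measurable_EFinP; exact: measurable_ksq.
- by move=> p; rewrite lee_fin ksq_ge0.
rewrite /fubini_F; under eq_integral do rewrite integral_ksq_inner.
have E : (fun x : mR => (2 * h `|x - a|)%:E * (\1_(D a) x)%:E)%E =
    (fun x => (2 * h `|x - a|)%:E) \_ (D a).
  apply/funext => x; rewrite /patch indicE; case: ifP; rewrite ?mule1 ?mule0//.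
rewrite E -integral_mkcond.
under eq_integral do rewrite EFinM.
have mh : measurable_fun (D a) (fun x : mR => (h `|x - a|)%:E).
  by apply/measurable_EFinP; exact: measurable_hshift.
have hn (x : mR) : D a x -> (0 <= (h `|x - a|)%:E)%E.
  by move=> Dx; rewrite lee_fin h0.
have two : (0 <= 2%:E :> \bar R)%E by rewrite lee_fin.
rewrite (ge0_integralZl mu (mD a) mh hn two).
have -> : 8 * B = 2 * (4 * B) by ring.
by rewrite EFinM lee_wpmul2l// integral_hshift.
Qed.

Lemma integrable_ksq a b : area.-integrable setT (EFin \o ksq a b).
Proof.
apply/integrableP; split; first by apply/measurable_EFinP; exact: measurable_ksq.
apply: le_lt_trans (ltry (8 * B)).
have -> : (\int[area]_p `|(EFin \o ksq a b) p| = \int[area]_p (ksq a b p)%:E)%E.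
  by apply: eq_integral => p _ /=; rewrite ger0_norm ?ksq_ge0.
exact: integral_ksq.
Qed.

Lemma integral_ksq_swap a b : (\int[area]_p (ksq b a (p.2, p.1))%:E <= (8 * B)%:E)%E.
Proof.
have mk : measurable_fun setT (fun p : mR * mR => (ksq b a (p.2, p.1))%:E).
  apply/measurable_EFinP; apply: (measurableT_comp (measurable_ksq b a)).
  exact: measurable_swap.
have k0 (p : mR * mR) : (0 <= (ksq b a (p.2, p.1))%:E)%E by rewrite lee_fin ksq_ge0.
rewrite /area fubini_tonelli1// /fubini_F (fubini_tonelli _ mk k0)/=.
have := integral_ksq b a; rewrite /area fubini_tonelli1//.
- by apply/measurable_EFinP; exact: measurable_ksq.
- by move=> p; rewrite lee_fin ksq_ge0.
Qed.

Lemma integrable_ksq_swap a b : area.-integrable setT (EFin \o (fun p => ksq b a (p.2, p.1))).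
Proof.
apply/integrableP; split.
  apply/measurable_EFinP; apply: (measurableT_comp (measurable_ksq b a)).
  exact: measurable_swap.
apply: le_lt_trans (ltry (8 * B)).
have -> : (\int[area]_p `|(EFin \o (fun p => ksq b a (p.2, p.1))) p| =
    \int[area]_p (ksq b a (p.2, p.1))%:E)%E.
  by apply: eq_integral => p _ /=; rewrite ger0_norm ?ksq_ge0.
exact: integral_ksq_swap.
Qed.

(** The larger coordinate difference is rho and decides which of the two kernels equals h(rho)/rho;
    the other one is nonnegative. *)
Lemma ksq_sum a b (p : mR * mR) : let rho := Num.max `|p.1 - a| `|p.2 - b| in
  0 < rho < d -> h rho / rho <= ksq a b p + ksq b a (p.2, p.1).
Proof.
case: p => x y rho; rewrite /rho /= => {rho}.
have [le Dx|lt Dy] := leP `|y - b| `|x - a|.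
  have E1 : gsq a x = h `|x - a| / `|x - a| by rewrite /gsq /patch mem_set.
  have E2 : \1_[set p : mR * mR | `|p.2 - b| <= `|p.1 - a|] (x, y) = 1 :> R.
    by rewrite indicE mem_set.
  by rewrite [ksq a b _]/ksq E1 E2 mulr1 lerDl; exact: ksq_ge0.
have E1 : gsq b y = h `|y - b| / `|y - b| by rewrite /gsq /patch mem_set.
have E2 : \1_[set p : mR * mR | `|p.2 - a| <= `|p.1 - b|] (y, x) = 1 :> R.
  by rewrite indicE mem_set//=; exact: ltW.
by rewrite [ksq b a _]/ksq E1 E2 mulr1 lerDr; exact: ksq_ge0.
Qed.

End SquareIntegrability.

(** * Behaviour of q and Q at a zero *)

Section ZeroStructure.
Context {R : realType}.
Variables (Om : set R[i]) (f : R[i] -> R[i]).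
Hypothesis dOm : domain Om.
Hypothesis hf : hol Om f.
Hypothesis nc : ~ constant_on Om f.
Hypothesis fsmall : forall z, Om z -> absc (f z) < 1 / 10.
Implicit Types (z w : R[i]).
Let oOm : open Om. Proof. by case: dOm. Qed.

(** For f = (z - a)^m g one has q = m/(z - a) + g'/g, and q' follows by differentiation. A single M
    bounds g'/g, its derivative, g and 1/g near a. *)
Lemma zero_structure a : Om a -> f a = 0 -> exists (m : nat) (M d : R),
  [/\ (0 < m)%N, 1 <= M, 0 < d, d <= 1 & forall z, 0 < absc (z - a) < d ->
    [/\ Uf Om f z, absc (qf f z - m%:R / (z - a)) <= M,
        absc (qf1 f z + m%:R / (z - a) ^+ 2) <= M,
        absc (f z) <= M * absc (z - a) ^+ m & absc (z - a) ^+ m <= M * absc (f z)]].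
Proof.
move=> Oa fa; have [m [g [d d0 [m0 hg]]]] := domain_zero dOm hf nc Oa fa.
pose B := [set z | absc (z - a) < d].
have oB : open B.
  apply: open_abscP => z; rewrite /B /= => zd; exists (d - absc (z - a)); first by rewrite subr_gt0.
  move=> w wz; have -> : w - a = (w - z) + (z - a) by rewrite addrA subrK.
  by apply: (le_lt_trans (ler_abscD _ _)); lra.
have Ba : B a by rewrite /B /= subrr absc0.
have gh : hol B g by move=> z /hg[].
have g0 z : B z -> g z != 0 by move=> /hg[].
have Gh : hol B (qf g).
  move=> z Bz; have [l hl] := holM (hol_cderiv oB gh) (holV gh g0) Bz.
  by exists l.
have Gc := hol_cder Gh.
have qE z : B z -> z != a -> qf f z = m%:R / (z - a) + qf g z.
  move=> Bz za; have za0 : z - a != 0 by rewrite subr_eq0.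
  have d1 := has_cderivX m (has_cderivB (has_cderiv_id z) (has_cderiv_cst z a)).
  have d2 := has_cderivM d1 (hol_cder gh Bz).
  have E : cder f z = (z - a) ^+ m * cder g z + g z * (m%:R * (z - a) ^+ m.-1 * (1 - 0)).
    apply: cder_eq; apply: has_cderiv_near d2.
    have [r r0 hr] := open_absc oB Bz; exists r => // w /hr Bw.
    by have [_ _ _ ->] := hg w Bw.
  have [_ _ gz fz] := hg z Bz.
  rewrite /qf E fz; case: m m0 {hg d1 d2 E fz} => // n _ /=.
  have : (z - a) ^+ n != 0 by rewrite expf_neq0.
  rewrite exprS; move: ((z - a) ^+ n) (z - a) za0 (g z) gz (cder g z) => A C C0 D D0 E A0.
  by field; rewrite C0 D0 A0.
have UB z : B z -> z != a -> Uf Om f z.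
  move=> Bz za; have [Oz _ gz fz] := hg z Bz; split=> //.
  by rewrite fz mulf_neq0// expf_neq0// subr_eq0.
have q1E z : B z -> z != a -> qf1 f z = - (m%:R / (z - a) ^+ 2) + cder (qf g) z.
  move=> Bz za; have za0 : z - a != 0 by rewrite subr_eq0.
  have h1 := qf_deriv oOm hf (UB z Bz za).
  have i1 := has_cderivV (f := fun w => w - a) za0 (has_cderivB (has_cderiv_id z) (has_cderiv_cst z a)).
  have i2 := has_cderivD (has_cderivM (has_cderiv_cst z m%:R) i1) (Gc z Bz).
  apply: (has_cderiv_unique h1).
  rewrite (_ : - _ + _ = m%:R * (- (1 - 0) / (z - a) ^+ 2) + (z - a)^-1 * 0 + cder (qf g) z); last first.
    move: (cder _ z) (z - a) za0 => A C C0; by field.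
  apply: has_cderiv_near i2.
  have [r r0 hr] := open_absc oB Bz.
  exists (Num.min r (absc (z - a))); first by rewrite lt_min r0 absc_gt0.
  move=> w; rewrite lt_min => /andP[/hr Bw wz].
  rewrite qE//; apply: contraTneq wz => ->; by rewrite absc_distC ltxx.
have bnd (u : R[i] -> R[i]) : {for a, continuous u} ->
    exists M r : R, [/\ 0 <= M, 0 < r & forall z, absc (z - a) < r -> absc (u z) <= M].
  move=> /continuousC_abscP/(_ 1 ltr01)[r r0 hr]; exists (absc (u a) + 1), r.
  split=> //; first by rewrite addr_ge0// absc_ge0.
  by move=> z /hr h; have := ler_abscD (u z - u a) (u a); rewrite subrK; lra.
have [M1 [r1 [M10 r10 b1]]] := bnd _ (hol_continuous Gh Ba).
have [M2 [r2 [M20 r20 b2]]] := bnd _ (hol_continuous (hol_cderiv oB Gh) Ba).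
have [M3 [r3 [M30 r30 b3]]] := bnd _ (hol_continuous gh Ba).
have [M4 [r4 [M40 r40 b4]]] := bnd _ (hol_continuous (holV gh g0) Ba).
exists m, (M1 + M2 + M3 + M4 + 1), (Num.min (Num.min d 1) (Num.min (Num.min r1 r2) (Num.min r3 r4))).
split=> //; first by lra.
- by rewrite !lt_min d0 ltr01 r10 r20 r30 r40.
- by rewrite !ge_min lexx orbT.
move=> z /andP[za0]; rewrite !lt_min => /andP[/andP[Bz _] /andP[/andP[/b1 c1 /b2 c2] /andP[/b3 c3 /b4 c4]]].
have za : z != a by rewrite -subr_eq0 -absc_gt0.
split.
- exact: UB.
- by rewrite (qE z Bz za) [m%:R / _ + _]addrC addrK; lra.
- by rewrite (q1E z Bz za) addrAC addNr add0r; lra.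
- have [_ _ _ ->] := hg z Bz; rewrite abscM abscX mulrC ler_wpM2r ?exprn_ge0 ?absc_ge0//; lra.
- have [_ _ gz ->] := hg z Bz; rewrite abscM abscX mulrCA ler_peMr ?exprn_ge0 ?absc_ge0//.
  rewrite -ler_pdivrMr ?absc_gt0// mul1r -abscV; lra.
Qed.

Definition Qf z : R := D1 f z * (absc (qf f z) ^+ 2 + absc (qf1 f z)).

(** [hlog] is the derivative of [Philog], and [hlog rho / rho] is the radial majorant of Q; the pair
    is the instance of [h] and [Psi] to which the lemmas on [ksq] are applied. *)
Definition hlog (t : R) : R := (t * (- ln t) * ln (- ln t) ^+ 2)^-1.
Definition Philog (t : R) : R := (ln (- ln t))^-1.

(** The threshold exp(-3) is chosen for - log t > 3 > e, which makes log(- log t) > 1. *)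
Lemma ln_small (t : R) : 0 < t < expR (- 3) -> 3 < - ln t.
Proof.
move=> /andP[t0 t3]; have : ln t < ln (expR (- 3)) by rewrite ltr_ln ?posrE ?expR_gt0.
by rewrite expRK; lra.
Qed.

Lemma lnln_small (t : R) : 0 < t < expR (- 3) -> 1 < ln (- ln t).
Proof.
move=> /ln_small h3; have e3 := @expR1_lt3 R.
by rewrite -[1]expRK ltr_ln ?posrE ?expR_gt0//; lra.
Qed.

Lemma Philog_deriv (t : R) : 0 < t < expR (- 3) -> is_derive t (1 : R) Philog (hlog t).
Proof.
move=> ht; have h3 := ln_small ht; have h1 := lnln_small ht.
have /andP[t0 _] := ht.
have d1 := is_deriveN1 (is_derive1_ln t0).
have S0 : 0 < - ln t by lra.
have L0 : 0 < ln (- ln t) by lra.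
apply: is_derive_ext (is_derive_invln (S := fun t => - ln t) S0 L0 d1) => //.
rewrite /hlog opprK -invfM; congr _^-1; ring.
Qed.

Lemma hlog_cont (t : R) : 0 < t < expR (- 3) -> {for t, continuous hlog}.
Proof.
move=> ht; have h3 := ln_small ht; have h1 := lnln_small ht.
have /andP[t0 _] := ht.
have c1 : {for t, continuous (fun t : R => - ln t)}.
  by apply: continuousN; exact: continuous_ln.
have c2 : {for t, continuous (fun t : R => ln (- ln t))}.
  apply: (@continuous_comp _ _ _ (fun t : R => - ln t) (@ln R)) => //.
  by apply: continuous_ln; lra.
have c3 : {for t, continuous (fun t : R => ln (- ln t) ^+ 2)}.
  by have := continuousM c2 c2.
have c4 : {for t, continuous (fun t : R => t * (- ln t))}.
  by apply: (@continuousM _ _ id) => //; exact: cvg_id.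
apply: (@continuousV _ _ (fun t : R => t * (- ln t) * ln (- ln t) ^+ 2)).
  by rewrite !mulf_neq0 ?expf_neq0// gt_eqF//; lra.
exact: (continuousM c4 c3).
Qed.

Lemma hlog_ge0 (t : R) : 0 < t < expR (- 3) -> 0 <= hlog t.
Proof.
move=> ht; have h3 := ln_small ht; have h1 := lnln_small ht; have /andP[t0 _] := ht.
by rewrite /hlog invr_ge0 !mulr_ge0 ?sqr_ge0//; lra.
Qed.

Lemma Philog_bound (t : R) : 0 < t < expR (- 3) -> `|Philog t| <= 1.
Proof.
move=> ht; have h1 := lnln_small ht.
by rewrite /Philog ger0_norm ?invr_ge0 ?invf_le1//; lra.
Qed.

Definition maxnorm z : R := Num.max `|complex.Re z| `|complex.Im z|.

Lemma maxnorm_le z : maxnorm z <= absc z.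
Proof. by rewrite /maxnorm ge_max ler_Re_absc ler_Im_absc. Qed.

Lemma absc_le_maxnorm z : absc z <= 2 * maxnorm z.
Proof.
apply: (le_trans (ler_absc_ReIm _)); have -> : 2 * maxnorm z = maxnorm z + maxnorm z by ring.
by apply: lerD; rewrite /maxnorm le_max lexx ?orbT.
Qed.

(** Two bounds are multiplied: S >= - log rho gives D1 <= 1/((- log rho) log^2(- log rho)), and the
    pole of q gives |q|^2 + |q'| <= (K^2 + K)/rho^2. *)
Lemma Qf_near_zero a : Om a -> f a = 0 -> exists C d : R,
  [/\ 0 <= C, 0 < d, d <= expR (- 3) & forall z, 0 < maxnorm (z - a) < d ->
   [/\ Uf Om f z, 0 <= Qf z & Qf z <= C * (hlog (maxnorm (z - a)) / maxnorm (z - a))]].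
Proof.
move=> Oa fa; have [m [M [d [m0 M1 d0 d1 H]]]] := zero_structure Oa fa.
pose K := m%:R + M; have K0 : 0 <= K by rewrite addr_ge0// ?ler0n; lra.
(* d/2 serves because |z - a| <= 2 rho; exp(-3) keeps [hlog] under control; the last entry turns
   |f|^2 <= (2 M rho)^2 into |f|^2 <= rho, that is S >= - log rho. *)
pose d' := Num.min (Num.min (d / 2) (expR (- 3))) (4 * M ^+ 2)^-1.
exists (K ^+ 2 + K), d'; split.
- by rewrite addr_ge0// sqr_ge0.
- by rewrite !lt_min divr_gt0// expR_gt0 invr_gt0 mulr_gt0// exprn_gt0//; lra.
- by rewrite !ge_min lexx orbT.
move=> z; set rho := maxnorm (z - a); set r := absc (z - a).
rewrite !lt_min => /andP[rho0 /andP[/andP[rd r3] rM]].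
have rr : rho <= r by exact: maxnorm_le.
have r2 : r <= 2 * rho by exact: absc_le_maxnorm.
have r0 : 0 < r by exact: lt_le_trans rr.
have rd1 : r < d by lra.
have [Uz q1 q2 fu _] := H z (ltac:(by rewrite r0 rd1)).
have ht : 0 < rho < expR (- 3) by rewrite rho0 r3.
have S4 := Sf_gt4 fsmall Uz; have L1 := lnSf_gt1 fsmall Uz.
have h3 := ln_small ht; have h1 := lnln_small ht.
have D10 : 0 < D1 f z by rewrite /D1 invr_gt0 mulr_gt0// ?exprn_gt0//; lra.
have fz0 : 0 < absc (f z) by rewrite absc_gt0; case: Uz.
have SL : - ln rho <= Sf f z.
  rewrite /Sf lerN2 ler_ln ?posrE ?exprn_gt0//.
  have fr : absc (f z) <= M * r.
    apply: (le_trans fu); rewrite -/r ler_wpM2l//; first lra.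
    case: m m0 {H K K0 q1 q2 fu} => // n _; rewrite exprS.
    by apply: ler_piMr; [exact: ltW|apply: exprn_ile1; lra].
  have fr2 : absc (f z) ^+ 2 <= (M * (2 * rho)) ^+ 2.
    have M0 : 0 <= M by lra.
    have frr : absc (f z) <= M * (2 * rho) by apply: (le_trans fr); rewrite ler_wpM2l.
    apply: lerXn2r => //; rewrite nnegrE; first exact: absc_ge0.
    exact: le_trans (absc_ge0 _) frr.
  apply: (le_trans fr2).
  have -> : (M * (2 * rho)) ^+ 2 = rho * (rho * (4 * M ^+ 2)) by ring.
  apply: ler_piMr; first exact: ltW.
  have M40 : 0 < 4 * M ^+ 2 by rewrite mulr_gt0// exprn_gt0//; lra.
  by rewrite -ler_pdivlMr// mul1r ltW.
have D1h : D1 f z <= (- ln rho * ln (- ln rho) ^+ 2)^-1.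
  rewrite /D1 lef_pV2 ?posrE; try (by rewrite mulr_gt0// ?exprn_gt0//; lra).
  apply: ler_pM; rewrite ?sqr_ge0//; first lra.
  rewrite lerXn2r ?nnegrE//; [lra|lra|].
  by rewrite ler_ln ?posrE//; lra.
have am : absc (m%:R : R[i]) = m%:R.
  have -> : (m%:R : R[i]) = (m%:R : R)%:C by rewrite rmorph_nat.
  by rewrite absc_real ger0_norm.
have rn : 1 <= r^-1 by rewrite invf_ge1//; lra.
have qb : absc (qf f z) <= K / r.
  have := ler_abscD (qf f z - m%:R / (z - a)) (m%:R / (z - a)); rewrite subrK => /le_trans -> //.
  rewrite abscM abscV am -/r /K mulrDl addrC lerD2l (le_trans q1)//.
  by rewrite ler_peMr//; lra.
have q1b : absc (qf1 f z) <= K / r ^+ 2.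
  have := ler_abscB (qf1 f z + m%:R / (z - a) ^+ 2) (m%:R / (z - a) ^+ 2); rewrite addrK => /le_trans -> //.
  rewrite [absc (_ / _)]abscM abscV abscX am -/r /K mulrDl addrC lerD2l (le_trans q2)//.
  rewrite ler_peMr//; [lra|rewrite invf_ge1 ?exprn_gt0// exprn_ile1//; lra].
split=> //.
  by rewrite /Qf; apply: mulr_ge0; [exact: ltW|rewrite addr_ge0 ?sqr_ge0 ?absc_ge0].
have qq : absc (qf f z) ^+ 2 + absc (qf1 f z) <= (K ^+ 2 + K) / rho ^+ 2.
  have k1 : absc (qf f z) ^+ 2 <= (K / r) ^+ 2.
    by apply: lerXn2r => //; rewrite nnegrE ?absc_ge0// divr_ge0// ltW.
  apply: (le_trans (lerD k1 q1b)).
  rewrite expr_div_n -mulrDl; apply: ler_wpM2l; first by rewrite addr_ge0 ?sqr_ge0.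
  by rewrite lef_pV2 ?posrE ?exprn_gt0//; apply: lerXn2r => //; rewrite nnegrE ltW.
rewrite /Qf; apply: (le_trans (ler_pM _ _ D1h qq)); first exact: ltW.
  by rewrite addr_ge0 ?sqr_ge0 ?absc_ge0.
have n1 : ln rho != 0 by rewrite lt_eqF//; lra.
have n2 : ln (- ln rho) != 0 by rewrite gt_eqF//; lra.
have n3 : rho != 0 by rewrite gt_eqF.
rewrite le_eqVlt; apply/orP; left; apply/eqP; rewrite /hlog; field.
by rewrite n1 n2 n3.
Qed.

End ZeroStructure.

(** * Local integrability of Q and of functions dominated by it *)

Section LocalIntegrability.
Context {R : realType}.
Implicit Types (z w : R[i]) (u : R[i] -> R) (K : set R[i]).
Local Notation mR := (measurableTypeR R).
Local Notation area := (@area R).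

Definition intK K u := area.-integrable setT (EFin \o ((u \_ K) \o of_plane)).

Definition cball z (d : R) : set R[i] := [set w | absc (w - z) < d].

Lemma open_cball z d : open (cball z d).
Proof.
apply: open_abscP => w; rewrite /cball /= => wz; exists (d - absc (w - z)).
  by rewrite subr_gt0.
move=> x xw; have -> : x - z = (x - w) + (w - z) by rewrite addrA subrK.
by apply: (le_lt_trans (ler_abscD _ _)); lra.
Qed.

Lemma restrict_comp K u : (u \_ K) \o of_plane = (u \o of_plane) \_ (of_plane @^-1` K) :> (mR * mR -> R).
Proof.
by apply/funext => p; rewrite /= /patch; congr (if _ then _ else _); rewrite !inE.
Qed.

Lemma measurable_restrict_sub (A B : set R[i]) u : measurable (of_plane @^-1` B : set (mR * mR)) ->
  B `<=` A -> measurable_fun setT ((u \_ A) \o of_plane : mR * mR -> R) ->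
  measurable_fun setT ((u \_ B) \o of_plane : mR * mR -> R).
Proof.
move=> mB BA mA.
have -> : (u \_ B) = ((u \_ A) \_ B).
  apply/funext => z; rewrite /patch; case: ifPn => //; rewrite inE => /BA Az.
  by rewrite mem_set.
rewrite (restrict_comp B); apply: (iffLR (measurable_restrictT _ mB)).
exact: (measurable_funS measurableT (@subsetT _ _) mA).
Qed.

Lemma measurable_compact_plane K : compact K -> measurable (of_plane @^-1` K : set (mR * mR)).
Proof. by move=> cK; apply: measurable_closed; exact: compact_closed_plane. Qed.

(** Finitely many of the discs cover K, and the sum of |u| over these discs is an integrable
    majorant of u on K. *)
Lemma intK_local (A : set R[i]) u : measurable_fun setT ((u \_ A) \o of_plane : mR * mR -> R) ->
  (forall z, A z -> exists2 d : R, 0 < d & intK (cball z d) u) ->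
  forall K, compact K -> K `<=` A -> intK K u.
Proof.
move=> mu loc K cK KA.
have /choice[d hd] : forall z, exists d : R, A z -> 0 < d /\ intK (cball z d) u.
  move=> z; have [Az|nA] := pselect (A z); last by exists 0.
  by have [d d0 hd] := loc z Az; exists d.
have := cK; rewrite compact_cover => /(_ _ K (fun z => cball z (d z))) [].
- by move=> z _; exact: open_cball.
- by move=> z Kz; exists z => //; rewrite /cball /= subrr absc0; have [] := hd z (KA _ Kz).
move=> D DK cov.
(* The test [K z] keeps, inside the sum, the information that the centre lies in A; only then is
   something known about the radius [d z]. *)
have iS : area.-integrable setT (fun p => \sum_(z <- finmap.enum_fset D)
    (if `[< K z >] then `|(u \_ (cball z (d z))) (of_plane p)|%:E else 0))%E.
  apply: integrable_sum => // z _.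
  case: asboolP => Kz; last exact: integrable0.
  have [_ hi] := hd z (KA _ Kz).
  exact: (integrable_norm hi).
apply: le_integrable iS => //.
  apply/measurable_EFinP; apply: measurable_restrict_sub mu => //.
  exact: measurable_compact_plane.
move=> p _ /=; rewrite gee0_abs; last first.
  by apply: sume_ge0 => z _; case: ifP => // _; rewrite lee_fin.
rewrite /patch; case: ifPn => Kp; last first.
  by rewrite normr0; apply: sume_ge0 => z _; case: ifP => // _; rewrite lee_fin.
have Kp' : K (of_plane p) by move: Kp; rewrite inE.
have [z Dz hz] := cov _ Kp'.
have Kz : K z by have := DK z Dz; rewrite inE.
rewrite (big_rem z) //= asboolT// mem_set// leeDl//.
by apply: sume_ge0 => w _; case: ifP => // _; rewrite lee_fin.
Qed.

Lemma bounded_in_box (d : R) z w : absc (w - z) < d -> in_box (absc z + d) w.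
Proof.
move=> wz; have h : absc w < absc z + d.
  by have := ler_abscD (w - z) z; rewrite subrK; lra.
by split; apply: le_lt_trans h; [exact: ler_Re_absc|exact: ler_Im_absc].
Qed.

Lemma intK_bounded K u (M B : R) : measurable_fun setT ((u \_ K) \o of_plane : mR * mR -> R) ->
  (forall z, K z -> `|u z| <= M) -> (forall z, K z -> in_box B z) -> intK K u.
Proof.
move=> mu uM KB; apply: (@integrable_bounded R _ `|M| B) => //.
- move=> p; rewrite /= /patch; case: ifPn => [|_]; last by rewrite normr0.
  by rewrite inE => /uM h; apply: (le_trans h); exact: ler_norm.
- by move=> p; rewrite /= /patch; case: ifPn => [|_]; [rewrite inE => /KB|rewrite eqxx].
Qed.

End LocalIntegrability.

Section QIntegrability.
Context {R : realType}.
Variables (Om : set R[i]) (f : R[i] -> R[i]).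
Hypothesis dOm : domain Om.
Hypothesis hf : hol Om f.
Hypothesis nc : ~ constant_on Om f.
Hypothesis fsmall : forall z, Om z -> absc (f z) < 1 / 10.
Implicit Types (z w : R[i]).
Local Notation mR := (measurableTypeR R).
Let oOm : open Om. Proof. by case: dOm. Qed.

(** Since u vanishes on the zeros, its extensions by 0 from Om and from the open set [Uf] agree, and
    u is continuous on the latter. *)
Lemma measurable_zero_ext (u : R[i] -> R) : rcont (Uf Om f) u -> (forall z, f z = 0 -> u z = 0) ->
  measurable_fun setT ((u \_ Om) \o of_plane : mR * mR -> R).
Proof.
move=> cu u0; have -> : u \_ Om = u \_ (Uf Om f).
  apply/funext => z; rewrite /patch; have [Oz|nO] := pselect (Om z); last first.
    by rewrite !memNset// => -[].
  have [fz|fz] := eqVneq (f z) 0; first by rewrite mem_set// u0//; case: ifP.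
  by rewrite !mem_set.
by apply: measurable_restrict_open => //; exact: Uf_open.
Qed.

Lemma Qf_cont : rcont (Uf Om f) (Qf f).
Proof.
apply: rcontM; first exact: D1_cont.
apply: rcontD.
  by apply: rcontX; apply: rcont_absc; exact: qf_cont.
by apply: rcont_absc; exact: qf1_cont.
Qed.

Lemma Qf_zero z : f z = 0 -> Qf f z = 0.
Proof.
by move=> /zero_qf[q0 q1]; rewrite /Qf q0 q1 absc0 expr0n addr0 mulr0.
Qed.

Lemma Qf_ge0 z : Om z -> 0 <= Qf f z.
Proof.
move=> Oz; have [fz|fz] := eqVneq (f z) 0; first by rewrite Qf_zero.
have Uz : Uf Om f z by [].
have S4 := Sf_gt4 fsmall Uz.
rewrite /Qf mulr_ge0 ?addr_ge0 ?sqr_ge0 ?absc_ge0//.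
by rewrite /D1 invr_ge0 mulr_ge0 ?sqr_ge0//; lra.
Qed.

(** It suffices to find a disc about each point. Where f is nonzero, Q is continuous, hence bounded
    nearby; at a zero the radial majorant is at most the sum of the two cone kernels, which are
    integrable. *)
Lemma Qf_int K : compact K -> K `<=` Om -> intK K (Qf f).
Proof.
have mQ := measurable_zero_ext Qf_cont Qf_zero.
apply: intK_local => // z Oz.
have [fz|fz] := eqVneq (f z) 0; last first.
  have Uz : Uf Om f z by [].
  have [d1 d10 h1] := open_absc (Uf_open oOm hf) Uz.
  have [d2 d20 h2] := (continuous_abscP _ _).1 (Qf_cont Uz) 1 ltr01.
  exists (Num.min d1 d2); first by rewrite lt_min d10.
  apply: (@intK_bounded _ _ _ (`|Qf f z| + 1) (absc z + Num.min d1 d2)).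
  - apply: measurable_restrict_sub mQ; first by apply: measurable_open; exact: open_cball.
    by move=> w; rewrite /cball /= lt_min => /andP[/h1[]].
  - move=> w; rewrite /cball /= lt_min => /andP[_ /h2].
    by have := ler_normD (Qf f w - Qf f z) (Qf f z); rewrite subrK; lra.
  - by move=> w; exact: bounded_in_box.
have [C [d [C0 d0 d3 hQ]]] := Qf_near_zero dOm hf nc fsmall Oz fz.
have [e e0 he] := open_absc oOm Oz.
pose r := Num.min d e.
exists r; first by rewrite lt_min d0.
have sub x : 0 < x < d -> 0 < x < expR (- 3) by move=> /andP[-> /lt_le_trans -> //].
have i1 := integrable_ksq (d := d) (B := 1) (Psi := @Philog R) (h := @hlog R) d0
  (fun x xd => Philog_deriv (sub x xd)) (fun x xd => hlog_cont (sub x xd))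
  (fun x xd => hlog_ge0 (sub x xd)) (fun x xd => Philog_bound (sub x xd)) (complex.Re z) (complex.Im z).
have i2 := integrable_ksq_swap (d := d) (B := 1) (Psi := @Philog R) (h := @hlog R) d0
  (fun x xd => Philog_deriv (sub x xd)) (fun x xd => hlog_cont (sub x xd))
  (fun x xd => hlog_ge0 (sub x xd)) (fun x xd => Philog_bound (sub x xd)) (complex.Re z) (complex.Im z).
have i3 := integrableZl measurableT C (integrableD measurableT i1 i2).
apply: le_integrable i3 => //.
  apply/measurable_EFinP; apply: measurable_restrict_sub mQ.
    by apply: measurable_open; exact: open_cball.
  by move=> w; rewrite /cball /= lt_min => /andP[_ /he].
move=> p _ /=; rewrite lee_fin.
have k1 := ksq_ge0 (fun x xd => hlog_ge0 (sub x xd)) (complex.Re z) (complex.Im z) p.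
have k2 := ksq_ge0 (fun x xd => hlog_ge0 (sub x xd)) (complex.Im z) (complex.Re z) (p.2, p.1).
rewrite [leRHS]ger0_norm ?mulr_ge0 ?addr_ge0//.
rewrite /patch; case: ifPn => [|_]; last by rewrite normr0 mulr_ge0// addr_ge0.
rewrite inE /cball /= /r lt_min => /andP[wd we].
rewrite ger0_norm; last by apply: Qf_ge0; exact: he.
have [wz|wz] := eqVneq (of_plane p) z.
  by rewrite wz Qf_zero// mulr_ge0// addr_ge0.
have m0 : 0 < maxnorm (of_plane p - z).
  have := absc_le_maxnorm (of_plane p - z); have : 0 < absc (of_plane p - z) by rewrite absc_gt0 subr_eq0.
  lra.
have m1 : maxnorm (of_plane p - z) < d by exact: le_lt_trans (maxnorm_le _) wd.
have [_ _ q] := hQ (of_plane p) (ltac:(by rewrite m0 m1)).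
apply: (le_trans q); rewrite ler_wpM2l//.
have := @ksq_sum R d (@hlog R) (fun x xd => hlog_ge0 (sub x xd)) (complex.Re z) (complex.Im z) p.
have -> : maxnorm (of_plane p - z) = Num.max `|p.1 - complex.Re z| `|p.2 - complex.Im z|.
  by rewrite /maxnorm /of_plane; case: (z).
apply; move: m0 m1; rewrite /maxnorm /of_plane; case: (z) => a b /= m0 m1.
by rewrite m0 m1.
Qed.

(** The one domination principle behind all local integrability below. The summand 1, integrable on
    compact sets, makes room for bounded terms such as v itself. *)
Lemma intK_dom (u : R[i] -> R) (C : R) K : compact K -> K `<=` Om ->
  rcont (Uf Om f) u -> (forall z, f z = 0 -> u z = 0) ->
  (forall z, Om z -> `|u z| <= C * (1 + Qf f z)) -> intK K u.
Proof.
move=> cK KO cu u0 uQ.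
have mu := measurable_zero_ext cu u0.
have [B B0 KB] := compact_bound_plane cK.
have i1 : intK K (fun=> 1).
  apply: (@intK_bounded _ _ _ 1 B).
  - apply: (@measurable_restrict_sub R setT); [exact: measurable_compact_plane|by []|].
    rewrite patch_setT; exact: measurable_cst.
  - by move=> z _; rewrite normr1.
  - by move=> z /KB h; split; apply: le_lt_trans h; [exact: ler_Re_absc|exact: ler_Im_absc].
have i2 := Qf_int cK KO.
have i3 := integrableZl measurableT C (integrableD measurableT i1 i2).
apply: le_integrable i3 => //.
  apply/measurable_EFinP; apply: measurable_restrict_sub mu => //.
  exact: measurable_compact_plane.
move=> p _ /=; rewrite lee_fin /patch.
case: ifPn => [|_]; last by rewrite addr0 mulr0.
rewrite inE => /KO/uQ h; apply: (le_trans h); exact: ler_norm.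
Qed.

End QIntegrability.

(** * Weak derivatives across the zeros *)

Section TestFunctions.
Context {R : realType}.
Implicit Types (z w : R[i]) (u phi : R[i] -> R) (K V : set R[i]).

(** [true] selects the direction x and [false] the direction y, so that integration by parts is
    carried out once for both. *)
Definition is_dd (b : bool) := if b then @is_dx R else @is_dy R.
Definition dd (b : bool) := if b then @dx R else @dy R.

Lemma is_dd_eq (b : bool) u z l : is_dd b u z l -> dd b u z = l.
Proof. by case: b => -[_ <-]; rewrite /dd /dx /dy derive1E. Qed.

Lemma is_ddM b u (w : R[i] -> R) z p q : is_dd b u z p -> is_dd b w z q ->
  is_dd b (fun x => u x * w x) z (p * w z + u z * q).
Proof. by case: b => h1 h2; [exact: is_dxM|exact: is_dyM]. Qed.

Lemma is_dd_near b u (w : R[i] -> R) z l : (exists2 d : R, 0 < d & forall x, absc (x - z) < d -> u x = w x) ->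
  is_dd b u z l -> is_dd b w z l.
Proof.
move=> [d d0 uw].
have E (g1 g2 : R -> R) : (forall t, `|t| < d -> g1 t = g2 t) ->
    is_derive (0 : R) (1 : R) g1 l -> is_derive (0 : R) (1 : R) g2 l.
  move=> g12; apply: near_eq_is_derive.
  apply/nbhs_ballP; exists d => // t; rewrite /ball /= sub0r normrN => td.
  exact: g12.
case: b; rewrite /is_dd /is_dx /is_dy; apply: E => t td; apply: uw;
  by rewrite addrC addKr ?absc_real ?absc_imag.
Qed.

Lemma is_dd_cst b (c : R) z : is_dd b (fun=> c) z 0.
Proof. by case: b; exact: is_derive_cst. Qed.

Lemma Ck_cont n phi : Ck n phi -> continuous phi.
Proof. by case: n => [|n] []. Qed.

Lemma Ck_dd n b phi : Ck n.+1 phi -> Ck n (dd b phi) /\ forall z, is_dd b phi z (dd b phi z).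
Proof.
move=> [_ [d cx cy]]; split; first by case: b.
move=> z; have [d1 d2] := d z; case: b; rewrite /is_dd /dd /dx /dy derive1E.
- exact: (derivableP d1).
- exact: (derivableP d2).
Qed.

Definition supp phi := closure [set z | phi z != 0].

Lemma test_CkS V phi : test_function V phi -> forall b n, Ck n (dd b phi).
Proof. by move=> [c _ _] b n; have [] := Ck_dd b (c n.+1). Qed.

Lemma supp_out phi z : ~ supp phi z -> exists2 d : R, 0 < d & forall w, absc (w - z) < d -> phi w = 0.
Proof.
move=> nz; have : (~` supp phi) z by [].
have oS : open (~` supp phi) by apply: closed_openC; exact: closed_closure.
move=> /(open_absc oS)[d d0 hd]; exists d => // w /hd nw.
apply: contrapT => /eqP pw; apply: nw; exact: subset_closure.
Qed.

Lemma phi_out phi z : ~ supp phi z -> phi z = 0.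
Proof. by move=> /supp_out[d d0]; apply; rewrite subrr absc0. Qed.

Lemma dd_out b phi z : ~ supp phi z -> dd b phi z = 0.
Proof.
move=> /supp_out[d d0 hd]; apply: is_dd_eq; apply: is_dd_near (is_dd_cst b 0 z).
by exists d => // w /hd ->.
Qed.

Lemma test_dd V phi b : test_function V phi -> test_function V (dd b phi).
Proof.
move=> tp; have [c cs sV] := tp.
have S : supp (dd b phi) `<=` supp phi.
  have cS : closed (supp phi) by exact: closed_closure.
  rewrite (iffLR (closure_id _) cS); apply: closure_subset => z /=; apply: contraPP => nz; rewrite (dd_out b nz).
  by rewrite eqxx.
split; first exact: (test_CkS tp b).
- by apply: (subclosed_compact _ cs S); exact: closed_closure.
- exact: (subset_trans S sV).
Qed.

Lemma supp_bound phi : compact (supp phi) ->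
  exists2 B : R, 0 < B & forall z, supp phi z -> in_box B z.
Proof.
move=> /compact_bound_plane[B B0 hB]; exists B => // z /hB h.
by split; apply: le_lt_trans h; [exact: ler_Re_absc|exact: ler_Im_absc].
Qed.

Lemma test_bounded V phi : test_function V phi -> exists2 M : R, 0 <= M &
  forall z, `|phi z| <= M.
Proof.
move=> [c cs sV]; have cp : forall z, supp phi z -> {for z, continuous phi}.
  by move=> z _; exact: (Ck_cont (c 0%N)).
have [M M0 hM] := continuous_bounded_compact cs cp.
exists M => // z; have [/hM//|nz] := pselect (supp phi z).
by rewrite phi_out// normr0.
Qed.

(** The positive part, in a form that inherits continuity and limits from the absolute value. *)
Definition pos (s : R) : R := (s + `|s|) / 2.

Lemma pos_ge0 s : 0 <= pos s.
Proof. by rewrite /pos; have := ler_norm (- s); rewrite normrN; lra. Qed.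

Lemma pos_id s : 0 <= s -> pos s = s.
Proof. by move=> s0; rewrite /pos ger0_norm//; field. Qed.

Lemma pos_0 s : s <= 0 -> pos s = 0.
Proof. by move=> s0; rewrite /pos ler0_norm// subrr mul0r. Qed.

(** The square smooths the corner: the first-order remainder of pos(s)^2 is at most t^2 at every s,
    as the four sign cases show. *)
Lemma pos_deriv (g : R -> R) (x a : R) : is_derive x (1 : R) g a ->
  is_derive x (1 : R) (fun t => pos (g t) ^+ 2) (2 * pos (g x) * a).
Proof.
move=> dg.
have k (s : R) : is_derive s (1 : R) (fun t => pos t ^+ 2) (2 * pos s).
  apply/is_derive_shift0; apply: is_derive0_eps => e e0; exists e => // t te.
  rewrite addr0.
  have h : `|pos (s + t) ^+ 2 - pos s ^+ 2 - 2 * pos s * t| <= `|t| ^+ 2.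
    rewrite real_normK ?num_real// ler_norml.
    have [s0|s0] := leP 0 s; have [st0|st0] := leP 0 (s + t).
    - by rewrite (pos_id s0) (pos_id st0); apply/andP; split; nra.
    - by rewrite (pos_id s0) (pos_0 (ltW st0)); apply/andP; split; nra.
    - by rewrite (pos_id st0) (pos_0 (ltW s0)); apply/andP; split; nra.
    - by rewrite (pos_0 (ltW s0)) (pos_0 (ltW st0)); apply/andP; split; nra.
  by apply: (le_trans h); rewrite expr2 ler_wpM2r// ltW.
by have := is_derive1_comp (k (g x)) dg.
Qed.

End TestFunctions.

Section WeakDerivative.
Context {R : realType}.
Variables (Om : set R[i]) (f : R[i] -> R[i]).
Hypothesis dOm : domain Om.
Hypothesis hf : hol Om f.
Hypothesis nc : ~ constant_on Om f.
Hypothesis fsmall : forall z, Om z -> absc (f z) < 1 / 10.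
Implicit Types (z w : R[i]).
Local Notation mR := (measurableTypeR R).
Local Notation area := (@area R).
Let oOm : open Om. Proof. by case: dOm. Qed.
Local Notation U := (Uf Om f).

Definition Lf z : R := ln (Sf f z).
Definition vd (b : bool) := if b then vx f else vy f.
(* On a zero Lf is a junk value, and so is theta; there the factor u, which
   vanishes, takes over. *)
Definition theta (e : R) z : R := pos (1 - e * Lf z) ^+ 2.
(** From L = 1/v one has grad L = - L^2 grad v; writing the gradient of the cutoff through [vd]
    makes it comparable with Q. *)
Definition theta' (b : bool) (e : R) z : R := 2 * pos (1 - e * Lf z) * (e * (vd b z * Lf z ^+ 2)).

Lemma theta_dd b e z : U z -> is_dd b (theta e) z (theta' b e z).
Proof.
move=> Uz; have S4 := Sf_gt4 fsmall Uz; have L1 := lnSf_gt1 fsmall Uz.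
have E (g : R -> R) (s : R) : g 0 = Sf f z -> is_derive (0 : R) (1 : R) g s ->
    is_derive (0 : R) (1 : R) (fun t => pos (1 - e * ln (g t)) ^+ 2)
      (2 * pos (1 - e * Lf z) * (- (e * (s / Sf f z)))).
  move=> g0 dg; have G0 : 0 < g 0 by rewrite g0; lra.
  have d1 := is_derive_ln1 G0 dg.
  have d2 := is_deriveM1 (is_derive_cst e (0:R) (1:R)) d1.
  have d3 := pos_deriv (is_deriveD1 (is_derive_cst (1:R) (0:R) (1:R)) (is_deriveN1 d2)).
  apply: is_derive_ext d3 => //.
  by rewrite /= g0 mul0r !add0r.
have S0 : Sf f z != 0 by rewrite gt_eqF//; lra.
have L0 : ln (Sf f z) != 0 by rewrite gt_eqF//; lra.
case: b; rewrite /is_dd.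
- have h := E _ _ (congr1 (Sf f) (addr0 z)) (Sf_dx hf Uz).
  apply: is_derive_ext h => //; rewrite /theta' /vd /vx /D1 /Lf.
  by field; rewrite S0 L0.
- have h := E _ _ (congr1 (Sf f) (addr0 z)) (Sf_dy hf Uz).
  apply: is_derive_ext h => //; rewrite /theta' /vd /vy /D1 /Lf.
  by field; rewrite S0 L0.
Qed.

Lemma rcont_pos A (u : R[i] -> R) : rcont A u -> rcont A (fun z => pos (u z)).
Proof.
move=> hu; have hn : rcont A (fun z => `|u z|).
  move=> z Az; apply/continuous_abscP => e e0.
  have [d d0 hd] := (continuous_abscP _ _).1 (hu z Az) e e0.
  by exists d => // w /hd; apply: le_lt_trans; exact: ler_dist_dist.
exact: (rcontM (rcontD hu hn) (@rcont_cst _ A 2^-1)).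
Qed.

Lemma vd_cont b : rcont U (vd b).
Proof. by case: b; [exact: vx_cont|exact: vy_cont]. Qed.

Lemma Lf_cont : rcont U Lf.
Proof. exact: lnSf_cont. Qed.

Lemma pos_theta_cont e : rcont U (fun z => pos (1 - e * Lf z)).
Proof.
apply: rcont_pos; apply: rcontD; first exact: rcont_cst.
by apply: rcontN; apply: rcontM; [exact: rcont_cst|exact: Lf_cont].
Qed.

Lemma theta_cont e : rcont U (theta e).
Proof. by apply: rcontX; exact: pos_theta_cont. Qed.

Lemma theta'_cont b e : rcont U (theta' b e).
Proof.
apply: rcontM.
  by apply: rcontM; [exact: rcont_cst|exact: pos_theta_cont].
apply: rcontM; first exact: rcont_cst.
by apply: rcontM; [exact: vd_cont|apply: rcontX; exact: Lf_cont].
Qed.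

(** L tends to infinity at a zero, so the cutoff vanishes close to it. Points with f z = 0 are left
    out because [Lf] has the default value 0 there. *)
Lemma Lf_large a (e : R) : Om a -> f a = 0 -> 0 < e -> exists2 d : R, 0 < d &
  forall z, absc (z - a) < d -> f z != 0 -> Om z /\ 1 - e * Lf z <= 0.
Proof.
(* |f| < k <= 1 implies |f|^2 <= k, hence S >= exp(1/e) and L >= 1/e. *)
move=> Oa fa e0; pose k := expR (- expR e^-1); have k0 : 0 < k by exact: expR_gt0.
have [d d0 hd] := (continuousC_abscP _ _).1 (hol_continuous hf Oa) _ k0.
have [d' d'0 hd'] := open_absc oOm Oa.
exists (Num.min d d'); first by rewrite lt_min d0.
move=> z; rewrite lt_min => /andP[/hd fk /hd' Oz] fz; split=> //.
rewrite fa subr0 in fk.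
have f0 : 0 < absc (f z) by rewrite absc_gt0.
have k1 : k <= 1 by rewrite /k expR_le1 oppr_le0 expR_ge0.
have S : expR e^-1 <= Sf f z.
  rewrite /Sf lerNr -[leRHS]expRK ler_ln ?posrE ?exprn_gt0// -/k.
  have f1 : absc (f z) <= 1 by lra.
  apply: (le_trans _ (ltW fk)); rewrite expr2; apply: ler_piMr => //; exact: ltW.
have L : e^-1 <= Lf z.
  have S0 : 0 < Sf f z by apply: lt_le_trans S; exact: expR_gt0.
  by rewrite /Lf -[leLHS]expRK ler_ln ?posrE ?expR_gt0.
have : e * e^-1 <= e * Lf z by rewrite ler_pM2l.
by rewrite mulfV ?gt_eqF//; lra.
Qed.

Lemma area_integral_supp V (u : R[i] -> R) : measurable (of_plane @^-1` V : set (mR * mR)) ->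
  (forall z, ~ V z -> u z = 0) ->
  area_integral V u = (\int[area]_p (u (of_plane p))%:E)%E.
Proof.
move=> mV u0; rewrite /area_integral integral_mkcond; apply: eq_integral => p _.
rewrite /patch; case: ifPn => //; rewrite notin_setE /= => nV.
by rewrite u0.
Qed.

Lemma integrable_test_mul (w psi : R[i] -> R) (C : R) : rcont U w -> (forall z, f z = 0 -> w z = 0) ->
  (forall z, Om z -> `|w z| <= C * (1 + Qf f z)) -> test_function Om psi ->
  area.-integrable setT (EFin \o ((fun z => w z * psi z) \o of_plane)).
Proof.
move=> cw w0 wB tp; have [c cs sO] := tp; have [M M0 hM] := test_bounded tp.
have iw := intK_dom dOm hf nc fsmall cs sO cw w0 wB.
have i1 := integrableZl measurableT M iw.
have mw : measurable_fun setT (((fun z => w z * psi z) \_ Om) \o of_plane : mR * mR -> R).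
  apply: (measurable_zero_ext dOm hf) => [|z fz]; last by rewrite w0// mul0r.
  by apply: rcontM => // z _; exact: (Ck_cont (c 0%N)).
have E : (fun z => w z * psi z) \_ Om = (fun z => w z * psi z).
  apply/funext => z; rewrite /patch; case: ifPn => //; rewrite notin_setE => nO.
  have nK : ~ supp psi z by move=> /sO.
  by rewrite (phi_out nK) mulr0.
rewrite E in mw; apply: le_integrable i1 => //; first exact/measurable_EFinP.
move=> p _ /=; rewrite lee_fin /patch; case: ifPn => Kp.
  by rewrite !normrM mulrC [`|M|]ger0_norm// ler_wpM2r.
have nK : ~ supp psi (of_plane p) by move: Kp; rewrite notin_setE.
by rewrite (phi_out nK) !mulr0 !normr0.
Qed.

Variables (b : bool) (u u' : R[i] -> R) (C : R).
Hypothesis C0 : 0 <= C.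
Hypothesis cu : rcont U u.
Hypothesis cu' : rcont U u'.
Hypothesis u0 : forall z, f z = 0 -> u z = 0.
Hypothesis u'0 : forall z, f z = 0 -> u' z = 0.
Hypothesis du : forall z, U z -> is_dd b u z (u' z).
Hypothesis uB : forall z, Om z -> `|u z| <= C * (1 + Qf f z).
Hypothesis u'B : forall z, Om z -> `|u' z| <= C * (1 + Qf f z).
(** This pays for the gradient of the cutoff: |u theta'| equals 2 |u vd| L times pos(1 - e L) e L,
    and the last product is at most 1. *)
Hypothesis uvB : forall z, U z -> `|u z * vd b z| * Lf z <= C * (1 + Qf f z).
Variables (phi : R[i] -> R) (tphi : test_function Om phi).

Let K := supp phi.
Let Pn (e : R) z := u z * (phi z * theta e z).
Let Pn' (e : R) z := u' z * (phi z * theta e z) + u z * (dd b phi z * theta e z + phi z * theta' b e z).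

Let phid z : is_dd b phi z (dd b phi z).
Proof. by have [c _ _] := tphi; have [] := Ck_dd b (c 1%N). Qed.

Let cphi : continuous phi.
Proof. by have [c _ _] := tphi; exact: Ck_cont (c 0%N). Qed.

Let cdphi : continuous (dd b phi).
Proof. by have [c _ _] := test_dd b tphi; exact: Ck_cont (c 0%N). Qed.

(** Off U, a point is either outside Om, where phi vanishes nearby, or a zero of f, where the cutoff
    vanishes nearby except on zeros, at which u and u' vanish. Hence u phi theta has a continuous
    derivative in direction b on the whole plane. *)
Lemma locally_zero (e : R) z : 0 < e -> ~ U z ->
  exists2 d : R, 0 < d & forall w, absc (w - z) < d -> Pn e w = 0 /\ Pn' e w = 0.
Proof.
move=> e0 nU; have [Oz|nO] := pselect (Om z); last first.
  have [_ _ sO] := tphi.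
  have nK : ~ supp phi z by move=> /sO.
  have oS : open (~` supp phi) by apply: closed_openC; exact: closed_closure.
  have [d d0 hd] := open_absc oS nK; exists d => // w /hd nw.
  by rewrite /Pn /Pn' (phi_out nw) (dd_out b nw) !mul0r !mulr0 addr0 mulr0 addr0.
have fz : f z = 0 by apply: contrapT => /eqP fz; exact: nU.
have [d d0 hd] := Lf_large Oz fz e0; exists d => // w wd.
have [fw|fw] := eqVneq (f w) 0.
  by rewrite /Pn /Pn' u0// u'0// !mul0r addr0.
have [_ L] := hd w wd fw.
by rewrite /Pn /Pn' /theta /theta' pos_0// expr0n /= !(mulr0, mul0r, addr0).
Qed.

Lemma Pn_deriv (e : R) z : 0 < e -> is_dd b (Pn e) z (Pn' e z).
Proof.
move=> e0; have [Uz|nU] := pselect (U z).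
  by have := is_ddM (du Uz) (is_ddM (phid z) (theta_dd b e Uz)).
have [d d0 hd] := locally_zero e0 nU.
have -> : Pn' e z = 0 by have [] := hd z; rewrite ?subrr ?absc0.
apply: is_dd_near (is_dd_cst b 0 z).
by exists d => // w /hd[->].
Qed.

Lemma Pn'_cont (e : R) : 0 < e -> continuous (Pn' e).
Proof.
move=> e0 z; have [Uz|nU] := pselect (U z).
  have rphi : rcont U phi by move=> x _; exact: cphi.
  have rdphi : rcont U (dd b phi) by move=> x _; exact: cdphi.
  have h := rcontD (rcontM cu' (rcontM rphi (@theta_cont e)))
    (rcontM cu (rcontD (rcontM rdphi (@theta_cont e)) (rcontM rphi (@theta'_cont b e)))).
  exact: h z Uz.
have [d d0 hd] := locally_zero e0 nU.
apply/continuous_abscP => k k0; exists d => // w wd.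
have [_ ->] := hd w wd; have [_ ->] := hd z (ltac:(by rewrite subrr absc0)).
by rewrite subrr normr0.
Qed.

Lemma Pn'_integral (e : R) : 0 < e -> (\int[area]_p (Pn' e (of_plane p))%:E = 0)%E.
Proof.
move=> e0; have [c cs sO] := tphi; have [B B0 hB] := supp_bound cs.
have out z : ~ in_box B z -> Pn e z = 0 /\ Pn' e z = 0.
  move=> nb; have nK : ~ supp phi z by move=> /hB.
  by rewrite /Pn /Pn' (phi_out nK) (dd_out b nK) !(mul0r, mulr0, addr0).
have := Pn_deriv; have := Pn'_cont e0.
case: (b) => cP dP.
- exact: (integral_dx0 B0 (fun z => dP e z e0) cP out).
- exact: (integral_dy0 B0 (fun z => dP e z e0) cP out).
Qed.

Let F z := u' z * phi z + u z * dd b phi z.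

(** The bound must be uniform in e for dominated convergence. The constant is 4 = 1 + 1 + 2, one
    term for each factor that is differentiated, with the 2 coming from the squared cutoff. *)
Let Pn'_bound (M e : R) z : 0 < e -> 0 <= M -> (forall x, `|phi x| <= M) -> (forall x, `|dd b phi x| <= M) ->
  U z -> `|Pn' e z| <= 4 * M * C * (1 + Qf f z).
Proof.
move=> e0 M0 pM dM Uz; have L1 := lnSf_gt1 fsmall Uz.
have Oz : Om z by case: Uz.
set Q := C * (1 + Qf f z).
have p0 := pos_ge0 (1 - e * Lf z).
have eL : 0 < e * Lf z by rewrite mulr_gt0// /Lf; lra.
have p1 : pos (1 - e * Lf z) <= 1.
  have [k|k] := leP 0 (1 - e * Lf z); first by rewrite pos_id//; lra.
  by rewrite pos_0// ltW.
have t0 : 0 <= theta e z by exact: sqr_ge0.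
have t1 : theta e z <= 1 by exact: exprn_ile1.
(* With t = e L this is (1 - t) t <= 1 for t <= 1, and 0 beyond: the large factor L is harmless on
   the support of the cutoff. *)
have pe : pos (1 - e * Lf z) * (e * Lf z) <= 1.
  have [k|k] := leP 0 (1 - e * Lf z); last by rewrite pos_0 ?mul0r// ltW.
  by rewrite pos_id//; nra.
have k1 : `|u' z * (phi z * theta e z)| <= Q * M.
  rewrite normrM (normrM (phi z)); apply: ler_pM; [exact: normr_ge0|by rewrite mulr_ge0|exact: u'B|].
  by rewrite (ger0_norm t0) -[leRHS]mulr1; apply: ler_pM.
have k2 : `|u z * (dd b phi z * theta e z)| <= Q * M.
  rewrite normrM (normrM (dd b phi z)); apply: ler_pM; [exact: normr_ge0|by rewrite mulr_ge0|exact: uB|].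
  by rewrite (ger0_norm t0) -[leRHS]mulr1; apply: ler_pM.
have k3 : `|u z * (phi z * theta' b e z)| <= 2 * Q * M.
  have -> : u z * (phi z * theta' b e z) =
    2 * ((u z * vd b z) * Lf z * (pos (1 - e * Lf z) * (e * Lf z))) * phi z.
    by rewrite /theta'; ring.
  rewrite normrM; apply: ler_pM => //.
  rewrite normrM (ger0_norm (_ : 0 <= 2))// ler_pM2l//.
  rewrite normrM -[leRHS]mulr1; apply: ler_pM => //.
    rewrite normrM (ger0_norm (_ : 0 <= Lf z)); last by rewrite /Lf; lra.
    exact: uvB.
  by rewrite ger0_norm// mulr_ge0// ltW.
have -> : Pn' e z = u' z * (phi z * theta e z) + (u z * (dd b phi z * theta e z) + u z * (phi z * theta' b e z)).
  by rewrite /Pn'; ring.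
apply: (le_trans (ler_normD _ _)); apply: (le_trans (lerD k1 (ler_normD _ _))).
apply: (le_trans (lerD (lexx _) (lerD k2 k3))).
by rewrite le_eqVlt; apply/orP; left; apply/eqP; rewrite /Q; ring.
Qed.

Let Pn'_out (e : R) z : ~ (U z /\ K z) -> Pn' e z = 0.
Proof.
move=> h; have [_ _ sO] := tphi.
have [Kz|nK] := pselect (K z); last first.
  by rewrite /Pn' (phi_out nK) (dd_out b nK) !(mul0r, mulr0, addr0).
have fz : f z = 0.
  by apply: contrapT => /eqP fz; apply: h; split=> //; split=> //; exact: sO.
by rewrite /Pn' u0// u'0// !mul0r addr0.
Qed.

Let Pn'_cvg z : Pn' n.+1%:R^-1 z @[n --> \oo] --> F z.
Proof.
have e0 : (n.+1%:R^-1 : R) @[n --> \oo] --> (0 : R) by exact: cvg_harmonic.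
have c1 : (1 - n.+1%:R^-1 * Lf z) @[n --> \oo] --> (1 : R).
  rewrite -[X in _ --> X]subr0 -[X in _ --> _ - X](mul0r (Lf z)).
  by apply: cvgB; [exact: cvg_cst|apply: cvgM => //; exact: cvg_cst].
have c2 : pos (1 - n.+1%:R^-1 * Lf z) @[n --> \oo] --> (1 : R).
  suff : pos (1 - n.+1%:R^-1 * Lf z) @[n --> \oo] --> pos (1 : R) by rewrite (pos_id ler01).
  exact: (cvgM (cvgD c1 (cvg_norm c1)) (cvg_cst _)).
have c3 : theta n.+1%:R^-1 z @[n --> \oo] --> (1 : R).
  have h := cvgM c2 c2; rewrite mulr1 in h; exact: h.
have c4 : theta' b n.+1%:R^-1 z @[n --> \oo] --> (0 : R).
  have h := cvgM (cvgM (@cvg_cst R 2 nat \oo _) c2) (cvgM e0 (@cvg_cst R (vd b z * Lf z ^+ 2) nat \oo _)).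
  by rewrite mul0r mulr0 in h; exact: h.
have -> : F z = u' z * (phi z * 1) + u z * (dd b phi z * 1 + phi z * 0).
  by rewrite /F !mulr1 mulr0 addr0.
exact: (cvgD (cvgM (cvg_cst _) (cvgM (cvg_cst _) c3))
  (cvgM (cvg_cst _) (cvgD (cvgM (cvg_cst _) c3) (cvgM (cvg_cst _) c4)))).
Qed.

(** Each product with the cutoff is a compactly supported function whose derivative integrates to 0;
    along e = 1/(n + 1) the cutoff tends to 1 and its gradient to 0 pointwise, and the uniform
    majorant allows the limit. *)
Lemma integral_weak0 : (\int[area]_p (F (of_plane p))%:E = 0)%E.
Proof.
have [c cs sO] := tphi.
have [M1 M10 hM1] := test_bounded tphi.
have [M2 M20 hM2] := test_bounded (test_dd b tphi).
pose M := M1 + M2.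
have M0 : 0 <= M by rewrite addr_ge0.
have pM x : `|phi x| <= M by have := hM1 x; rewrite /M; lra.
have dM x : `|dd b phi x| <= M by have := hM2 x; rewrite /M; lra.
(* The majorant 1 + Q is set to 0 on the zeros, where [Pn'] vanishes too, because [intK_dom] applies
   to functions vanishing there. *)
pose G z := if f z == 0 then 0 else 1 + Qf f z.
have GC : rcont U G.
  move=> z Uz; have [d d0 hd] := open_absc (Uf_open oOm hf) Uz.
  have := @rcontD _ U _ _ (@rcont_cst _ U 1) (@Qf_cont _ _ _ dOm hf fsmall).
  move=> /(_ z Uz)/continuous_abscP h; apply/continuous_abscP => e e0.
  have [d' d'0 hd'] := h e e0; exists (Num.min d d'); first by rewrite lt_min d0.
  move=> w; rewrite lt_min => /andP[/hd[_ fw] /hd']; rewrite /G (negbTE fw).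
  by case: Uz => _ /negbTE ->.
have G0 z : f z = 0 -> G z = 0 by move=> fz; rewrite /G fz eqxx.
have GB z : Om z -> `|G z| <= 1 * (1 + Qf f z).
  move=> Oz; have Q0 := Qf_ge0 fsmall Oz; rewrite mul1r /G; case: ifP => _.
    by rewrite normr0; lra.
  by rewrite ger0_norm//; lra.
have iG := intK_dom dOm hf nc fsmall cs sO GC G0 GB.
have iH := integrableZl measurableT (4 * M * C) iG.
have FE : F \_ Om = F.
  apply/funext => z; rewrite /patch; case: ifPn => //; rewrite notin_setE => nO.
  have nK : ~ supp phi z by move=> /sO.
  by rewrite /F (phi_out nK) (dd_out b nK) !mulr0 addr0.
have mF : measurable_fun setT (F \o of_plane : mR * mR -> R).
  rewrite -FE; apply: (measurable_zero_ext dOm hf) => [|z fz]; last first.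
    by rewrite /F u0// u'0// !mul0r addr0.
  by apply: rcontD; apply: rcontM => // z _; [exact: cphi|exact: cdphi].
have e0 n : 0 < (n.+1%:R^-1 : R) by rewrite invr_gt0 ltr0n.
have [] := @dominated_convergence _ _ R area setT measurableT
  (fun n p => (Pn' n.+1%:R^-1 (of_plane p))%:E) (fun p => (F (of_plane p))%:E)
  (fun p => ((4 * M * C)%:E * (EFin \o ((G \_ K) \o of_plane)) p)%E).
- move=> n; apply/measurable_EFinP; apply: continuous_measurable.
  exact: Pn'_cont.
- exact/measurable_EFinP.
- apply: aeW => p _; apply: cvg_EFin; [exact: nearW|exact: Pn'_cvg].
- exact: iH.
- apply: aeW => p n _; rewrite /= lee_fin /patch.
  have [[Uz Kz]|h] := pselect (U (of_plane p) /\ K (of_plane p)).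
    rewrite mem_set// /G; case: (Uz) => _ /negbTE ->.
    exact: Pn'_bound.
  rewrite Pn'_out// normr0 !mulr_ge0//; case: ifPn => //.
  rewrite inE => /sO Oz; rewrite /G; case: ifP => //.
  by have := Qf_ge0 fsmall Oz; lra.
move=> _ _; set s := (X in X @ _ --> _).
have -> : s = cst 0%E by apply/funext => n; exact: (Pn'_integral (e0 n)).
by move=> h; have := cvg_unique _ h (cvg_cst _); apply.
Qed.

Lemma weak_derivative : area_integral Om (fun z => u z * dd b phi z) =
  (- area_integral Om (fun z => (u' z * phi z)%R))%E.
Proof.
have [c cs sO] := tphi; have := integral_weak0.
have i1 := integrable_test_mul cu u0 uB (test_dd b tphi).
have i2 := integrable_test_mul cu' u'0 u'B tphi.
have mO : measurable (of_plane @^-1` Om : set (mR * mR)) by exact: measurable_open.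
have out z : ~ Om z -> ~ supp phi z by move=> nO /sO.
rewrite area_integral_supp//; last by move=> z /out nK; rewrite (dd_out b nK) mulr0.
rewrite area_integral_supp//; last by move=> z /out nK; rewrite (phi_out nK) mulr0.
rewrite /F; under eq_integral do rewrite EFinD.
rewrite (integralD measurableT i2 i1).
have f1 := integrable_fin_num measurableT i1; have f2 := integrable_fin_num measurableT i2.
set A := (\int[_]_(_ in _) _)%E in f2 *; set B := (\int[_]_(_ in _) _)%E in f1 *.
move: A B f1 f2 => [a||] [b'||]//= _ _ [ab]; congr (_%:E); lra.
Qed.

End WeakDerivative.

(** * Domination of v and its derivatives by Q *)

Section Bounds.
Context {R : realType}.
Variables (Om : set R[i]) (f : R[i] -> R[i]).
Hypothesis dOm : domain Om.
Hypothesis hf : hol Om f.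
Hypothesis nc : ~ constant_on Om f.
Hypothesis fsmall : forall z, Om z -> absc (f z) < 1 / 10.
Implicit Types (z w : R[i]).
Local Notation mR := (measurableTypeR R).
Local Notation area := (@area R).
Let oOm : open Om. Proof. by case: dOm. Qed.
Local Notation U := (Uf Om f).

(** D2 = D1 (L + 2)/(S L), with S > 4 and L > 1. The last bound, D1 L = 1/(S L) <= 1, absorbs the
    factor L that the cutoff costs. *)
Lemma D_facts z : U z -> [/\ 0 < D1 f z, D1 f z <= 1, 0 <= D2 f z, D2 f z <= D1 f z &
   D1 f z * Lf f z <= 1].
Proof.
move=> Uz; have S4 := Sf_gt4 fsmall Uz; have L1 := lnSf_gt1 fsmall Uz.
rewrite /Lf; set S := Sf f z in S4 L1 *; set L := ln S in L1 *.
have S0 : S != 0 by rewrite gt_eqF//; lra.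
have L0 : L != 0 by rewrite gt_eqF//; lra.
have E1 : D1 f z = (S * L ^+ 2)^-1 by [].
have E2 : D2 f z = (S * L ^+ 2)^-1 * ((L + 2) / (S * L)).
  by rewrite /D2 -/S -/L; field; rewrite S0 L0.
have P : 1 <= S * L ^+ 2 by nra.
have A0 : 0 < (S * L ^+ 2)^-1 by rewrite invr_gt0; lra.
have SL : 0 < S * L by rewrite mulr_gt0//; lra.
have B1 : (L + 2) / (S * L) <= 1 by rewrite ler_pdivrMr// mul1r; nra.
have B0 : 0 <= (L + 2) / (S * L) by rewrite divr_ge0 ?(ltW SL)//; lra.
rewrite E2 E1; split => //.
- by rewrite invf_le1//; lra.
- by rewrite mulr_ge0// ltW.
- by rewrite ler_piMr// ltW.
- have -> : (S * L ^+ 2)^-1 * L = (S * L)^-1 by field; rewrite S0 L0.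
  by rewrite invf_le1//; nra.
Qed.

Lemma q_facts z : [/\ `|complex.Re (qf f z)| <= absc (qf f z), `|complex.Im (qf f z)| <= absc (qf f z),
  `|complex.Re (qf1 f z)| <= absc (qf1 f z) & `|complex.Im (qf1 f z)| <= absc (qf1 f z)].
Proof. by split; rewrite ?ler_Re_absc ?ler_Im_absc. Qed.

Lemma sq_le (x a : R) : `|x| <= a -> x ^+ 2 <= a ^+ 2.
Proof. by move=> h; rewrite -(real_normK (num_real x)) lerXn2r// nnegrE (le_trans _ h). Qed.

Lemma prod_le (x y a : R) : `|x| <= a -> `|y| <= a -> `|x * y| <= a ^+ 2.
Proof. by move=> h1 h2; rewrite normrM expr2; apply: ler_pM. Qed.

Lemma D1q_le z : U z -> D1 f z * absc (qf f z) ^+ 2 <= Qf f z /\ D1 f z * absc (qf1 f z) <= Qf f z.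
Proof.
move=> /D_facts[A0 _ _ _ _]; rewrite /Qf mulrDr.
have h1 : 0 <= D1 f z * absc (qf f z) ^+ 2 by rewrite mulr_ge0 ?sqr_ge0// ltW.
have h2 : 0 <= D1 f z * absc (qf1 f z) by rewrite mulr_ge0 ?absc_ge0// ltW.
by split; lra.
Qed.

(** The common shape of the three second derivatives, used with c = 4; the resulting 6 Q is rounded
    up to the constant 8 shared by all bounds. *)
Lemma term_bound (A D c X a q r Q : R) : 0 < A -> 0 <= D -> D <= A -> 0 <= c -> `|X| <= c * a ^+ 2 ->
  `|r| <= q -> A * a ^+ 2 <= Q -> A * q <= Q -> `|D * X + A * (2 * r)| <= (c + 2) * Q.
Proof.
move=> A0 D0 DA c0 Xa rq AQ Aq; apply: (le_trans (ler_normD _ _)).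
have -> : (c + 2) * Q = c * Q + 2 * Q by ring.
apply: lerD.
  rewrite normrM (ger0_norm D0); apply: (@le_trans _ _ (A * (c * a ^+ 2))); first exact: ler_pM.
  by rewrite mulrCA ler_wpM2l.
rewrite normrM (gtr0_norm A0) normrM (ger0_norm (_ : 0 <= 2))//.
by rewrite mulrCA ler_wpM2l//; apply: le_trans Aq; rewrite ler_pM2l.
Qed.

Lemma vxx_le z : U z -> `|vxx f z| <= 8 * (1 + Qf f z).
Proof.
move=> Uz; have [A0 A1 D0 DA AL] := D_facts Uz; have [x1 x2 x3 x4] := q_facts z.
have [Q1 Q2] := D1q_le Uz; have Q0 : 0 <= Qf f z by apply: (Qf_ge0 fsmall); case: Uz.
apply: (@le_trans _ _ ((4 + 2) * Qf f z)); last lra.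
apply: term_bound Q1 Q2 => //.
rewrite ger0_norm ?sqr_ge0// exprMn; have := sq_le x1; lra.
Qed.

Lemma vyy_le z : U z -> `|vyy f z| <= 8 * (1 + Qf f z).
Proof.
move=> Uz; have [A0 A1 D0 DA AL] := D_facts Uz; have [x1 x2 x3 x4] := q_facts z.
have [Q1 Q2] := D1q_le Uz; have Q0 : 0 <= Qf f z by apply: (Qf_ge0 fsmall); case: Uz.
have -> : vyy f z = D2 f z * (2 * complex.Im (qf f z)) ^+ 2 + D1 f z * (2 * - complex.Re (qf1 f z)).
  by rewrite /vyy; ring.
apply: (@le_trans _ _ ((4 + 2) * Qf f z)); last lra.
apply: term_bound Q1 Q2; rewrite ?normrN//.
rewrite ger0_norm ?sqr_ge0// exprMn; have := sq_le x2; lra.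
Qed.

Lemma vxy_le z : U z -> `|vxy f z| <= 8 * (1 + Qf f z).
Proof.
move=> Uz; have [A0 A1 D0 DA AL] := D_facts Uz; have [x1 x2 x3 x4] := q_facts z.
have [Q1 Q2] := D1q_le Uz; have Q0 : 0 <= Qf f z by apply: (Qf_ge0 fsmall); case: Uz.
rewrite /vxy normrN; apply: (@le_trans _ _ ((4 + 2) * Qf f z)); last lra.
apply: term_bound Q1 Q2 => //.
rewrite normrM (ger0_norm (_ : 0 <= 4))// ler_pM2l//; exact: prod_le.
Qed.

Lemma vd_abs b z : U z -> `|vd f b z| <= 2 * D1 f z * absc (qf f z).
Proof.
move=> Uz; have [A0 A1 D0 DA AL] := D_facts Uz; have [x1 x2 x3 x4] := q_facts z.
case: b; rewrite /vd /vx /vy ?normrN normrM (gtr0_norm A0) normrM (ger0_norm (_ : 0 <= 2))//.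
  by rewrite mulrA [D1 _ _ * 2]mulrC ler_pM2l// mulr_gt0.
by rewrite mulrA [D1 _ _ * 2]mulrC ler_pM2l// mulr_gt0.
Qed.

Lemma vd_le b z : U z -> `|vd f b z| <= 8 * (1 + Qf f z).
Proof.
move=> Uz; have [A0 A1 D0 DA AL] := D_facts Uz; have [Q1 Q2] := D1q_le Uz.
apply: (le_trans (vd_abs b Uz)).
have := absc_ge0 (qf f z); move: (absc (qf f z)) (D1 f z) A0 A1 Q1 => a A A0 A1 Q1 a0.
(* This gives 2 A a <= A a^2 + A <= Q + 1: a first derivative is linear in |q|, Q is quadratic. *)
have : 0 <= A * (a - 1) ^+ 2 by rewrite mulr_ge0 ?sqr_ge0// ltW.
nra.
Qed.

(** The product is at most 4 (D1 |q|^2)(D1 L) <= 4 Q. It serves twice: as the cutoff condition when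
    u is a first derivative and, because L > 1, as the square integrability of the gradient. *)
Lemma vd_sq_le b b' z : U z -> `|vd f b z * vd f b' z| * Lf f z <= 8 * (1 + Qf f z).
Proof.
move=> Uz; have [A0 A1 D0 DA AL] := D_facts Uz; have [Q1 Q2] := D1q_le Uz.
have Q0 : 0 <= Qf f z by apply: (Qf_ge0 fsmall); case: Uz.
have L1 := lnSf_gt1 fsmall Uz.
have a0 := absc_ge0 (qf f z).
rewrite normrM; apply: (@le_trans _ _ ((2 * D1 f z * absc (qf f z)) * (2 * D1 f z * absc (qf f z)) * Lf f z)).
  apply: ler_wpM2r; first by rewrite /Lf; lra.
  by apply: ler_pM => //; exact: vd_abs.
have -> : 2 * D1 f z * absc (qf f z) * (2 * D1 f z * absc (qf f z)) * Lf f z =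
  4 * ((D1 f z * absc (qf f z) ^+ 2) * (D1 f z * Lf f z)) by ring.
have h : (D1 f z * absc (qf f z) ^+ 2) * (D1 f z * Lf f z) <= Qf f z.
  apply: le_trans Q1; apply: ler_piMr => //.
  by rewrite mulr_ge0 ?sqr_ge0// ltW.
lra.
Qed.

Lemma v_bound z : Om z -> 0 <= vfun f z <= 1.
Proof.
move=> Oz; have [fz|fz] := eqVneq (f z) 0.
  by have [-> _ _ _] := zero_v fz; rewrite lexx ler01.
have L1 := lnSf_gt1 fsmall (conj Oz fz : U z).
rewrite vfunE; apply/andP; split; first by rewrite invr_ge0; lra.
by rewrite invf_le1; lra.
Qed.

(** Here v L = 1, so the factor L disappears at once. *)
Lemma v_vd_le b z : U z -> `|vfun f z * vd f b z| * Lf f z <= 8 * (1 + Qf f z).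
Proof.
move=> Uz; have L1 := lnSf_gt1 fsmall Uz.
rewrite vfunE normrM ger0_norm ?invr_ge0; last lra.
rewrite mulrAC mulVf ?mul1r; first exact: vd_le.
by rewrite gt_eqF//; lra.
Qed.

Lemma ext_le (u : R[i] -> R) : (forall z, f z = 0 -> u z = 0) ->
  (forall z, U z -> `|u z| <= 8 * (1 + Qf f z)) -> forall z, Om z -> `|u z| <= 8 * (1 + Qf f z).
Proof.
move=> u0 uU z Oz; have [fz|fz] := eqVneq (f z) 0; last exact: uU.
by rewrite u0// normr0 Qf_zero// addr0 mulr1.
Qed.

Lemma v_le z : Om z -> `|vfun f z| <= 8 * (1 + Qf f z).
Proof.
move=> Oz; have /andP[v0 v1] := v_bound Oz; have := Qf_ge0 fsmall Oz.
by rewrite ger0_norm//; lra.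
Qed.

End Bounds.

(** * Continuity, boundedness and Sobolev regularity of v *)

Section Positive.
Context {R : realType}.
Variables (Om : set R[i]) (f : R[i] -> R[i]).
Hypothesis dOm : domain Om.
Hypothesis hf : hol Om f.
Hypothesis nc : ~ constant_on Om f.
Hypothesis fsmall : forall z, Om z -> absc (f z) < 1 / 10.
Implicit Types (z w : R[i]).
Local Notation mR := (measurableTypeR R).
Local Notation area := (@area R).
Let oOm : open Om. Proof. by case: dOm. Qed.
Local Notation U := (Uf Om f).

Definition dominated (u : R[i] -> R) := [/\ rcont U u, forall z, f z = 0 -> u z = 0 &
  forall z, Om z -> `|u z| <= 8 * (1 + Qf f z)].

Lemma dominated_v : dominated (vfun f).
Proof.
split; [exact: (v_cont hf fsmall)|by move=> z /zero_v[]|exact: (v_le fsmall)].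
Qed.

Lemma dominated_vd b : dominated (vd f b).
Proof.
have z0 z : f z = 0 -> vd f b z = 0 by case: b => /zero_v[].
split=> //; first exact: (@vd_cont _ _ _ dOm hf fsmall b).
apply: ext_le z0 _ => z Uz; exact: (vd_le fsmall b Uz).
Qed.

Lemma dominated_vxx : dominated (vxx f).
Proof.
have z0 z : f z = 0 -> vxx f z = 0 by case/zero_v => _ _ _ [].
split=> //; first exact: (vxx_cont oOm hf fsmall).
by apply: ext_le z0 _ => z Uz; exact: (vxx_le fsmall Uz).
Qed.

Lemma dominated_vxy : dominated (vxy f).
Proof.
have z0 z : f z = 0 -> vxy f z = 0 by case/zero_v => _ _ _ [].
split=> //; first exact: (vxy_cont oOm hf fsmall).
by apply: ext_le z0 _ => z Uz; exact: (vxy_le fsmall Uz).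
Qed.

Lemma dominated_vyy : dominated (vyy f).
Proof.
have z0 z : f z = 0 -> vyy f z = 0 by case/zero_v => _ _ _ [].
split=> //; first exact: (vyy_cont oOm hf fsmall).
by apply: ext_le z0 _ => z Uz; exact: (vyy_le fsmall Uz).
Qed.

Lemma dominated_Lp1 u : dominated u -> Lp_loc 1%:E Om u.
Proof.
move=> [cu u0 uB] K cK KO; apply/Lfun1_integrable.
exact: (intK_dom dOm hf nc fsmall cK KO cu u0 uB).
Qed.

Lemma v_dd b z : U z -> is_dd b (vfun f) z (vd f b z).
Proof. by case: b => Uz; [exact: (v_dx hf fsmall Uz)|exact: (v_dy hf fsmall Uz)]. Qed.

Lemma weak_v b phi : test_function Om phi ->
  area_integral Om (fun z => vfun f z * dd b phi z) =
  (- area_integral Om (fun z => (vd f b z * phi z)%R))%E.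
Proof.
move=> tp; have [c1 z1 b1] := dominated_v; have [c2 z2 b2] := dominated_vd b.
apply: (weak_derivative dOm hf nc fsmall (C := 8)) => //.
- exact: v_dd.
- by move=> z Uz; exact: (v_vd_le fsmall b Uz).
Qed.

Lemma weak_vd b b' (w : R[i] -> R) phi : dominated w ->
  (forall z, U z -> is_dd b (vd f b') z (w z)) -> test_function Om phi ->
  area_integral Om (fun z => vd f b' z * dd b phi z) =
  (- area_integral Om (fun z => (w z * phi z)%R))%E.
Proof.
move=> [c2 z2 b2] dw tp; have [c1 z1 b1] := dominated_vd b'.
apply: (weak_derivative dOm hf nc fsmall (C := 8)) => //.
by move=> z Uz; exact: (vd_sq_le fsmall b' b Uz).
Qed.

(** Integration by parts twice, first with [dd b' phi] as the test function and then with phi, so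
    that the signs cancel; for the mixed derivative it is v_x that is differentiated in y. *)
Lemma weak_v2 b b' (w : R[i] -> R) phi : dominated w ->
  (forall z, U z -> is_dd b' (vd f b) z (w z)) -> test_function Om phi ->
  area_integral Om (fun z => vfun f z * dd b (dd b' phi) z) =
  area_integral Om (fun z => w z * phi z).
Proof.
move=> dw hw tp; rewrite (weak_v b (test_dd b' tp)) (weak_vd dw hw tp).
by rewrite oppeK.
Qed.

Lemma weak_vxx phi : test_function Om phi ->
  area_integral Om (fun z => vfun f z * dx (dx phi) z) = area_integral Om (fun z => vxx f z * phi z).
Proof. exact: (weak_v2 (b := true) (b' := true) dominated_vxx (vx_dx oOm hf fsmall)). Qed.

Lemma weak_vxy phi : test_function Om phi ->
  area_integral Om (fun z => vfun f z * dx (dy phi) z) = area_integral Om (fun z => vxy f z * phi z).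
Proof. exact: (weak_v2 (b := true) (b' := false) dominated_vxy (vx_dy oOm hf fsmall)). Qed.

Lemma weak_vyy phi : test_function Om phi ->
  area_integral Om (fun z => vfun f z * dy (dy phi) z) = area_integral Om (fun z => vyy f z * phi z).
Proof. exact: (weak_v2 (b := false) (b' := false) dominated_vyy (vy_dy oOm hf fsmall)). Qed.

(** Within i + j <= 2 the default branch is reached only by (0, 2). *)
Definition wpart (i j : nat) : R[i] -> R :=
  match i, j with
  | 0%N, 0%N => vfun f | 1%N, 0%N => vd f true | 0%N, 1%N => vd f false
  | 2%N, 0%N => vxx f | 1%N, 1%N => vxy f | _, _ => vyy f end.

Lemma weak_partial_v i j : (i + j <= 2)%N -> weak_partial Om i j (vfun f) (wpart i j).
Proof.
move=> ij; split.
- exact: (dominated_Lp1 dominated_v).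
- apply: dominated_Lp1; case: i j ij => [|[|[|i]]] [|[|[|j]]]//= _.
  + exact: dominated_v.
  + exact: (dominated_vd false).
  + exact: dominated_vyy.
  + exact: (dominated_vd true).
  + exact: dominated_vxy.
  + exact: dominated_vxx.
- move=> phi tp; case: i j ij => [|[|[|i]]] [|[|[|j]]]//= _; rewrite /partial /=.
  + by rewrite expr0 mul1e.
  + by rewrite expr1 EFinN mulN1e; exact: (weak_v false tp).
  + by rewrite sqrrN expr1n mul1e; exact: weak_vyy.
  + by rewrite expr1 EFinN mulN1e; exact: (weak_v true tp).
  + by rewrite sqrrN expr1n mul1e; exact: weak_vxy.
  + by rewrite sqrrN expr1n mul1e; exact: weak_vxx.
Qed.

Lemma v_continuous : {within Om, continuous (vfun f)}.
Proof.
apply: continuous_in_subspaceT => z; rewrite inE => Oz.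
have [fz|fz] := eqVneq (f z) 0; last first.
  exact: (v_cont hf fsmall (conj Oz fz : U z)).
apply/continuous_abscP => e e0; have e20 : 0 < e / 2 by rewrite divr_gt0.
have e2 : 0 < (e / 2)^-1^-1 by rewrite invrK.
(* Applied to e/2: near the zero L >= 2/e, hence v = 1/L <= e/2. *)
have [d d0 hd] := Lf_large dOm hf Oz fz e20; exists d => // w wd.
have [-> _ _ _] := zero_v fz; rewrite subr0.
have [fw|fw] := eqVneq (f w) 0; first by have [-> _ _ _] := zero_v fw; rewrite normr0.
have [Ow hL] := hd w wd fw.
have L1 := lnSf_gt1 fsmall (conj Ow fw : U w).
rewrite vfunE -/(Lf f w) gtr0_norm ?invr_gt0; last by rewrite /Lf; lra.
rewrite invf_plt ?posrE//; last by rewrite /Lf; lra.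
have : (e / 2)^-1 <= Lf f w by rewrite -[(e / 2)^-1]mul1r ler_pdivrMr//; lra.
apply: lt_le_trans; rewrite ltf_pV2 ?posrE//; lra.
Qed.

Lemma v_Linf : Lp_on +oo%E Om (vfun f).
Proof.
have [c1 z1 _] := dominated_v.
rewrite /Lp_on inE; apply/andP; split.
  rewrite inE; exact: (measurable_zero_ext dOm hf c1 z1).
rewrite inE /finite_norm /= unlock /Lnorm; case: ifPn => // _.
apply: (@le_lt_trans _ _ 1%:E); last exact: ltry.
apply/ess_supP; apply: aeW => p /=; rewrite lee_fin /patch.
case: ifPn; last by rewrite normr0.
rewrite inE => /(v_bound fsmall)/andP[v0 v1]; by rewrite ger0_norm.
Qed.

Lemma Lp2_of_sq u : dominated u -> (forall z, Om z -> `|u z| ^+ 2 <= 8 * (1 + Qf f z)) -> Lp_loc 2%:E Om u.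
Proof.
move=> [cu u0 _] uB K cK KO.
have mu := measurable_zero_ext dOm hf cu u0.
have mK := measurable_restrict_sub (measurable_compact_plane cK) KO mu.
rewrite /Lp_on inE; apply/andP; split; first by rewrite inE.
rewrite inE /finite_norm /= unlock /Lnorm; apply: poweR_lty.
have h := @intK_dom _ _ _ dOm hf nc fsmall (fun z => u z ^+ 2) 8 K cK KO.
have i : intK K (fun z => u z ^+ 2).
  apply: h.
  - exact: rcontX.
  - by move=> z /u0 ->; rewrite expr0n.
  - by move=> z /uB; rewrite normrX.
have /integrableP[_] := i; apply: le_lt_trans.
rewrite le_eqVlt; apply/orP; left; apply/eqP; apply: eq_integral => p _ /=.
rewrite /patch; case: ifPn => _; rewrite ?normr0 ?powR0 ?(pnatr_eq0 R 2)//.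
by rewrite normrX -powR_mulrn.
Qed.

Lemma vd_sq b z : U z -> `|vd f b z| ^+ 2 <= 8 * (1 + Qf f z).
Proof.
move=> Uz; have L1 := lnSf_gt1 fsmall Uz.
apply: le_trans (vd_sq_le fsmall b b Uz); rewrite normrM -expr2.
by rewrite ler_peMr ?sqr_ge0// /Lf ltW.
Qed.

Lemma Sobolev12 : Sobolev_loc 1 2%:E Om (vfun f).
Proof.
move=> i j ij; exists (wpart i j); split.
  by apply: weak_partial_v; rewrite (leq_trans ij).
case: i j ij => [|[|i]] [|[|j]]//= _.
- apply: (Lp2_of_sq dominated_v) => z Oz; have /andP[v0 v1] := v_bound fsmall Oz.
  rewrite ger0_norm//; have := Qf_ge0 fsmall Oz.
  have : vfun f z ^+ 2 <= 1 by exact: exprn_ile1.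
  lra.
- apply: (Lp2_of_sq (dominated_vd false)) => z Oz.
  have [fz|fz] := eqVneq (f z) 0; last exact: vd_sq.
  have [_ _ h _] := zero_v fz; rewrite /vd h normr0 expr0n /=.
  by have := Qf_ge0 fsmall Oz; lra.
- apply: (Lp2_of_sq (dominated_vd true)) => z Oz.
  have [fz|fz] := eqVneq (f z) 0; last exact: vd_sq.
  have [_ h _ _] := zero_v fz; rewrite /vd h normr0 expr0n /=.
  by have := Qf_ge0 fsmall Oz; lra.
Qed.

Lemma Sobolev21 : Sobolev_loc 2 1%:E Om (vfun f).
Proof.
move=> i j ij; exists (wpart i j); split; first exact: weak_partial_v.
by have [] := weak_partial_v ij.
Qed.

End Positive.

(** * The distributional Laplacian *)

Section Laplacian.
Context {R : realType}.
Implicit Types (z w : R[i]) (u : R[i] -> R).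

Lemma dd_cst b (c : R) z : dd b (fun=> c) z = 0.
Proof. by apply: is_dd_eq; exact: is_dd_cst. Qed.

Lemma Re_half (p q r s : R) :
  complex.Re (((p +i* q) + 'i * (r +i* s)) / 2%:R) = (p - s) / 2.
Proof.
have -> : (2%:R : R[i])^-1 = (2^-1)%:C by rewrite fmorphV rmorph_nat.
by rewrite /=; ring.
Qed.

Lemma Im_half (p q r s : R) :
  complex.Im (((p +i* q) + 'i * (r +i* s)) / 2%:R) = (q + r) / 2.
Proof.
have -> : (2%:R : R[i])^-1 = (2^-1)%:C by rewrite fmorphV rmorph_nat.
by rewrite /=; ring.
Qed.

Lemma d_zbar_real u w : d_zbar (fun w => (u w)%:C) w = (dx u w / 2) +i* (dy u w / 2).
Proof.
have x0 := dd_cst true 0 w; have y0 := dd_cst false 0 w.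
apply/eqP; rewrite eq_complex /d_zbar /dxC /dyC Re_half Im_half /=.
rewrite /dd in x0 y0.
have -> : dx (fun=> 0) w = 0 :> R by exact: x0.
have -> : dy (fun=> 0) w = 0 :> R by exact: y0.
by rewrite subr0 add0r !eqxx.
Qed.

(** This is 4 d_z d_zbar u = u_xx + u_yy. The first derivatives are prescribed on a whole disc
    because the outer operator differentiates them again. *)
Lemma laplacianE u (a b : R[i] -> R) z p q :
  (exists2 d : R, 0 < d & forall w, absc (w - z) < d -> is_dx u w (a w) /\ is_dy u w (b w)) ->
  is_dx a z p -> is_dy b z q -> laplacian u z = p + q.
Proof.
move=> [d d0 hd] ha hb.
have h1 : dx (fun w => complex.Re (d_zbar (fun w => (u w)%:C) w)) z = 2^-1 * p.
  suff k : is_dd true (fun w => complex.Re (d_zbar (fun w => (u w)%:C) w)) z (2^-1 * p).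
    exact: (is_dd_eq k).
  apply: (is_dd_near (b := true) _ (is_dxZ 2^-1 ha)); exists d => // w /hd[k _].
  by rewrite d_zbar_real /= mulrC; congr (_ / 2); apply/esym; exact: (@is_dd_eq R true u).
have h2 : dy (fun w => complex.Im (d_zbar (fun w => (u w)%:C) w)) z = 2^-1 * q.
  suff k : is_dd false (fun w => complex.Im (d_zbar (fun w => (u w)%:C) w)) z (2^-1 * q).
    exact: (is_dd_eq k).
  apply: (is_dd_near (b := false) _ (is_dyZ 2^-1 hb)); exists d => // w /hd[_ k].
  by rewrite d_zbar_real /= mulrC; congr (_ / 2); apply/esym; exact: (@is_dd_eq R false u).
rewrite /laplacian /d_z /dxC /dyC h1 h2.
(* A and B stand for the mixed derivatives; they enter only the imaginary part, as A - B. *)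
have -> (A B : R) : complex.Re (4%:R * (((2^-1 * p +i* A) - 'i * (B +i* (2^-1 * q))) / 2%:R)) = p + q.
  have -> : (2%:R : R[i])^-1 = (2^-1)%:C by rewrite fmorphV rmorph_nat.
  have -> : (4%:R : R[i]) = (4%:R : R)%:C by rewrite rmorph_nat.
  by rewrite /=; field.
by [].
Qed.

Variables (Om : set R[i]) (f : R[i] -> R[i]).
Hypothesis dOm : domain Om.
Hypothesis hf : hol Om f.
Hypothesis nc : ~ constant_on Om f.
Hypothesis fsmall : forall z, Om z -> absc (f z) < 1 / 10.
Let oOm : open Om. Proof. by case: dOm. Qed.
Local Notation U := (Uf Om f).
Local Notation area := (@area R).

Lemma gfunE z : Om z -> gfun f z = vxx f z + vyy f z.
Proof.
move=> Oz; rewrite /gfun; case: eqP => [/zero_v[_ _ _ [-> _ ->]]|/eqP fz]; first by rewrite addr0.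
have Uz : U z by [].
apply: (@laplacianE _ (vx f) (vy f)).
- have [d d0 hd] := open_absc (Uf_open oOm hf) Uz; exists d => // w /hd Uw.
  by split; [exact: (v_dx hf fsmall Uw)|exact: (v_dy hf fsmall Uw)].
- exact: (vx_dx oOm hf fsmall Uz).
- exact: (vy_dy oOm hf fsmall Uz).
Qed.

Lemma laplacian_test V phi z : test_function V phi -> laplacian phi z = dx (dx phi) z + dy (dy phi) z.
Proof.
move=> tp; have [c _ _] := tp.
apply: (@laplacianE _ (dx phi) (dy phi)).
- exists 1 => // w _; split.
    by have [_] := Ck_dd true (c 1%N); apply.
  by have [_] := Ck_dd false (c 1%N); apply.
- by have [_] := Ck_dd true (test_CkS tp true 1%N); apply.
- by have [_] := Ck_dd false (test_CkS tp false 1%N); apply.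
Qed.

Lemma eq_area_integral V u1 u2 : (forall z, V z -> u1 z = u2 z) -> area_integral V u1 = area_integral V u2.
Proof. by move=> h; apply: eq_integral => p; rewrite inE /= => /h ->. Qed.

Lemma area_integralD u1 u2 psi1 psi2 : dominated Om f u1 -> dominated Om f u2 ->
  test_function Om psi1 -> test_function Om psi2 ->
  area_integral Om (fun z => u1 z * psi1 z + u2 z * psi2 z) =
  (area_integral Om (fun z => (u1 z * psi1 z)%R) + area_integral Om (fun z => (u2 z * psi2 z)%R))%E.
Proof.
move=> [c1 z1 b1] [c2 z2 b2] t1 t2.
have i1 := integrable_test_mul dOm hf nc fsmall c1 z1 b1 t1.
have i2 := integrable_test_mul dOm hf nc fsmall c2 z2 b2 t2.
have mO : measurable (of_plane @^-1` Om : set (measurableTypeR R * measurableTypeR R)).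
  exact: measurable_open.
rewrite /area_integral; under eq_integral do rewrite EFinD.
by rewrite integralD//; apply: integrableS measurableT _ _ _; rewrite ?setTI//.
Qed.

Lemma g_L1 : Lp_loc 1%:E Om (gfun f).
Proof.
move=> K cK KO; apply/Lfun1_integrable.
have [c1 z1 b1] := dominated_vxx dOm hf fsmall.
have [c2 z2 b2] := dominated_vyy dOm hf fsmall.
have i1 : intK K (vxx f) := intK_dom dOm hf nc fsmall cK KO c1 z1 b1.
have i2 : intK K (vyy f) := intK_dom dOm hf nc fsmall cK KO c2 z2 b2.
have := integrableD measurableT i1 i2.
apply: eq_integrable => // p _ /=; rewrite -EFinD; congr (_%:E).
rewrite /patch; case: ifPn; last by rewrite addr0.
by rewrite inE => /KO/gfunE ->.
Qed.

Lemma g_distributional : distributional_laplacian Om (vfun f) (gfun f).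
Proof.
move=> phi tp.
have dv := dominated_v hf fsmall.
have d1 := dominated_vxx dOm hf fsmall; have d2 := dominated_vyy dOm hf fsmall.
have tx : test_function Om (dx (dx phi)) := test_dd true (test_dd true tp).
have ty : test_function Om (dy (dy phi)) := test_dd false (test_dd false tp).
rewrite (@eq_area_integral _ _ (fun z => vfun f z * dx (dx phi) z + vfun f z * dy (dy phi) z)); last first.
  by move=> z _; rewrite (laplacian_test z tp) mulrDr.
rewrite [RHS](@eq_area_integral _ _ (fun z => vxx f z * phi z + vyy f z * phi z)); last first.
  by move=> z Oz; rewrite (gfunE Oz) mulrDl.
rewrite (area_integralD dv dv tx ty) (area_integralD d1 d2 tp tp).
exact: (f_equal2 (fun x y => x + y)%E (weak_vxx dOm hf nc fsmall tp) (weak_vyy dOm hf nc fsmall tp)).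
Qed.

End Laplacian.

(** * Failure of higher integrability *)

Section Bump.
Context {R : realType}.
Implicit Types (al be : R -> R).

Fixpoint smooth1 (n : nat) al : Prop :=
  if n is m.+1 then exists al', (forall t : R, is_derive t (1 : R) al (al' t)) /\ smooth1 m al'
  else continuous al.

Lemma is_derive_continuous al (t l : R) : is_derive t (1 : R) al l -> {for t, continuous al}.
Proof. by move=> [d _]; apply: differentiable_continuous; apply/derivable1_diffP. Qed.

Lemma smooth1_cont n al : smooth1 n al -> continuous al.
Proof. by case: n => [//|n] [al' [d _]] t; exact: is_derive_continuous (d t). Qed.

Lemma smooth1W n al : smooth1 n.+1 al -> smooth1 n al.
Proof.
elim: n al => [|n ih] al; first exact: smooth1_cont.
by move=> [al' [d s]]; exists al'; split=> //; exact: ih.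
Qed.

Lemma smooth1D n al be : smooth1 n al -> smooth1 n be -> smooth1 n (fun t => al t + be t).
Proof.
elim: n al be => [|n ih] al be.
  by move=> ca cb t; apply: cvgD; [exact: ca|exact: cb].
move=> [al' [da sa]] [be' [db sb]]; exists (fun t => al' t + be' t); split; last exact: ih.
by move=> t; exact: is_deriveD1.
Qed.

Lemma smooth1M n al be : smooth1 n al -> smooth1 n be -> smooth1 n (fun t => al t * be t).
Proof.
elim: n al be => [|n ih] al be.
  by move=> ca cb t; apply: cvgM; [exact: ca|exact: cb].
move=> sal sbe; have [al' [da sa]] := sal; have [be' [db sb]] := sbe.
exists (fun t => al' t * be t + al t * be' t); split.
  by move=> t; exact: is_deriveM1.
by apply: smooth1D; apply: ih => //; exact: smooth1W.
Qed.

Lemma smooth1_cst n (c : R) : smooth1 n (fun=> c).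
Proof.
elim: n c => [|n ih] c; first by move=> t; exact: cvg_cst.
by exists (fun=> 0); split=> // t; exact: is_derive_cst.
Qed.

Lemma smooth1_affine n al (c k : R) : smooth1 n al -> smooth1 n (fun t => al (c * t + k)).
Proof.
have d t : is_derive t (1 : R) (fun t => c * t + k) c.
  have h := is_deriveD1 (is_deriveM1 (is_derive_cst c t (1 : R)) (is_derive_id t (1 : R)))
    (is_derive_cst k t (1 : R)).
  by apply: is_derive_ext h => //; rewrite mul0r add0r mulr1 addr0.
elim: n al => [|n ih] al.
  move=> ca t; apply: (@continuous_comp _ _ _ (fun t => c * t + k) al); last exact: ca.
  exact: is_derive_continuous (d t).
move=> [al' [da sa]]; exists (fun t => al' (c * t + k) * c); split.
  move=> t; exact: (@is_derive1_comp R al (fun t => c * t + k) t _ _ (da (c * t + k)) (d t)).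
by apply: smooth1M; [exact: ih|exact: smooth1_cst].
Qed.

(* The functions t^-k exp(-1/t) are closed under differentiation up to linear
   combinations, which gives smoothness at 0 by induction. *)
Definition flat (k : nat) (t : R) : R := if 0 < t then t^-1 ^+ k * expR (- t^-1) else 0.

(** With y = 1/t, exp(y) >= y^(k+2)/(k+2)!. The two extra powers leave t^2, which makes the
    derivative at 0 vanish. *)
Lemma flat_le k (t : R) : 0 <= flat k t <= k.+2`!%:R * t ^+ 2.
Proof.
rewrite /flat; case: ifPn => [t0|_]; last by rewrite lexx mulr_ge0 ?sqr_ge0.
have u0 : 0 < t^-1 by rewrite invr_gt0.
apply/andP; split; first by rewrite mulr_ge0 ?expR_ge0// exprn_ge0// ltW.
have h := expR_ge1Dxn k.+1 (ltW u0).
have fk : 0 < k.+2`!%:R :> R by rewrite ltr0n fact_gt0.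
have {}h : t^-1 ^+ k.+2 <= k.+2`!%:R * expR t^-1.
  rewrite mulrC -ler_pdivrMr//; apply: le_trans h; by rewrite lerDr.
rewrite expRN -ler_pdivlMr ?invr_gt0 ?expR_gt0// invrK.
have -> : t^-1 ^+ k = t^-1 ^+ k.+2 * t ^+ 2.
  by rewrite -addn2 exprD -mulrA -exprMn mulVf ?gt_eqF// expr1n mulr1.
have -> : k.+2`!%:R * t ^+ 2 * expR t^-1 = k.+2`!%:R * expR t^-1 * t ^+ 2 by ring.
by apply: ler_wpM2r => //; exact: sqr_ge0.
Qed.

Lemma flat_deriv k (t : R) : is_derive t (1 : R) (flat k) (- k%:R * flat k.+1 t + flat k.+2 t).
Proof.
have [t0|t0|t0] := ltgtP t 0.
- have h : is_derive t (1 : R) (fun=> (0 : R)) 0 by exact: is_derive_cst.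
  rewrite /flat ltNge (ltW t0) /= mulr0 addr0.
  apply: near_eq_is_derive h; near=> x; have x0 : x < 0 by near: x; exact: lt_nbhsl.
  by rewrite ltNge (ltW x0).
- have ti : t != 0 by rewrite gt_eqF.
  have d1 := is_deriveV1 (g := fun x => x) ti (is_derive_id t (1 : R)).
  have dX n : is_derive t (1 : R) (fun x => x^-1 ^+ n) (- n%:R * t^-1 ^+ n.+1).
    elim: n => [|n ih].
      rewrite oppr0 mul0r; have h : is_derive t (1 : R) (fun=> (1 : R)) 0 by exact: is_derive_cst.
      by apply: (is_derive_ext _ erefl h) => x; rewrite expr0.
    apply: is_derive_ext (is_deriveM1 d1 ih) => [x|]; first by rewrite -exprS.
    by rewrite -natr1 !exprS; field.
  have dE : is_derive t (1 : R) (fun x => expR (- x^-1)) (expR (- t^-1) * t^-1 ^+ 2).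
    have := @is_derive1_comp R (@expR R) (fun x => - x^-1) t _ _ (is_derive_expR (- t^-1)) (is_deriveN1 d1).
    apply: is_derive_ext => //; by field.
  have h := is_deriveM1 (dX k) dE.
  rewrite /flat t0.
  apply: near_eq_is_derive (is_derive_ext _ _ h) => //; last first.
    by rewrite !exprS; ring.
  near=> x; have x0 : 0 < x by near: x; exact: lt_nbhsr.
  by rewrite x0.
- rewrite t0 /flat ltxx mulr0 addr0.
  apply: is_derive0_eps => e e0.
  have fk : 0 < k.+2`!%:R :> R by rewrite ltr0n fact_gt0.
  exists (e / k.+2`!%:R); first by rewrite divr_gt0.
  move=> x xe; rewrite ltxx mul0r !subr0.
  have := flat_le k x; rewrite /flat => /andP[h0 h1].
  rewrite ger0_norm//; apply: (le_trans h1).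
  rewrite -(real_normK (num_real x)) expr2 mulrA ler_wpM2r//.
  by move: xe; rewrite ltr_pdivlMr// mulrC => /ltW.
Unshelve. all: by end_near.
Qed.

Lemma smooth1_flat n k : smooth1 n (flat k).
Proof.
elim: n k => [|n ih] k; first by move=> t; exact: is_derive_continuous (flat_deriv k t).
exists (fun t => - k%:R * flat k.+1 t + flat k.+2 t); split; first exact: flat_deriv.
by apply: smooth1D => //; apply: smooth1M => //; exact: smooth1_cst.
Qed.

(** The arguments are (t - x0)/e and (x0 + e - t)/e, both positive exactly on the interval ]x0, x0 +
    e[; they are spelled as c t + k to fit [smooth1_affine]. *)
Definition plateau (x0 e t : R) : R := flat 0 (e^-1 * t + - x0 / e) * flat 0 (- e^-1 * t + (1 + x0 / e)).

Lemma smooth1_plateau n x0 e : smooth1 n (plateau x0 e).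
Proof. by apply: smooth1M; apply: smooth1_affine; exact: smooth1_flat. Qed.

Lemma flat0_bounds (t : R) : 0 <= flat 0 t <= 1.
Proof.
rewrite /flat expr0 mul1r; case: ifPn => [t0|_]; last by rewrite lexx ler01.
by rewrite expR_ge0 expR_le1 oppr_le0 invr_ge0 ltW.
Qed.

Lemma plateau_bounds x0 e t : 0 <= plateau x0 e t <= 1.
Proof.
have /andP[h1 h2] := flat0_bounds (e^-1 * t + - x0 / e).
have /andP[h3 h4] := flat0_bounds (- e^-1 * t + (1 + x0 / e)).
by rewrite /plateau mulr_ge0// mulr_ile1.
Qed.

Lemma plateau_supp x0 e t : 0 < e -> plateau x0 e t != 0 -> x0 < t < x0 + e.
Proof.
move=> e0; rewrite /plateau mulf_eq0 negb_or => /andP[h1 h2].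
have k1 : 0 < e^-1 * t + - x0 / e by apply: contraNT h1; rewrite /flat => /negbTE ->.
have k2 : 0 < - e^-1 * t + (1 + x0 / e) by apply: contraNT h2; rewrite /flat => /negbTE ->.
have {}k1 : 0 < (t - x0) / e by move: k1; rewrite mulrBl mulrC mulNr.
have {}k2 : 0 < (x0 + e - t) / e.
  rewrite (_ : _ / _ = - e^-1 * t + (1 + x0 / e))//; by field; rewrite gt_eqF.
have ei : 0 < e^-1 by rewrite invr_gt0.
by move: k1 k2; rewrite !pmulr_lgt0// => ? ?; apply/andP; split; lra.
Qed.

(** On the middle half both arguments are at least 1/4, so each of the two factors is at least
    exp(-4). *)
Lemma plateau_lower x0 e t : 0 < e -> x0 + e / 4 <= t <= x0 + e * 3 / 4 -> expR (- 8) <= plateau x0 e t.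
Proof.
move=> e0 /andP[h1 h2].
have k1 : 4^-1 <= e^-1 * t + - x0 / e.
  have -> : e^-1 * t + - x0 / e = (t - x0) / e by rewrite mulrBl mulrC mulNr.
  by rewrite ler_pdivlMr//; lra.
have k2 : 4^-1 <= - e^-1 * t + (1 + x0 / e).
  have -> : - e^-1 * t + (1 + x0 / e) = (x0 + e - t) / e by field; rewrite gt_eqF.
  by rewrite ler_pdivlMr//; lra.
have E (s : R) : 4^-1 <= s -> expR (- 4) <= flat 0 s.
  move=> s4; have s0 : 0 < s by lra.
  rewrite /flat s0 expr0 mul1r ler_expR lerN2 -[leRHS]invrK lef_pV2 ?posrE//; lra.
have -> : - 8 = - 4 + - 4 :> R by ring.
rewrite expRD /plateau; apply: ler_pM; rewrite ?expR_ge0//; exact: E.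
Qed.

Definition tensor al be (z : R[i]) : R := al (complex.Re z) * be (complex.Im z).

Lemma tensor_continuous al be : continuous al -> continuous be -> continuous (tensor al be).
Proof.
move=> ca cb z.
have cR : {for z, continuous (fun w : R[i] => complex.Re w)}.
  by apply: (@rcont_Re R setT (fun w => w)) => // w _; exact: cvg_id.
have cI : {for z, continuous (fun w : R[i] => complex.Im w)}.
  by apply: (@rcont_Im R setT (fun w => w)) => // w _; exact: cvg_id.
have c1 : {for z, continuous (fun w : R[i] => al (complex.Re w))}.
  apply: (@cvg_comp _ _ _ (fun w : R[i] => complex.Re w) al (nbhs z) (nbhs (complex.Re z)) (nbhs (al (complex.Re z)))).
    exact: cR.
  exact: ca.
have c2 : {for z, continuous (fun w : R[i] => be (complex.Im w))}.
  apply: (@cvg_comp _ _ _ (fun w : R[i] => complex.Im w) be (nbhs z) (nbhs (complex.Im z)) (nbhs (be (complex.Im z)))).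
    exact: cI.
  exact: cb.
exact: (continuousM c1 c2).
Qed.

Lemma tensor_dx al be (al' : R -> R) : (forall t : R, is_derive t (1 : R) al (al' t)) ->
  forall z, is_dx (tensor al be) z (tensor al' be z).
Proof.
move=> da [x y]; apply/is_dxE; rewrite /tensor /=.
apply: is_derive_ext (is_deriveM1 (da x) (is_derive_cst (be y) x (1 : R))) => //.
by rewrite mulr0 addr0.
Qed.

Lemma tensor_dy al be (be' : R -> R) : (forall t : R, is_derive t (1 : R) be (be' t)) ->
  forall z, is_dy (tensor al be) z (tensor al be' z).
Proof.
move=> db [x y]; apply/is_dyE; rewrite /tensor /=.
apply: is_derive_ext (is_deriveM1 (is_derive_cst (al x) y (1 : R)) (db y)) => //.
by rewrite mul0r add0r.
Qed.

Lemma tensor_Ck n al be : smooth1 n al -> smooth1 n be -> Ck n (tensor al be).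
Proof.
elim: n al be => [|n ih] al be sa sb.
  by split=> //; exact: tensor_continuous.
have [al' [da sa']] := sa; have [be' [db sb']] := sb.
have E1 : dx (tensor al be) = tensor al' be.
  apply/funext => z; have k : is_dd true (tensor al be) z (tensor al' be z) := tensor_dx be da z.
  exact: (is_dd_eq k).
have E2 : dy (tensor al be) = tensor al be'.
  apply/funext => z; have k : is_dd false (tensor al be) z (tensor al be' z) := tensor_dy al db z.
  exact: (is_dd_eq k).
split; first by apply: tensor_continuous; [exact: (smooth1_cont sa)|exact: (smooth1_cont sb)].
split.
- move=> z; split; first by have [] : is_dx (tensor al be) z (tensor al' be z) := tensor_dx be da z.
  by have [] : is_dy (tensor al be) z (tensor al be' z) := tensor_dy al db z.
- by rewrite E1; apply: ih => //; exact: smooth1W.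
- by rewrite E2; apply: ih => //; exact: smooth1W.
Qed.

End Bump.

(** * Pairing an L^p function with a bump *)

Section Duality.
Context {R : realType}.
Implicit Types (phi w : R[i] -> R).
Local Notation mR := (measurableTypeR R).
Local Notation area := (@area R).

(** An essentially bounded function on a compact set has integrable powers; this reduces the
    exponent [+oo] to a finite one. *)
Lemma Lp_on_oo (r : R) K w : 1 <= r -> compact K -> Lp_on +oo%E K w -> Lp_on r%:E K w.
Proof.
move=> r1 cK; rewrite /Lp_on !inE => /andP[mw]; rewrite inE /finite_norm /= => fin.
rewrite inE in mw; apply/andP; split; first by rewrite inE.
rewrite inE /finite_norm /= unlock /Lnorm; apply: poweR_lty.
pose g := (w \_ K) \o of_plane : mR * mR -> R.
have [M hM] : exists M : R, {ae area, forall p, (`|g p|%:E <= M%:E)%E}.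
  move: fin; rewrite unlock /Lnorm; case: ifPn => [_|]; last first.
    (* The sup norm is defined by cases on whether the whole space has positive measure; the unit
       square excludes the other case. *)
    rewrite -leNgt => h _; exfalso; move: h; apply/negP; rewrite -ltNge.
    have [k k0 hk] : exists2 c : \bar R, (0 < c)%E & (c <= area [set: mR * mR])%E.
      exists 1%E; first exact: lte01.
      have -> : (1 = area (pbox 0 1 0 1))%E by rewrite area_box ?ler01// !subr0 mulr1.
      apply: le_measure; rewrite ?inE//; apply: measurableX; exact: measurable_itv.
    exact: lt_le_trans hk.
  (* The maximum with 0 excludes the value -oo, so that [fine] loses nothing. *)
  set e := ess_sup _ _ => ey; exists (fine (maxe e 0)).
  have := ess_sup_ge area (abse \o (fun p => (g p)%:E)).
  apply: filterS => p; rewrite /= => h; rewrite fineK.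
    by rewrite le_max h.
  by rewrite fin_numE -ltey gt_max ey ltry andbT gt_eqF// lt_max ltNyr orbT.
have [B B0 KB] := compact_bound_plane cK.
have i1 : intK K (fun=> `|M| `^ r).
  apply: (@intK_bounded _ _ _ (`|M| `^ r) B).
  - apply: (@measurable_restrict_sub R setT); [exact: measurable_compact_plane|by []|].
    rewrite patch_setT; exact: measurable_cst.
  - by move=> z _; rewrite ger0_norm ?powR_ge0.
  - by move=> z /KB h; split; apply: le_lt_trans h; [exact: ler_Re_absc|exact: ler_Im_absc].
have /integrableP[m1 ] := i1; apply: le_lt_trans.
apply: ae_ge0_le_integral => //.
- by move=> p _; rewrite lee_fin powR_ge0.
- apply/measurable_EFinP; apply: (measurableT_comp (measurable_powR _)).
  exact: measurableT_comp.
- exact: measurableT_comp.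
apply: filterS hM => p hp _; rewrite /= lee_fin; move: hp; rewrite lee_fin /g /= /patch.
case: ifPn => _ hp; last by rewrite !normr0 powR0// gt_eqF//; lra.
by rewrite [leRHS]ger0_norm ?powR_ge0// ge0_ler_powR ?nnegrE//; [lra|exact: (le_trans hp (ler_norm _))].
Qed.

(* With T = La / 2, the elementary bound |g| <= T + T (|g| / T)^p turns a
   function that pairs like one larger than La on supp phi into a small mass. *)
Lemma mass_bound (g phi W : mR * mR -> R) (p La : R) : 1 <= p -> 0 < La ->
  measurable_fun setT g -> area.-integrable setT (fun q => (`|g q| `^ p)%:E) ->
  area.-integrable setT (EFin \o phi) -> (forall q, 0 <= phi q <= 1) ->
  area.-integrable setT (fun q => (W q * phi q)%:E) ->
  (forall q, phi q != 0 -> La <= W q) ->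
  (\int[area]_q (g q * phi q)%:E = \int[area]_q (W q * phi q)%:E)%E ->
  fine (\int[area]_q (phi q)%:E)%E <=
    (La / 2)^-1 `^ p * fine (\int[area]_q (`|g q| `^ p)%:E)%E.
Proof.
move=> p1 L0 mg ig iphi phi01 iW WL E.
set T := La / 2; have T0 : 0 < T by rewrite divr_gt0.
set B := T^-1 `^ p.
have B0 : 0 <= B by exact: powR_ge0.
have pt q : `|g q * phi q| <= T * phi q + T * (B * `|g q| `^ p).
  have /andP[f0 f1] := phi01 q; rewrite normrM (ger0_norm f0).
  have P0 : 0 <= B * `|g q| `^ p by rewrite mulr_ge0// powR_ge0.
  have [h|h] := leP `|g q| T.
    have : `|g q| * phi q <= T * phi q by exact: ler_wpM2r.
    have : 0 <= T * (B * `|g q| `^ p) by rewrite mulr_ge0// ltW.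
    lra.
  have k : T^-1 * `|g q| <= B * `|g q| `^ p.
    rewrite /B -powRM ?invr_ge0 ?(ltW T0)//.
    have u1 : 1 <= T^-1 * `|g q| by rewrite mulrC ler_pdivlMr// mul1r ltW.
    by rewrite -[leLHS]powRr1 ?(le_trans ler01 u1)// ler_powR.
  have k2 : `|g q| <= T * (B * `|g q| `^ p).
    by have := ler_wpM2l (ltW T0) k; rewrite [T * (T^-1 * _)]mulrA mulfV ?gt_eqF// mul1r.
  have : `|g q| * phi q <= `|g q| by rewrite ler_piMr.
  have : 0 <= T * phi q by rewrite mulr_ge0// ltW.
  lra.
have i1 := integrableZl measurableT T iphi.
have i2 := integrableZl measurableT T (integrableZl measurableT B ig).
have i3 := integrableD measurableT i1 i2.
have igp : area.-integrable setT (fun q => (g q * phi q)%:E).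
  apply: le_integrable i3 => //.
    apply/measurable_EFinP; apply: measurable_funM => //.
    by apply/measurable_EFinP; case/integrableP: iphi.
  move=> q _; rewrite /= lee_fin; apply: (le_trans (pt q)); exact: ler_norm.
have h1 : (\int[area]_q (La * phi q)%:E <= \int[area]_q (W q * phi q)%:E)%E.
  apply: le_integral => //; first exact: (integrableZl measurableT La iphi).
  move=> q _; rewrite lee_fin; have /andP[f0 f1] := phi01 q.
  have [->|/WL h] := eqVneq (phi q) 0; first by rewrite !mulr0.
  exact: ler_wpM2r.
have h2 : (\int[area]_q (g q * phi q)%:E <=
    \int[area]_q (T%:E * (phi q)%:E + T%:E * (B%:E * (`|g q| `^ p)%:E)))%E.
  apply: le_integral => // q _; rewrite lee_fin; apply: le_trans (pt q); exact: ler_norm.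
have {h1} : (\int[area]_q (La%:E * (phi q)%:E) <=
    \int[area]_q (T%:E * (phi q)%:E + T%:E * (B%:E * (`|g q| `^ p)%:E)))%E.
  by apply: le_trans h2; rewrite E.
rewrite integralD// !integralZl//; last exact: (integrableZl measurableT B ig).
rewrite -(fineK (integrable_fin_num measurableT iphi)).
rewrite -(fineK (integrable_fin_num measurableT ig)) -!EFinM -EFinD lee_fin.
set I := fine _; set A := fine _ => h.
(* Since La = 2 T, half of the left-hand side absorbs the term T I, which leaves I <= B A. *)
rewrite -(ler_pM2l T0); have : La = T + T by rewrite /T; field.
move=> LE; have {}h : (T + T) * I <= T * I + T * (B * A) by rewrite -LE.
by rewrite mulrDl lerD2l in h.
Qed.

End Duality.

(** * Exponentials against powers of the logarithm *)

Section Growth.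
Context {R : realType}.

(** Here x is - log eps. In logarithms the left side is - p s x + 3 p log x + O(1) and the right
    side - 2 x + O(1), so the surplus k = p s - 2 decides. *)
Lemma exp_poly_dominates (p s C c A x0 : R) : 0 < C -> 0 < c -> 0 <= A -> 1 <= p -> 2 < p * s ->
  exists2 x : R, x0 <= x & (expR (s * x) / (C * x ^+ 3) / 2)^-1 `^ p * A < c * expR (- x) ^+ 2.
Proof.
move=> C0 c0 A0 p1 ps.
pose k := p * s - 2; have k0 : 0 < k by rewrite subr_gt0.
(* In log x <= d x - 1 - log d this slope makes 3 p log x cost only k x / 2 and a constant, half of
   the surplus k x. *)
pose d := k / (6 * p); have d0 : 0 < d by rewrite divr_gt0// mulr_gt0//; lra.
(* N collects all constants; the x chosen next satisfies k x / 2 >= |N| + 1. [A + 1] makes the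
   logarithm meaningful for A = 0. *)
pose N := p * ln (2 * C) + ln (A + 1) - ln c + 3 * p * (- 1 - ln d).
exists (`|x0| + 1 + 2 * (`|N| + 1) / k).
  have h : 0 <= 2 * (`|N| + 1) / k by apply: divr_ge0; [have := normr_ge0 N; lra|exact: ltW].
  by have := ler_norm x0; lra.
set x := _ + _.
have x1 : 1 <= x.
  have h : 0 <= 2 * (`|N| + 1) / k by apply: divr_ge0; [have := normr_ge0 N; lra|exact: ltW].
  by rewrite /x; have := normr_ge0 x0; lra.
have xk : 2 * (`|N| + 1) <= k * x.
  rewrite [k * x]mulrC -ler_pdivrMr// /x; have := normr_ge0 x0; lra.
have X0 : 0 < x by lra.
have lx : ln x <= d * x - 1 - ln d.
  have dx0 : 0 < d * x by rewrite mulr_gt0.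
  have := expR_ge1Dx (ln (d * x)); rewrite lnK ?posrE// => h.
  have h2 : ln (d * x) = ln d + ln x by rewrite lnM ?posrE.
  lra.
have T0 : 0 < expR (s * x) / (C * x ^+ 3) / 2.
  by rewrite !divr_gt0 ?expR_gt0// mulr_gt0// exprn_gt0.
have -> : (expR (s * x) / (C * x ^+ 3) / 2)^-1 `^ p = expR (p * (ln (2 * C) + 3 * ln x - s * x)).
  rewrite /powR gt_eqF ?invr_gt0//; congr (expR (p * _)).
  have x3 : 0 < x ^+ 3 by rewrite exprn_gt0.
  have q0 : 0 < 2 * C * x ^+ 3 by rewrite !mulr_gt0.
  have -> : (expR (s * x) / (C * x ^+ 3) / 2)^-1 = 2 * C * x ^+ 3 / expR (s * x).
    by field; rewrite !gt_eqF ?expR_gt0.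
  rewrite ln_div ?posrE ?expR_gt0// expRK lnM ?posrE ?mulr_gt0// lnXn//.
  by rewrite [3 * _]mulr_natl.
have -> : c * expR (- x) ^+ 2 = expR (ln c - 2 * x).
  rewrite expRD lnK ?posrE// -expRM_natl; congr (_ * expR _); ring.
apply: (@le_lt_trans _ _ (expR (p * (ln (2 * C) + 3 * ln x - s * x)) * (A + 1))).
  by rewrite ler_pM2l ?expR_gt0// lerDl.
have A1 : 0 < A + 1 by lra.
rewrite -{1}[A + 1]lnK ?posrE// -expRD ltr_expR.
have e1 : 3 * p * ln x <= 3 * p * (d * x - 1 - ln d) by rewrite ler_pM2l//; lra.
have e2 : 3 * p * (d * x - 1 - ln d) = k * x / 2 + 3 * p * (- 1 - ln d).
  by rewrite /d; field; lra.
have e3 : p * (ln (2 * C) + 3 * ln x - s * x) + ln (A + 1) =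
  p * ln (2 * C) + ln (A + 1) + 3 * p * ln x - (k * x + 2 * x) by rewrite /k; ring.
have nN := ler_norm N; rewrite e3; rewrite /N in nN xk *; lra.
Qed.

End Growth.

(** * Lower bounds for v_x and v_yy beside a zero *)

Section LowerBounds.
Context {R : realType}.
Variables (Om : set R[i]) (f : R[i] -> R[i]).
Hypothesis dOm : domain Om.
Hypothesis hf : hol Om f.
Hypothesis nc : ~ constant_on Om f.
Hypothesis fsmall : forall z, Om z -> absc (f z) < 1 / 10.
Implicit Types (z w : R[i]).
Let oOm : open Om. Proof. by case: dOm. Qed.

Lemma Re_natV (m : nat) (X Y : R) : complex.Re (m%:R / (X +i* Y)) = m%:R * (X / (X ^+ 2 + Y ^+ 2)).
Proof. by rewrite -(rmorph_nat (real_complex R)) /=; ring. Qed.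

Lemma Re_natV2 (m : nat) (X Y : R) : complex.Re (m%:R / (X +i* Y) ^+ 2) =
  m%:R * ((X / (X ^+ 2 + Y ^+ 2)) ^+ 2 - (Y / (X ^+ 2 + Y ^+ 2)) ^+ 2).
Proof. by rewrite -(rmorph_nat (real_complex R)) -exprVn expr2 /=; ring. Qed.

(** The crude log S <= S turns 1/(S log^2 S) into S^-3; the loss is only logarithmic in the distance
    to the zero. *)
Lemma D1_lower z : Uf Om f z -> (Sf f z ^+ 3)^-1 <= D1 f z.
Proof.
move=> Uz; have S4 := Sf_gt4 fsmall Uz; have L1 := lnSf_gt1 fsmall Uz.
rewrite /D1; set S := Sf f z in S4 L1 *.
have LS : ln S <= S.
  have S0 : S \is Num.pos by rewrite posrE; lra.
  by have := expR_ge1Dx (ln S); rewrite lnK//; lra.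
rewrite lef_pV2 ?posrE; first last.
- by rewrite mulr_gt0 ?exprn_gt0//; lra.
- by rewrite exprn_gt0//; lra.
rewrite [S ^+ 3]exprS ler_pM2l; last lra.
by rewrite lerXn2r// nnegrE; lra.
Qed.

(** A box with |Y| <= X/2, so that 1/(z - a) and 1/(z - a)^2 both have positive real part,
    comparable with their modulus. *)
Definition sector (a : R[i]) (e : R) : set R[i] := [set z | exists X Y : R,
  [/\ z - a = X +i* Y, e <= X, X <= 2 * e & `|Y| <= e / 2]].

Lemma partials_lower a : Om a -> f a = 0 -> exists C x0 : R, 0 < C /\
  forall x, x0 <= x -> forall z, sector a (expR (- x)) z ->
    expR (1 * x) / (C * x ^+ 3) <= vx f z /\ expR (2 * x) / (C * x ^+ 3) <= vyy f z.
Proof.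
move=> Oa fa; have [m [M [d [m0 M1 d0 d1 H]]]] := zero_structure dOm hf nc Oa fa.
(* From |f| >= e^m / M with e = exp(-x), S <= 2 m x + 2 log M <= C1 x once x >= 1. *)
pose C1 : R := 2 * m%:R + 2 * ln M.
have m1 : 1 <= (m%:R : R) by rewrite ler1n.
have lM : 0 <= ln M by exact: ln_ge0.
have C10 : 0 < C1 by rewrite /C1; lra.
(* By e (1 + x) <= 1 the threshold gives 3 e < d and 50 M e <= 1. The error M is then at most half
   of the main terms 1/(5 e) and 1/(25 e^2); the factor 25 is the one needed for v_yy. *)
exists (25 * C1 ^+ 3), (1 + 50 * M + 3 / d); split; first by rewrite mulr_gt0 ?exprn_gt0.
move=> x xl z [X [Y [zE X1 X2 Yl]]]; set e := expR (- x) in X1 X2 Yl.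
have e0 : 0 < e := expR_gt0 _.
have d3 : 0 < 3 / d by rewrite divr_gt0.
have ex : e * (1 + x) <= 1.
  rewrite /e expRN mulrC ler_pdivrMr ?expR_gt0// mul1r; exact: expR_ge1Dx.
have x1 : 1 <= x by lra.
have eM : 50 * M * e <= 1 by nra.
have ed : 3 * e < d.
  have k : 3 / d <= x by lra.
  have k2 : 3 <= d * x by rewrite mulrC -ler_pdivrMr.
  have : d * (e * (1 + x)) <= d by rewrite -[leRHS]mulr1 ler_pM2l.
  by have := mulr_gt0 d0 e0; nra.
have e1 : e <= 1 by nra.
have Y2 : Y ^+ 2 <= e ^+ 2 / 4.
  rewrite -(real_normK (num_real Y)).
  have := normr_ge0 Y; nra.
have nz : z - a = X +i* Y by [].
have az : absc (z - a) <= X + `|Y|.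
  rewrite zE; apply: (le_trans (ler_absc_ReIm _)); rewrite /= ger0_norm//; lra.
have az1 : e <= absc (z - a).
  rewrite zE; apply: (le_trans X1); apply: le_trans (ler_Re_absc _); exact: ler_norm.
have [Uz q1 q2 _ fM] := H z (ltac:(apply/andP; split; lra)).
have n0 : 0 < X ^+ 2 + Y ^+ 2 by have := sqr_ge0 Y; have := exprn_gt0 2 e0; nra.
have r1 : 1 / (5 * e) <= X / (X ^+ 2 + Y ^+ 2).
  rewrite ler_pdivlMr// mulrAC mul1r ler_pdivrMr ?mulr_gt0//; nra.
(* The real part of 1/(X + i Y)^2 is at least (3/4)/(17/4)^2 = 12/289 times e^-2, just above
   1/25. *)
have r2 : 1 / (25 * e ^+ 2) <= (X / (X ^+ 2 + Y ^+ 2)) ^+ 2 - (Y / (X ^+ 2 + Y ^+ 2)) ^+ 2.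
  have -> : (X / (X ^+ 2 + Y ^+ 2)) ^+ 2 - (Y / (X ^+ 2 + Y ^+ 2)) ^+ 2 =
    (X ^+ 2 - Y ^+ 2) / (X ^+ 2 + Y ^+ 2) ^+ 2.
    by field; rewrite gt_eqF.
  rewrite ler_pdivlMr ?exprn_gt0// mulrAC mul1r ler_pdivrMr ?mulr_gt0 ?exprn_gt0//.
  have s1 : X ^+ 2 + Y ^+ 2 <= 17 / 4 * e ^+ 2 by nra.
  have s2 : 3 / 4 * e ^+ 2 <= X ^+ 2 - Y ^+ 2 by nra.
  have s3 : (X ^+ 2 + Y ^+ 2) ^+ 2 <= (17 / 4 * e ^+ 2) ^+ 2.
    by rewrite lerXn2r// nnegrE; [exact: ltW|rewrite mulr_ge0// sqr_ge0].
  apply: (le_trans s3).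
  have s4 := sqr_ge0 e.
  apply: (@le_trans _ _ (3 / 4 * e ^+ 2 * (25 * e ^+ 2))).
    by have := sqr_ge0 (e ^+ 2); nra.
  by rewrite ler_wpM2r// mulr_ge0.
have Rq : 1 / (10 * e) <= complex.Re (qf f z).
  have h := le_trans (ler_Re_absc _) q1; rewrite ler_norml in h.
  move: h; rewrite zE raddfB /= Re_natV => /andP[h _].
  have k1 : 1 / (5 * e) <= m%:R * (X / (X ^+ 2 + Y ^+ 2)).
    apply: (le_trans r1); rewrite ler_peMl//; apply: le_trans r1.
    by rewrite divr_ge0// mulr_ge0// ltW.
  have k2 : M <= 1 / (10 * e) by rewrite ler_pdivlMr ?mulr_gt0//; nra.
  have k3 : 1 / (5 * e) = 1 / (10 * e) + 1 / (10 * e) by field; rewrite gt_eqF.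
  lra.
have Rq1 : complex.Re (qf1 f z) <= - (1 / (50 * e ^+ 2)).
  have h := le_trans (ler_Re_absc _) q2; rewrite ler_norml in h.
  move: h; rewrite zE raddfD /= Re_natV2 => /andP[_ h].
  set r := (_ - _) in r2 h.
  have k1 : 1 / (25 * e ^+ 2) <= m%:R * r.
    apply: (le_trans r2); rewrite ler_peMl//; apply: le_trans r2.
    by rewrite divr_ge0// mulr_ge0// sqr_ge0.
  have k2 : M <= 1 / (50 * e ^+ 2).
    rewrite ler_pdivlMr ?mulr_gt0 ?exprn_gt0//.
    have : e ^+ 2 <= e by rewrite expr2 ler_piMr// ltW.
    by nra.
  have k3 : 1 / (25 * e ^+ 2) = 1 / (50 * e ^+ 2) + 1 / (50 * e ^+ 2) by field; rewrite gt_eqF.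
  lra.
have [D10 _ D20 _ _] := D_facts fsmall Uz.
have S4 := Sf_gt4 fsmall Uz.
have Sx : Sf f z <= C1 * x.
  have f0 : 0 < absc (f z) by rewrite absc_gt0; case: Uz.
  rewrite /Sf expr2 lnM ?posrE//.
  have k1 : e ^+ m <= M * absc (f z).
    by apply: le_trans fM; rewrite lerXn2r// nnegrE ?absc_ge0 ?ltW.
  have k2 : m%:R * - x <= ln M + ln (absc (f z)).
    rewrite -lnM ?posrE//; last lra.
    have -> : m%:R * - x = ln (e ^+ m) by rewrite lnXn// expRK mulr_natl.
    by rewrite ler_ln ?posrE ?exprn_gt0// mulr_gt0//; lra.
  have k3 : ln M <= ln M * x by rewrite ler_peMr.
  by rewrite /C1; nra.
have Dl : 1 / (C1 * x) ^+ 3 <= D1 f z.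
  apply: le_trans (D1_lower Uz); rewrite mul1r lef_pV2 ?posrE ?exprn_gt0 ?mulr_gt0//; try lra.
  by rewrite lerXn2r// nnegrE; [lra|rewrite mulr_ge0//; lra].
have W1 : expR x = e^-1 by rewrite /e expRN invrK.
have W2 : expR (2 * x) = e^-1 ^+ 2 by rewrite -W1 -expRM_natl.
have Dg : 0 < 1 / (C1 * x) ^+ 3 by rewrite divr_gt0// exprn_gt0// mulr_gt0//; lra.
have ei : 0 < e^-1 by rewrite invr_gt0.
split.
- rewrite mul1r W1 /vx.
  have -> : e^-1 / (25 * C1 ^+ 3 * x ^+ 3) = 1 / (C1 * x) ^+ 3 * (e^-1 / 25).
    by field; rewrite !gt_eqF//; lra.
  apply: ler_pM => //; [exact: ltW|by rewrite divr_ge0// ltW|].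
  have k3 : 1 / (10 * e) = e^-1 / 10 by field; rewrite gt_eqF.
  by rewrite k3 in Rq; lra.
- rewrite W2 /vyy.
  have -> : e^-1 ^+ 2 / (25 * C1 ^+ 3 * x ^+ 3) = 1 / (C1 * x) ^+ 3 * (e^-1 ^+ 2 / 25).
    by field; rewrite !gt_eqF//; lra.
  have k4 : 0 <= D2 f z * (2 * complex.Im (qf f z)) ^+ 2 by rewrite mulr_ge0// sqr_ge0.
  have k3 : 1 / (50 * e ^+ 2) = e^-1 ^+ 2 / 50 by field; rewrite gt_eqF.
  rewrite k3 in Rq1.
  have : 1 / (C1 * x) ^+ 3 * (e^-1 ^+ 2 / 25) <= D1 f z * (2 * - complex.Re (qf1 f z)).
    by apply: ler_pM => //; [exact: ltW|by rewrite divr_ge0// sqr_ge0|lra].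
  lra.
Qed.

End LowerBounds.

(** * Bump functions on the box *)

Section TestBump.
Context {R : realType}.
Local Notation mR := (measurableTypeR R).
Local Notation area := (@area R).
Implicit Types (a z : R[i]) (e r : R).

Definition cdisk a r : set R[i] := [set z | absc (z - a) <= r].

Lemma closed_cdisk a r : closed (cdisk a r).
Proof.
rewrite -[cdisk a r]setCK; apply: open_closedC; apply: open_abscP => z /= /negP.
rewrite -ltNge => zr; exists (absc (z - a) - r); first by rewrite subr_gt0.
move=> w wz; apply/negP; rewrite -ltNge.
have := ler_abscD (z - w) (w - a); rewrite addrA subrK (absc_distC z w); lra.
Qed.

Lemma compact_cdisk a r : compact (cdisk a r).
Proof.
apply: subclosed_compact (@closed_cdisk a r) (@compact_pbox R (absc a + (r + 1))) _.
move=> z zr; apply: in_box_pbox; apply: bounded_in_box; rewrite /cdisk /= in zr; lra.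
Qed.

(** The offsets put the support into the box [sector a e]: abscissae between e and 2 e to the right
    of a, ordinates within e/2 of it. *)
Definition tbump a e : R[i] -> R :=
  tensor (plateau (complex.Re a + e) e) (plateau (complex.Im a - e / 2) e).

Lemma tbump_bounds a e z : 0 <= tbump a e z <= 1.
Proof.
have /andP[h1 h2] := plateau_bounds (complex.Re a + e) e (complex.Re z).
have /andP[h3 h4] := plateau_bounds (complex.Im a - e / 2) e (complex.Im z).
by rewrite /tbump /tensor mulr_ge0// mulr_ile1.
Qed.

Lemma tbump_sector a e z : 0 < e -> tbump a e z != 0 -> sector a e z.
Proof.
move=> e0; rewrite mulf_eq0 negb_or => /andP[/(plateau_supp e0)/andP[x1 x2] /(plateau_supp e0)/andP[y1 y2]].
exists (complex.Re z - complex.Re a), (complex.Im z - complex.Im a); split.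
- by case: (z) (a) => [p q] [s t].
- lra.
- lra.
- by rewrite ler_norml; apply/andP; split; lra.
Qed.

Lemma sector_cdisk a e z : 0 < e -> sector a e z -> cdisk a (3 * e) z.
Proof.
move=> e0 [X [Y [zE X1 X2 Yl]]]; rewrite /cdisk /= zE; apply: (le_trans (ler_absc_ReIm _)).
by rewrite /= (ger0_norm (_ : 0 <= X)); lra.
Qed.

Lemma tbump_test a e (V : set R[i]) : 0 < e -> cdisk a (3 * e) `<=` V -> test_function V (tbump a e).
Proof.
move=> e0 KV; have S : closure [set z | tbump a e z != 0] `<=` cdisk a (3 * e).
  rewrite (iffLR (closure_id _) (@closed_cdisk a (3 * e))); apply: closure_subset => z /= h.
  by apply: sector_cdisk => //; exact: tbump_sector.
split.
- by move=> n; apply: tensor_Ck; exact: smooth1_plateau.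
- apply: subclosed_compact (@compact_cdisk a (3 * e)) S; exact: closed_closure.
- exact: subset_trans S KV.
Qed.

Lemma tbump_integrable a e : 0 < e -> area.-integrable setT (EFin \o (tbump a e \o of_plane)).
Proof.
move=> e0; have tp := @tbump_test a e setT e0 (@subsetT _ _); have [c cs _] := tp.
have [B B0 hB] := supp_bound cs.
apply: (@integrable_continuous_box R (tbump a e) B); first exact: Ck_cont (c 0%N).
by move=> z h; apply: hB; exact: subset_closure.
Qed.

(** The middle halves of the two sides span a box of area e^2 / 4, on which each of the two plateaus
    is at least exp(-8). *)
Lemma tbump_mass a e : 0 < e ->
  expR (- 16) / 4 * e ^+ 2 <= fine (\int[area]_q (tbump a e (of_plane q))%:E)%E.
Proof.
move=> e0; have i := tbump_integrable a e0.
pose x1 := complex.Re a + e; pose y1 := complex.Im a - e / 2.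
pose P : set (mR * mR) := pbox (x1 + e / 4) (x1 + e * 3 / 4) (y1 + e / 4) (y1 + e * 3 / 4).
have mP : measurable P by apply: measurableX; exact: measurable_itv.
rewrite -lee_fin fineK; last exact: integrable_fin_num.
have -> : ((expR (- 16) / 4 * e ^+ 2)%:E = \int[area]_(q in P) (cst (expR (- 16))%:E q))%E.
  have aP : area P = ((e / 2) * (e / 2))%:E.
    by rewrite /P area_box; [congr (_%:E); field|lra|lra].
  transitivity ((expR (- 16))%:E * area P)%E; last exact: (esym (integral_cst area mP _)).
  by rewrite aP -EFinM; congr (_%:E); field.
have /integrableP[mt _] := i.
apply: (@le_trans _ _ (\int[area]_(q in P) (tbump a e (of_plane q))%:E)%E); last first.
  apply: ge0_subset_integral => // q _; rewrite lee_fin.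
  by have /andP[] := tbump_bounds a e (of_plane q).
apply: ge0_le_integral => //.
- by move=> q _; rewrite lee_fin expR_ge0.
- exact: (measurable_funS measurableT (@subsetT _ _) mt).
move=> [s t]; rewrite /P /pbox => -[/=]; rewrite !in_itv /= => hs ht; rewrite lee_fin.
have -> : - 16 = - 8 + - 8 :> R by ring.
rewrite expRD /tbump /tensor; apply: ler_pM; rewrite ?expR_ge0//; exact: plateau_lower.
Qed.

End TestBump.

(** * Weak derivatives outside L^p *)

Section Negative.
Context {R : realType}.
Variables (Om : set R[i]) (f : R[i] -> R[i]).
Hypothesis dOm : domain Om.
Hypothesis hf : hol Om f.
Hypothesis nc : ~ constant_on Om f.
Hypothesis fsmall : forall z, Om z -> absc (f z) < 1 / 10.
Implicit Types (z : R[i]).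
Local Notation mR := (measurableTypeR R).
Local Notation area := (@area R).
Let oOm : open Om. Proof. by case: dOm. Qed.

Lemma test_functionS (V W : set R[i]) (phi : R[i] -> R) : V `<=` W -> test_function V phi -> test_function W phi.
Proof. by move=> VW [c cs sV]; split=> //; exact: subset_trans sV VW. Qed.

Lemma area_integral_test (V : set R[i]) (u phi : R[i] -> R) : open V -> test_function V phi ->
  area_integral V (fun z => u z * phi z) = (\int[area]_q (u (of_plane q) * phi (of_plane q))%:E)%E.
Proof.
move=> oV [c cs sV]; apply: area_integral_supp; first exact: measurable_open.
move=> z nV; have nS : ~ supp phi z by move=> /sV.
by rewrite (phi_out nS) mulr0.
Qed.

(** The common core of both negative statements, with s = 1 for v_x and s = 2 for v_yy. The weak
    derivative w is known only through its pairings, which agree with those of the classical W;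
    testing with bumps of shrinking size contradicts [mass_bound]. *)
Lemma not_Lp_loc (a : R[i]) (V : set R[i]) (p s C x0 : R) (W w : R[i] -> R) :
  open V -> V a -> V `<=` Om -> 1 <= p -> 2 < p * s -> dominated Om f W -> 0 < C ->
  (forall x, x0 <= x -> forall z, sector a (expR (- x)) z -> expR (s * x) / (C * x ^+ 3) <= W z) ->
  (forall phi, test_function V phi ->
    area_integral V (fun z => w z * phi z) = area_integral V (fun z => W z * phi z)) ->
  ~ Lp_loc p%:E V w.
Proof.
move=> oV Va VO p1 ps [cW W0 WB] C0 lowW dual Lw.
have [d d0 hd] := open_absc oV Va.
pose r := d / 2; have r0 : 0 < r by rewrite divr_gt0.
pose K := cdisk a r.
have KV : K `<=` V by move=> z zr; apply: hd; rewrite /K /cdisk /= /r in zr; lra.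
have LK := Lw K (@compact_cdisk _ a r) KV.
(* The cut to a fixed disc K makes the integral of |g|^p a constant, independent of the size of the
   bump. *)
pose g : mR * mR -> R := (w \_ K) \o of_plane.
have ig : area.-integrable setT (fun q => (`|g q| `^ p)%:E) := Lfun_integrable p1 LK.
have mg : measurable_fun setT g by move: LK; rewrite /Lp_on inE => /andP[+ _]; rewrite inE.
have A0 : 0 <= fine (\int[area]_q (`|g q| `^ p)%:E)%E.
  by apply: fine_ge0; apply: integral_ge0 => q _; rewrite lee_fin powR_ge0.
have c0 : 0 < expR (- 16) / 4 :> R by rewrite divr_gt0// expR_gt0.
(* The threshold ensures both x >= x0 and, by e (1 + x) <= 1, that the disc of radius 3 e containing
   the bump lies in K. *)
have [x xl hx] := exp_poly_dominates (`|x0| + 3 / r + 1) C0 c0 A0 p1 ps.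
have r3 : 0 < 3 / r by rewrite divr_gt0.
have x0x : x0 <= x by have := ler_norm x0; lra.
have X0 : 0 < x by have := normr_ge0 x0; lra.
set e := expR (- x) in hx; have e0 : 0 < e := expR_gt0 _.
have er : 3 * e <= r.
  have ex : e * (1 + x) <= 1.
    by rewrite /e expRN mulrC ler_pdivrMr ?expR_gt0// mul1r; exact: expR_ge1Dx.
  have k : 3 / r <= x by have := normr_ge0 x0; lra.
  have k2 : 3 <= r * x by rewrite mulrC -ler_pdivrMr.
  have : r * (e * (1 + x)) <= r by rewrite -[leRHS]mulr1 ler_pM2l.
  by have := mulr_gt0 r0 e0; nra.
have eK : cdisk a (3 * e) `<=` K by move=> z; rewrite /K /cdisk /= => /le_trans; apply.
have tV : test_function V (tbump a e) by apply: tbump_test => //; exact: subset_trans eK KV.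
have tO := test_functionS VO tV.
pose La := expR (s * x) / (C * x ^+ 3).
have La0 : 0 < La by rewrite divr_gt0 ?expR_gt0// mulr_gt0// exprn_gt0.
have E := dual _ tV; rewrite !(area_integral_test _ oV tV) in E.
have := @mass_bound R g (tbump a e \o of_plane) (W \o of_plane) p La p1 La0 mg ig
  (tbump_integrable a e0) (fun q => tbump_bounds a e (of_plane q)).
move=> /(_ (integrable_test_mul dOm hf nc fsmall cW W0 WB tO)) h.
have : fine (\int[area]_q ((tbump a e \o of_plane) q)%:E)%E <=
   (La / 2)^-1 `^ p * fine (\int[area]_q (`|g q| `^ p)%:E)%E.
  apply: h.
  - by move=> q /= /(tbump_sector e0); exact: lowW.
  - rewrite -E; apply: eq_integral => q _; congr (_%:E); rewrite /g /= /patch.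
    case: ifPn => //; rewrite notin_setE => nK.
    suff -> : tbump a e (of_plane q) = 0 by rewrite !mulr0.
    apply/eqP; apply: contrapT => /negP h'; apply: nK; apply: eK.
    by apply: sector_cdisk => //; exact: tbump_sector.
move=> h2; have := tbump_mass a e0.
by move=> /le_trans/(_ h2); rewrite leNgt hx.
Qed.

(** For p = [+oo] the exponent 3 is taken; it exceeds k in both uses, where k is 2 or 1. *)
Lemma Lp_loc_finite (p : \bar R) (V : set R[i]) (w : R[i] -> R) (k : R) :
  k < 3 -> (k%:E < p)%E -> Lp_loc p V w -> exists2 r : R, k < r & Lp_loc r%:E V w.
Proof.
move=> k3; case: p => [p|_|]; last by [].
  by rewrite lte_fin => kp h; exists p.
move=> h; exists 3 => // K cK KV; apply: Lp_on_oo => //; [lra|exact: h].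
Qed.

Lemma not_Sobolev1 (p : \bar R) (a : R[i]) (V : set R[i]) : (2%:E < p)%E -> zeros Om f a ->
  open V -> V a -> V `<=` Om -> ~ Sobolev_loc 1 p V (vfun f).
Proof.
move=> p2 [Oa fa] oV Va VO /(_ 1%N 0%N isT)[w [[_ _ Hw] Lw]].
have k3 : 2 < 3 :> R by lra.
have [r r2 {}Lw] := Lp_loc_finite k3 p2 Lw.
have [C [x0 [C0 low]]] := partials_lower dOm hf nc fsmall Oa fa.
apply: (@not_Lp_loc a V r 1 C x0 (vd f true) w) Lw => //.
- lra.
- lra.
- exact: (dominated_vd dOm hf fsmall).
- by move=> x /low h z /h[].
move=> phi tp; have tO := test_functionS VO tp.
have := Hw phi tp; rewrite /partial /= addn0 expr1 EFinN mulN1e.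
have tdx : test_function V (dx phi) := test_dd true tp.
(* Test functions of V are test functions of Omega, and the integrals over V and over Omega both
   equal the one over the plane; so the formula on Omega identifies the pairings of w with those of
   v_x. *)
rewrite (area_integral_test _ oV tdx) -(area_integral_test _ oOm (test_functionS VO tdx)).
rewrite (weak_v dOm hf nc fsmall true tO) => /oppe_inj <-.
by rewrite (area_integral_test _ oV tp) (area_integral_test _ oOm tO).
Qed.

Lemma not_Sobolev2 (p : \bar R) (a : R[i]) (V : set R[i]) : (1%:E < p)%E -> zeros Om f a ->
  open V -> V a -> V `<=` Om -> ~ Sobolev_loc 2 p V (vfun f).
Proof.
move=> p2 [Oa fa] oV Va VO /(_ 0%N 2%N isT)[w [[_ _ Hw] Lw]].
have k3 : 1 < 3 :> R by lra.
have [r r2 {}Lw] := Lp_loc_finite k3 p2 Lw.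
have [C [x0 [C0 low]]] := partials_lower dOm hf nc fsmall Oa fa.
apply: (@not_Lp_loc a V r 2 C x0 (vyy f) w) Lw => //.
- lra.
- lra.
- exact: (dominated_vyy dOm hf fsmall).
- by move=> x /low h z /h[].
move=> phi tp; have tO := test_functionS VO tp.
have := Hw phi tp; rewrite /partial /= add0n sqrrN expr1n mul1e.
have tdy : test_function V (dy (dy phi)) := test_dd false (test_dd false tp).
rewrite (area_integral_test _ oV tdy) -(area_integral_test _ oOm (test_functionS VO tdy)).
rewrite (weak_vyy dOm hf nc fsmall tO) => <-.
by rewrite (area_integral_test _ oV tp) (area_integral_test _ oOm tO).
Qed.

End Negative.

Theorem theorem1p5 (R : realType) (Omega : set R[i]) (f : R[i] -> R[i])
  (domOmega : domain Omega)
  (holf : holomorphic_on Omega f)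
  (nonconstf : ~ constant_on Omega f)
  (Zf_neq0 : zeros Omega f !=set0)
  (f_small : forall z, Omega z -> absc (f z) < 1 / 10) :
  let v : R[i] -> R := vfun f in
  let g : R[i] -> R := gfun f in
  (({within Omega, continuous v} /\
    Lp_on +oo%E Omega v /\
    Sobolev_loc 1 2%:E Omega v) /\
   (forall (p : \bar R) (a : R[i]) (V : set R[i]),
      (2%:E < p)%E -> zeros Omega f a -> open V -> V a -> V `<=` Omega ->
      ~ Sobolev_loc 1 p V v)) /\
  Lp_loc 1%:E Omega g /\
  distributional_laplacian Omega v g /\
  (Sobolev_loc 2 1%:E Omega v /\
   (forall (p : \bar R) (a : R[i]) (V : set R[i]),
      (1%:E < p)%E -> zeros Omega f a -> open V -> V a -> V `<=` Omega ->
      ~ Sobolev_loc 2 p V v)).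
Proof.
have hf := holomorphic_hol holf.
split; last split; last split.
- split; last by move=> p a V p2 Za oV Va VO; exact: (not_Sobolev1 domOmega hf nonconstf f_small p2 Za oV Va VO).
  split; first exact: (v_continuous domOmega hf f_small).
  by split; [exact: (v_Linf domOmega hf f_small)|exact: (Sobolev12 domOmega hf nonconstf f_small)].
- exact: (g_L1 domOmega hf nonconstf f_small).
- exact: (g_distributional domOmega hf nonconstf f_small).
- split; first exact: (Sobolev21 domOmega hf nonconstf f_small).
  by move=> p a V p1 Za oV Va VO; exact: (not_Sobolev2 domOmega hf nonconstf f_small p1 Za oV Va VO).
Qed.
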